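(* Let $U_{11}(x)=\sum_\Gamma x^{b(\Gamma)}$, the sum over isomorphism classes of Yukawa 1PI graphs of vertex type (external legs exactly one boson leg, one incoming fermion leg and one outgoing fermion leg), with $b(\Gamma)$ the number of boson edges including the external boson leg. Then $$U_{11}(x)=x\left.\frac{C_{\ge2}(t)}{t^2}\right|_{t=C(x)^2/x}.$$
   Context: Yukawa graphs: each vertex incident to exactly one incoming fermion, one outgoing fermion and one boson half-edge; internal edges are directed fermion edges or boson edges; unpaired half-edges are external legs; fermion cycles allowed; isomorphisms preserve types and orientations and fix each external leg. 1PI: connected and remains connected after deleting any internal edge. $C(x)$ and $C_{\ge2}(x)$ are the ordinary generating functions of connected and of $2$-connected chord diagrams (perfect matchings of $\{1,\dots,2n\}$; connected means the intersection graph, with chords $\{a<b\},\{c<d\}$ adjacent iff $a<c<b<d$ or $c<a<d<b$, is connected; $2$-connected means connected, at least two chords, and connected after deleting any single chord). Note $C_{\ge2}(t)/t^2$ is a power series and $C(x)^2/x$ has zero constant term. *)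

(* Defs.v *)
From mathcomp Require Import all_boot all_order all_algebra all_fingroup.
Set Implicit Arguments. Unset Strict Implicit. Unset Printing Implicit Defensive.
Import GRing.Theory.

(* Yukawa graphs with vertex set 'I_V.                                 *)
(* Each vertex v carries an incoming fermion half-edge, an outgoing    *)
(* fermion half-edge and a boson half-edge.                            *)
(*  f v = Some w : the outgoing fermion half-edge of v is paired with  *)
(*                 the incoming fermion half-edge of w (directed       *)
(*                 fermion edge v -> w; w = v allowed).                *)
(*  f v = None   : the outgoing fermion half-edge of v is external.    *)
(*  p v = Some w : the boson half-edges of v and w form a boson edge.  *)
(*  p v = None   : the boson half-edge of v is an external leg.        *)
Definition ygraph (V : nat) := ({ffun 'I_V -> option 'I_V} * {ffun 'I_V -> option 'I_V})%type.

Definition vertex_type V (g : ygraph V) : bool :=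
  [&& [forall u, forall v, forall w,
         ((g.1 u == Some w) && (g.1 v == Some w)) ==> (u == v)],
      [forall u, forall v, (g.2 u == Some v) ==> ((g.2 v == Some u) && (u != v))],
      #|[set u | g.1 u == None]| == 1,
      #|[set w | [forall u, g.1 u != Some w]]| == 1
    & #|[set u | g.2 u == None]| == 1].

(* adjacency of vertices, after possibly deleting one internal edge:   *)
(* del = Some (true, s)  deletes the fermion edge leaving s,           *)
(* del = Some (false, s) deletes the boson edge at s.                  *)
Definition yadj V (g : ygraph V) (del : option (bool * 'I_V)) : rel 'I_V :=
  fun x y =>
    [|| (g.1 x == Some y) && (del != Some (true, x)),
        (g.1 y == Some x) && (del != Some (true, y))
      | [&& g.2 x == Some y, del != Some (false, x) & del != Some (false, y)]].

Definition yconnected V (g : ygraph V) del : bool :=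
  [forall x, forall y, connect (yadj g del) x y].

Definition onePI V (g : ygraph V) : bool :=
  [&& yconnected g None,
      [forall s, (g.1 s != None) ==> yconnected g (Some (true, s))]
    & [forall s, (g.2 s != None) ==> yconnected g (Some (false, s))]].

Definition bosons V (g : ygraph V) : nat :=
  (#|[set u | g.2 u != None]|./2).+1.

(* isomorphism: a vertex bijection preserving fermion edges (with      *)
(* orientation) and boson edges; external legs are then fixed, as      *)
(* there is exactly one of each type.                                  *)
Definition yiso V (g h : ygraph V) : bool :=
  [exists s : {perm 'I_V}, [forall v,
     (h.1 (s v) == omap s (g.1 v)) && (h.2 (s v) == omap s (g.2 v))]].

Definition U11_classes (V n : nat) : nat :=
  #|[set [set h | yiso g h] |
       g in [set g : ygraph V | [&& vertex_type g, onePI g & bosons g == n]]]|.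

(* coefficient of x^n in U11(x); a graph with b = n has 2n-1 vertices, *)
(* so summing over V <= 2n covers all graphs. *)
Definition U11 (n : nat) : nat := \sum_(V < n.*2.+1) U11_classes V n.

Definition perfect k (m : {ffun 'I_k -> 'I_k}) : bool :=
  [forall i, (m (m i) == i) && (m i != i)].

Definition chords k (m : {ffun 'I_k -> 'I_k}) : {set {set 'I_k}} :=
  [set [set i; m i] | i : 'I_k].

Definition crossing k (c d : {set 'I_k}) : bool :=
  [exists a : 'I_k, exists b : 'I_k, exists x : 'I_k, exists y : 'I_k,
     [&& c == [set a; b], d == [set x; y] &
         [&& a < x, x < b & b < y]%N || [&& x < a, a < y & y < b]%N]].

Definition gconnected k (S : {set {set 'I_k}}) : bool :=
  (S != set0) &&
  [forall c in S, forall d in S,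
     connect (fun x y => [&& x \in S, y \in S & crossing x y]) c d].

Definition chord_connected k (m : {ffun 'I_k -> 'I_k}) : bool :=
  gconnected (chords m).

Definition chord_2connected k (m : {ffun 'I_k -> 'I_k}) : bool :=
  [&& gconnected (chords m), 1 < #|chords m|
    & [forall e in chords m, gconnected (chords m :\ e)]].

Definition cC (n : nat) : nat :=
  #|[set m : {ffun 'I_(n.*2) -> 'I_(n.*2)} | perfect m && chord_connected m]|.
Definition cC2 (n : nat) : nat :=
  #|[set m : {ffun 'I_(n.*2) -> 'I_(n.*2)} | perfect m && chord_2connected m]|.

Local Open Scope ring_scope.
Definition fps := nat -> int.

Definition fps_of (a : nat -> nat) : fps := fun n => (a n)%:Z.
Definition fps_mul (a b : fps) : fps :=
  fun n => \sum_(i < n.+1) a i * b (n - i)%N.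
Definition fps_divx (a : fps) : fps := fun n => a n.+1.
Definition fps_divx2 (a : fps) : fps := fun n => a n.+2.
Definition fps_mulx (a : fps) : fps :=
  fun n => if n is n'.+1 then a n' else 0.
Definition fps_trunc (N : nat) (a : fps) : {poly int} := \poly_(i < N.+1) a i.
(* composition g(d(x)), for d with zero constant term: the coefficient *)
(* of x^n only depends on g_k, d_k for k <= n. *)
Definition fps_comp (g d : fps) : fps :=
  fun n => (\sum_(k < n.+1) g k *: (fps_trunc n d) ^+ k)`_n.

(* Main.v *)
(* Put S = C(x)/x. Erasing the first point turns a connected chord diagram into a
   word with one unmatched letter and no nonempty interval closed under the matching.
   The maximal proper intervals left by exactly one chord are disjoint, and
   contracting them gives a 2-connected diagram, whence
       S - 1 = \sum_(k >= 2) c_k x^(k-1) S^(2k-1) = x P(x S^2) S^3,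
   where P = C_{>=2}(t)/t^2 = \sum_k c_k t^(k-2). It remains to prove
   S - 1 = U11 S^3.

   Joining the three legs of a vertex-type graph to a root vertex makes 1PI mean that
   the closed graph is bridgeless and that no two-edge cut contains an edge at the root.
   Such graphs are rigid, so isomorphism classes are counted by labelled graphs. Let W
   count the bridgeless rooted graphs. Splitting off the largest set bounded by a
   two-edge cut through a given root half-edge costs a factor 1 + W, so
   W = (1 + W)^3 U11. A bridgeless graph with no two-edge cut through the root boson
   edge is a bridgeless graph with two marked fermion edges, hence
   1 + W = 1 + x (1 + W) (1 + 2 x d/dx) (1 + W). Removing the chord of the unmatched
   letter shows that S satisfies the same recurrence, so 1 + W = S. *)

(* Contracting an interval left by a single chord produces one letter whose partner lies outside.
   This is why diagrams are handled as words with one unmatched letter: such words can be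
   substituted for letters, and a diagram with k chords and its first point erased offers 2k-1
   places.

   A graph can be cut along a vertex set without naming the two parts canonically only if its
   vertices are labelled, so the graph series are exponential in the number of vertices; rigidity
   turns them back into the ordinary series of the statement.

   Diagrams and graphs are both encoded as involutions extended by the identity. A two-edge cut is
   opened by exchanging the partners of two half-edges of the same type, which keeps every vertex of
   the Yukawa kind; afterwards the involution preserves a vertex set and is a pair of independent
   involutions.

   The exponent 3 is the number of half-edges at the root. Treating them one at a time passes
   through the series (1 + 2x d/dx) S, reached once the boson half-edge is done. *)
Require Import Defs.
From mathcomp Require Import all_boot all_order all_algebra all_fingroup zify.
Set Implicit Arguments. Unset Strict Implicit. Unset Printing Implicit Defensive.

(** * Counting by bijections, classification and splitting of involutions *)

Section Counting.

Lemma card_can_in (S T : finType) (A : {set S}) (B : {set T})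
    (f : S -> T) (g : T -> S) :
  {in A, forall x, f x \in B} -> {in B, forall y, g y \in A} ->
  {in A, cancel f g} -> {in B, cancel g f} -> #|A| = #|B|.
Proof.
move=> fAB gBA fK gK; have finj := can_in_inj fK.
rewrite -(card_in_imset finj); apply: eq_card => y.
apply/imsetP/idP => [[x xA ->]|yB]; first exact: fAB.
by exists (g y); rewrite ?gK ?gBA.
Qed.

(** Classification by a relation rather than a function: existence and uniqueness of a decomposition
    become separate goals, and no witness has to be chosen. *)
Lemma card_classify (S I : finType) (A : {set S}) (rel : I -> S -> bool) :
  {in A, forall x, exists i, rel i x} ->
  (forall x i j, x \in A -> rel i x -> rel j x -> i = j) ->
  #|A| = \sum_i #|[set x in A | rel i x]|.
Proof.
move=> ex uniq.
transitivity (\sum_(x in A) \sum_i (rel i x : nat)).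
  rewrite -sum1_card; apply: eq_bigr => x xA.
  have [i ri] := ex x xA; rewrite (bigD1 i) //= ri big1 ?addn0 // => j ji.
  by case: (boolP (rel j x)) => // /(uniq _ _ _ xA ri) ij; rewrite ij eqxx in ji.
rewrite exchange_big; apply: eq_bigr => i _.
rewrite -sum1_card [LHS]big_mkcond [RHS]big_mkcond.
by apply: eq_bigr => x _; rewrite inE; case: (x \in A); case: (rel i x).
Qed.

(** [A] is halved according to which of [x] and [f x] comes first in the enumeration; [f] swaps the
    halves. *)
Lemma even_card_invol (E : finType) (A : {set E}) (f : E -> E) :
  {in A, forall x, f x \in A} -> {in A, forall x, f (f x) = x} ->
  {in A, forall x, f x != x} -> ~~ odd #|A|.
Proof.
move=> fA ff fx.
pose B := [set x in A | enum_rank x < enum_rank (f x)].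
pose C := [set x in A | enum_rank (f x) < enum_rank x].
have BC : #|B| = #|C|.
  apply: (@card_can_in _ _ _ _ f f) => x; rewrite !inE => /andP[xA];
  by rewrite ?ff ?fA.
have -> : A = B :|: C.
  apply/setP=> x; rewrite !inE; case: (boolP (x \in A)) => //= xA.
  case: ltngtP => // /val_inj /enum_rank_inj e.
  by move/fx: xA; rewrite -e eqxx.
rewrite cardsU BC (_ : B :&: C = set0) ?cards0 ?subn0 ?addnn ?odd_double //.
apply/setP=> x; rewrite !inE; case: (x \in A) => //=.
by case: ltngtP.
Qed.

End Counting.

Section JoinRes.
Variable E : finType.
Implicit Types (K : {set E}) (m : {ffun E -> E}).

Definition joinf K m1 m2 : {ffun E -> E} := [ffun x => if x \in K then m1 x else m2 x].
(** The restriction is extended by the identity, so that both parts of a split map keep the type of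
    the whole and [supported] tells where each may act. *)
Definition resf K m : {ffun E -> E} := [ffun x => if x \in K then m x else x].
Definition supported K m := [forall x, (x \notin K) ==> (m x == x)].

Lemma supportedP K m : reflect (forall x, x \notin K -> m x = x) (supported K m).
Proof.
apply: (iffP forallP) => [H x xK|H x]; first by move/implyP/(_ xK)/eqP: (H x).
by apply/implyP => xK; apply/eqP/H.
Qed.

Lemma joinf_res K m : joinf K (resf K m) (resf (~: K) m) = m.
Proof. by apply/ffunP => x; rewrite !ffunE inE; case: (x \in K). Qed.

Lemma resf_joinl K m1 m2 : supported K m1 -> resf K (joinf K m1 m2) = m1.
Proof.
move/supportedP=> s1; apply/ffunP => x; rewrite !ffunE.
by case: (boolP (x \in K)) => // /s1.
Qed.

Lemma resf_joinr K m1 m2 : supported (~: K) m2 -> resf (~: K) (joinf K m1 m2) = m2.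
Proof.
move/supportedP=> s2; apply/ffunP => x; rewrite !ffunE inE.
by case: (boolP (x \in K)) => //= xK; rewrite s2 // inE negbK.
Qed.

(** The source of all product formulas below, for diagrams ([E] the positions) and for graphs ([E]
    the half-edges) alike. *)
Lemma card_split K (P P1 P2 : pred {ffun E -> E}) :
  (forall m, P m -> P1 (resf K m) && P2 (resf (~: K) m)) ->
  (forall m1 m2, P1 m1 -> P2 m2 -> P (joinf K m1 m2)) ->
  (forall m, P1 m -> supported K m) -> (forall m, P2 m -> supported (~: K) m) ->
  #|[set m | P m]| = #|[set m | P1 m]| * #|[set m | P2 m]|.
Proof.
move=> H1 H2 s1 s2; rewrite -cardsX.
apply: (@card_can_in _ _ _ _ (fun m => (resf K m, resf (~: K) m))
                         (fun p => joinf K p.1 p.2)).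
- by move=> m; rewrite !inE => /H1.
- by move=> [m1 m2]; rewrite !inE /= => /andP[p1 p2]; apply: H2.
- by move=> m _; apply: joinf_res.
- move=> [m1 m2]; rewrite !inE /= => /andP[p1 p2].
  by rewrite resf_joinl ?resf_joinr ?s1 ?s2.
Qed.

End JoinRes.

(** * Matchings on words *)

Section Words.
Variable N : nat.
Implicit Types (X Y Z K : {set 'I_N}) (m : {ffun 'I_N -> 'I_N}).

(** Intervals are relative to the letter set [X], so subwords on scattered positions need no
    renumbering. The empty set is an interval. *)
Definition convex X Y := (Y \subset X) &&
  [forall x in Y, forall z in Y, forall y in X, (x <= y <= z) ==> (y \in Y)].

(* An unmatched letter counts as matched to a point outside the word. *)
Definition out m Y := \sum_(y in Y) ((m y \notin Y) || (m y == y) : nat).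

Definition fixpts m X := [set x in X | m x == x].

Definition matching X m := [forall x, m (m x) == x] && supported X m.

(* [word 0 1]: connected chord diagrams. [word 1 1]: the same with the first
   point erased, so that its partner is the unmatched letter. [word 1 2]:
   2-connected diagrams with the first point erased. *)
Definition word (o b : nat) X m :=
  [&& matching X m, #|fixpts m X| == o
    & [forall Y, (convex X Y && (b <= #|Y| < #|X|)) ==> (b <= out m Y)]].

Lemma convexP X Y : reflect
  (Y \subset X /\ forall x y z, x \in Y -> z \in Y -> y \in X -> x <= y -> y <= z -> y \in Y)
  (convex X Y).
Proof.
apply: (iffP andP) => -[YX H]; split=> //.
  move=> x y z xY zY yX xy yz.
  move/forall_inP/(_ x xY)/forall_inP/(_ z zY)/forall_inP/(_ y yX): H.
  by rewrite xy yz.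
apply/forall_inP=> x xY; apply/forall_inP=> z zY; apply/forall_inP=> y yX.
by apply/implyP=> /andP[xy yz]; apply: H xY zY yX xy yz.
Qed.

Lemma convexI X Y Z : convex X Y -> convex X Z -> convex X (Y :&: Z).
Proof.
move=> /convexP[YX cY] /convexP[ZX cZ]; apply/convexP; split.
  by rewrite subIset ?YX.
move=> x y z; rewrite !inE => /andP[? ?] /andP[? ?] ? ? ?.
by rewrite (cY x y z) ?(cZ x y z).
Qed.

Lemma convexU X Y Z : convex X Y -> convex X Z -> Y :&: Z != set0 ->
  convex X (Y :|: Z).
Proof.
move=> /convexP[YX cY] /convexP[ZX cZ] /set0Pn[c]; rewrite inE => /andP[cY' cZ'].
apply/convexP; split; first by rewrite subUset YX.
move=> x y z; rewrite !inE => xYZ zYZ yX xy yz.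
have [cy|yc] := leqP c y.
  by case/orP: zYZ => zi; [rewrite (cY c y z)|rewrite (cZ c y z) ?orbT].
by case/orP: xYZ => xi; [rewrite (cY x y c)|rewrite (cZ x y c) ?orbT] => //; lia.
Qed.

(** Since [Z] reaches outside [Y], removing it cannot leave pieces of [Y] on both of its sides. *)
Lemma convexD X Y Z : convex X Y -> convex X Z -> ~~ (Z \subset Y) ->
  convex X (Y :\: Z).
Proof.
move=> /convexP[YX cY] /convexP[ZX cZ] /subsetPn[c cZ' cY'].
apply/convexP; split; first by rewrite subDset subsetU ?YX ?orbT.
move=> x y z; rewrite !inE => /andP[xZ xY] /andP[zZ zY] yX xy yz.
rewrite (cY x y z) // andbT; apply/negP=> yZ; case/negP: cY'.
have cX := subsetP ZX c cZ'.
have [xc|cx] := leqP x c; last first.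
  by case/negP: xZ; apply: (cZ c x y) => //; [apply: (subsetP YX)|lia].
have [cz|zc] := leqP c z; first exact: (cY x c z).
by case/negP: zZ; apply: (cZ y z c) => //; [apply: (subsetP YX)|lia].
Qed.

Lemma convex_trans X Y Z : convex X Y -> convex Y Z -> convex X Z.
Proof.
move=> /convexP[YX cY] /convexP[ZY cZ]; apply/convexP; split.
  exact: subset_trans YX.
move=> x y z xZ zZ yX xy yz; apply: (cZ x y z) => //.
by apply: (cY x y z) => //; apply: (subsetP ZY).
Qed.

Lemma convexIsub X Y Z : Y \subset X -> convex X Z -> convex Y (Z :&: Y).
Proof.
move=> YX /convexP[ZX cZ]; apply/convexP; split; first exact: subsetIr.
move=> x y z; rewrite !inE => /andP[xZ _] /andP[zZ _] yY xy yz.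
by rewrite yY andbT (cZ x y z) // (subsetP YX).
Qed.

Lemma convex_sub X Y Z : Y \subset X -> convex X Z -> Z \subset Y -> convex Y Z.
Proof. by move=> YX cZ ZY; rewrite -(setIidPl ZY); apply: convexIsub cZ. Qed.

Lemma convex1 X x : x \in X -> convex X [set x].
Proof.
move=> xX; apply/convexP; split; first by rewrite sub1set.
by move=> y z t /set1P-> /set1P-> zX yz zy; apply/set1P/val_inj => /=; lia.
Qed.

Lemma out_eq m m' Y : {in Y, m =1 m'} -> out m Y = out m' Y.
Proof. by move=> e; apply: eq_bigr => y yY; rewrite e. Qed.

(** Submodularity, checked letter by letter; an unmatched letter leaves every set that contains
    it. *)
Lemma outD m Y Z : out m (Y :|: Z) + out m (Y :&: Z) <= out m Y + out m Z.
Proof.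
rewrite /out !(big_mkcond (fun x => x \in _)) -!big_split /=; apply: leq_sum => y _.
rewrite !inE; case: (y \in Y); case: (y \in Z); case: (m y \in Y); case: (m y \in Z);
by case: (m y == y).
Qed.

Lemma out_gt0P m Y :
  reflect (exists2 y, y \in Y & (m y \notin Y) || (m y == y)) (0 < out m Y).
Proof.
apply: (iffP idP) => [|[y yY H]]; last by rewrite /out (bigD1 y) //= H.
rewrite lt0n sum_nat_eq0 negb_forall => /existsP[y].
by rewrite negb_imply eqb0 negbK => /andP[yY H]; exists y.
Qed.

Lemma out0P m Y :
  reflect (forall y, y \in Y -> m y \in Y /\ m y != y) (out m Y == 0).
Proof.
rewrite eqn0Ngt; apply: (iffP negP) => [H y yY|H /out_gt0P[y /H[-> /negbTE->]]//].
split; [rewrite -[_ \in _]negbK|]; apply/negP=> h; apply: H; apply/out_gt0P;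
by exists y; rewrite ?h ?orbT.
Qed.

Lemma out_ge2 m Y y z : y \in Y -> z \in Y -> y != z ->
  (m y \notin Y) || (m y == y) -> (m z \notin Y) || (m z == z) -> 1 < out m Y.
Proof.
move=> yY zY yz Hy Hz; rewrite /out (bigD1 y) //= (bigD1 z) //=.
  by rewrite Hy Hz.
by rewrite zY eq_sym.
Qed.

Lemma out1P m Y :
  reflect (exists y, [/\ y \in Y, (m y \notin Y) || (m y == y) &
            forall z, z \in Y -> z != y -> m z \in Y /\ m z != z]) (out m Y == 1).
Proof.
apply: (iffP eqP) => [o1|[y [yY Hy Hz]]].
  have /out_gt0P[y yY Hy] : 0 < out m Y by rewrite o1.
  exists y; split=> // z zY zy; apply/andP; rewrite -[m z \in Y]negbK -negb_or.
  apply/negP=> Hz; have := out_ge2 yY zY _ Hy Hz; rewrite o1 => F.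
  by have := F _; rewrite eq_sym zy => /(_ isT).
rewrite /out (bigD1 y) //= Hy big1 // => z /andP[zY zy].
by have [-> /negbTE->] := Hz z zY zy.
Qed.

Lemma out_set1 m x : out m [set x] = 1.
Proof. by rewrite /out big_set1 inE; case: (m x == x). Qed.

Lemma matchingP X m : reflect
  ((forall x, m (m x) = x) /\ (forall x, x \notin X -> m x = x)) (matching X m).
Proof.
apply: (iffP andP) => -[H1 H2]; split.
- by move=> x; apply/eqP; apply/forallP: x.
- exact/supportedP.
- by apply/forallP => x; rewrite H1.
- exact/supportedP.
Qed.

Lemma matching_in X m x : matching X m -> x \in X -> m x \in X.
Proof.
move=> /matchingP[mm mX] xX; apply/negPn/negP=> mx.
by have := mX _ mx; rewrite mm => e; move: mx; rewrite -e xX.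
Qed.

Lemma out_full X m : matching X m -> out m X = #|fixpts m X|.
Proof.
move=> mX; rewrite -sum1_card /out [LHS]big_mkcond [RHS]big_mkcond.
apply: eq_bigr => x _; rewrite inE; case: ifP => //= xX.
by rewrite (matching_in mX) //=; case: eqP.
Qed.

Lemma matching_odd X m : matching X m -> odd #|X| = odd #|fixpts m X|.
Proof.
move=> mX; have /matchingP[mm _] := mX.
rewrite -(cardsID (fixpts m X) X) (setIidPr _); last by apply/subsetP=> x; rewrite inE => /andP[].
rewrite oddD (_ : odd #|X :\: _| = false) ?addbF //; apply/negbTE.
apply: (@even_card_invol _ _ m) => x; rewrite !inE // => /andP[nx xX].
- by rewrite (matching_in mX xX) mm andbT /= eq_sym; move: nx; rewrite xX.
- by move: nx; rewrite xX.
Qed.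

Lemma wordP o b X m : reflect
  [/\ matching X m, #|fixpts m X| = o &
   forall Y, convex X Y -> b <= #|Y| -> #|Y| < #|X| -> b <= out m Y] (word o b X m).
Proof.
apply: (iffP and3P) => -[mX /eqP fX /= H]; split=> //.
  by move=> Y cY bY YX; move/forallP/(_ Y)/implyP: H; apply; rewrite cY bY.
by apply/forallP=> Y; apply/implyP=> /andP[cY /andP[? ?]]; apply: H.
Qed.

Lemma word1P X m : reflect
  [/\ matching X m, #|fixpts m X| = 1 &
   forall Y, convex X Y -> Y != set0 -> 0 < out m Y] (word 1 1 X m).
Proof.
apply: (iffP (wordP 1 1 X m)) => -[mX fX H]; split=> // Y cY.
  move=> Y0; have [YX|XY] := ltnP #|Y| #|X|; first by apply: H; rewrite ?card_gt0.
  suff -> : Y = X by rewrite out_full ?fX.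
  by apply/eqP; rewrite eqEcard XY andbT; case/convexP: cY.
by rewrite card_gt0 => ? _; apply: H.
Qed.

Lemma matching_join X K m1 m2 : K \subset X -> matching K m1 -> matching (X :\: K) m2 ->
  matching X (joinf K m1 m2).
Proof.
move=> KX m1K m2K; have [mm1 s1] := matchingP _ _ m1K; have [mm2 s2] := matchingP _ _ m2K.
apply/matchingP; split=> x; rewrite !ffunE.
  case: (boolP (x \in K)) => xK; first by rewrite (matching_in m1K) ?mm1.
  case: (boolP (x \in X)) => xX.
    have: m2 x \in X :\: K by apply: (matching_in m2K); rewrite inE xK.
    by rewrite inE => /andP[/negbTE-> _]; rewrite mm2.
  by have e: m2 x = x; [rewrite s2 // inE (negbTE xX) andbF|rewrite !e (negbTE xK)].
move=> xX; case: ifP => [/(subsetP KX)|_]; first by rewrite (negbTE xX).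
by rewrite s2 // inE (negbTE xX) andbF.
Qed.

Lemma matching_resl X K m : matching X m -> (forall x, x \in K -> m x \in K) ->
  matching K (resf K m).
Proof.
move=> /matchingP[mm s] st; apply/matchingP; split=> x; rewrite !ffunE.
  case: (boolP (x \in K)) => xK; first by rewrite st.
  by rewrite (negbTE xK).
by case: ifP.
Qed.

Lemma matching_resr X K m : matching X m -> (forall x, x \in K -> m x \in K) ->
  matching (X :\: K) (resf (~: K) m).
Proof.
move=> /matchingP[mm s] st; apply/matchingP; split=> x; rewrite !ffunE !inE.
  case: (boolP (x \in K)) => xK /=; first by rewrite xK.
  case: (boolP (m x \in K)) => //= mK.
  by rewrite -[m x]mm; move/st: mK; rewrite mm (negbTE xK).
by case: (x \in K) => //=; apply: s.
Qed.

Lemma fixpts_join X K m1 m2 : K \subset X ->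
  fixpts (joinf K m1 m2) X = fixpts m1 K :|: fixpts m2 (X :\: K).
Proof.
move=> KX; apply/setP=> x; rewrite !inE ffunE.
case: (boolP (x \in K)) => xK //=; first by rewrite (subsetP KX) // orbF.
Qed.

Lemma fixpts1 X m j x : fixpts m X = [set j] -> x \in X -> (m x == x) = (x == j).
Proof. by move=> E xX; have := in_set1 x j; rewrite -E inE xX. Qed.

Lemma fixpts_eq m m' X : {in X, m =1 m'} -> fixpts m X = fixpts m' X.
Proof. by move=> e; apply/setP=> x; rewrite !inE; case: (boolP (x \in X)) => // /e->. Qed.

End Words.

(** * Transport of words to the positions 0, ..., n - 1 *)

Section Transport.
Variables (N : nat) (X : {set 'I_N}) (x0 : 'I_N) (x0X : x0 \in X).
Notation ev := (@enum_val _ (mem X)).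
Notation rk := (enum_rank_in x0X).
Implicit Types (m : {ffun 'I_N -> 'I_N}).

Lemma leq_enum_val (i j : 'I_#|X|) : (ev i <= ev j) = (i <= j).
Proof.
have lt (a b : 'I_#|X|) : a < b -> ev a < ev b.
  move=> ab; rewrite !(enum_val_nth x0).
  have S : sorted ltn (map val (enum X)).
    rewrite /(enum _) -enumT; apply: (subseq_sorted ltn_trans (s2 := map val (enum 'I_N))).
      by apply: map_subseq; apply: filter_subseq.
    by rewrite val_enum_ord iota_ltn_sorted.
  have := sorted_ltn_nth ltn_trans 0 S; move/(_ a b).
  rewrite !inE size_map -cardE !ltn_ord => /(_ isT isT ab).
  by rewrite !(nth_map x0) -?cardE ?ltn_ord.
by case: (ltngtP i j) => [/lt|/lt|/val_inj->]; lia.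
Qed.

Definition shrink m : {ffun 'I_#|X| -> 'I_#|X|} := [ffun i => rk (m (ev i))].
Definition expand (m : {ffun 'I_#|X| -> 'I_#|X|}) : {ffun 'I_N -> 'I_N} :=
  [ffun x => if x \in X then ev (m (rk x)) else x].

Lemma expandK : cancel expand shrink.
Proof.
by move=> m; apply/ffunP=> i; rewrite !ffunE enum_valP /= !enum_valK_in.
Qed.

Lemma shrinkK m : matching X m -> expand (shrink m) = m.
Proof.
move=> mX; apply/ffunP => x; rewrite !ffunE; case: ifP => xX.
  by rewrite !enum_rankK_in // (matching_in mX).
by have [_ ->] := matchingP _ _ mX; rewrite ?xX.
Qed.

Lemma expand_matching (m' : {ffun 'I_#|X| -> 'I_#|X|}) :
  matching setT m' -> matching X (expand m').
Proof.
move=> /matchingP[mm _]; apply/matchingP; split=> x; rewrite !ffunE.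
  case: (boolP (x \in X)) => xX; last by rewrite (negbTE xX).
  by rewrite enum_valP enum_valK_in mm enum_rankK_in.
by move/negbTE->.
Qed.

Lemma preim_enum_val (Y : {set 'I_N}) : Y \subset X ->
  [set ev i | i in [set i | ev i \in Y]] = Y.
Proof.
move=> YX; apply/setP=> y; apply/imsetP/idP => [[i]|yY]; first by rewrite inE => ? ->.
by exists (rk y); rewrite ?inE enum_rankK_in // (subsetP YX).
Qed.

Lemma word_shrink o b m : matching X m -> word o b setT (shrink m) = word o b X m.
Proof.
move=> mX; have [mm mn] := matchingP _ _ mX.
have evm i : ev (shrink m i) = m (ev i).
  by rewrite ffunE enum_rankK_in // (matching_in mX) // enum_valP.
have outE (Y : {set 'I_#|X|}) : out m (ev @: Y) = out (shrink m) Y.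
  rewrite /out big_imset; last by move=> ? ? _ _; apply: enum_val_inj.
  apply: eq_bigr => i _; rewrite -evm (inj_eq enum_val_inj).
  by rewrite (mem_imset _ _ enum_val_inj).
have cardE (Y : {set 'I_#|X|}) : #|ev @: Y| = #|Y|.
  by rewrite card_imset //; apply: enum_val_inj.
have convE (Y : {set 'I_#|X|}) : convex X (ev @: Y) = convex setT Y.
  apply/convexP/convexP => -[_ H]; split; rewrite ?subsetT //.
    move=> x y z xY zY _ xy yz; rewrite -(mem_imset _ _ (@enum_val_inj _ (mem X))).
    apply: (H (ev x) _ (ev z)); rewrite ?leq_enum_val ?enum_valP //;
    by rewrite (mem_imset _ _ enum_val_inj).
  - by apply/subsetP => _ /imsetP[i _ ->]; apply: enum_valP.
  - move=> _ y _ /imsetP[i iY ->] /imsetP[j jY ->] yX.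
    rewrite -(enum_rankK_in x0X yX) !leq_enum_val => iy yj.
    by rewrite (mem_imset _ _ enum_val_inj); apply: (H i _ j).
have fixE : #|fixpts (shrink m) setT| = #|fixpts m X|.
  rewrite -cardE; congr #|pred_of_set _|; apply/setP=> x; rewrite [RHS]inE.
  apply/imsetP/andP => [[i]|[xX /eqP mx]].
    by rewrite !inE /= => /eqP e ->; rewrite enum_valP -evm e.
  exists (rk x); last by rewrite enum_rankK_in.
  by rewrite !inE /=; apply/eqP/enum_val_inj; rewrite evm enum_rankK_in.
apply/wordP/wordP => -[mT fT H]; split=> //.
- by rewrite -fixE.
- move=> Y cY; have [YX _] := convexP _ _ cY.
  move: cY; rewrite -(preim_enum_val YX) convE cardE outE => cY bY YX'.
  by apply: H; rewrite ?cardsT ?card_ord.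
- apply/matchingP; split=> x; last by rewrite inE.
  by apply: (@enum_val_inj _ (mem X)); rewrite !evm mm.
- by rewrite fixE.
- move=> Y; rewrite -convE -cardE -outE cardsT card_ord; exact: H.
Qed.

End Transport.

Definition nword o b n := #|[set m : {ffun 'I_n -> 'I_n} | word o b setT m]|.

Lemma card_word N (X : {set 'I_N}) o b : X != set0 ->
  #|[set m | word o b X m]| = nword o b #|X|.
Proof.
case/set0Pn=> x0 x0X; apply: (@card_can_in _ _ _ _ (shrink x0X) (@expand _ _ _ x0X)).
- by move=> m; rewrite !inE => H; rewrite word_shrink //; case/and3P: H.
- move=> m; rewrite !inE => H; have mX : matching X (expand x0X m).
    by apply: expand_matching; case/and3P: H.
  by rewrite -(word_shrink x0X) // expandK.
- by move=> m; rewrite inE => /and3P[mX _ _]; apply: shrinkK.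
- by move=> m _; apply: expandK.
Qed.

Lemma nword_parity o b n : odd n != odd o -> nword o b n = 0.
Proof.
move=> no; apply: eq_card0 => m; rewrite inE; apply/negP=> /wordP[mX fX _].
by move: no; rewrite -fX -(matching_odd mX) cardsT card_ord eqxx.
Qed.

(** * Insertion of a word into a connected matching *)

Section Words.
Variable N : nat.
Implicit Types (X Y Z K : {set 'I_N}) (m : {ffun 'I_N -> 'I_N}).

Definition stable m Y := [forall y in Y, m y \in Y].

Lemma stableP m Y : reflect (forall y, y \in Y -> m y \in Y) (stable m Y).
Proof. exact: forall_inP. Qed.

Lemma stable_out m Y : stable m Y -> out m Y = #|fixpts m Y|.
Proof.
move=> /stableP sY; rewrite -sum1_card /out [LHS]big_mkcond [RHS]big_mkcond.
by apply: eq_bigr => x _; rewrite inE; case: ifP => //= xX; rewrite sY //=; case: eqP.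
Qed.

Lemma stableC X m Y : matching X m -> stable m Y -> stable m (X :\: Y).
Proof.
move=> mX; have [mm mn] := matchingP _ _ mX.
move=> /stableP sY; apply/stableP=> x; rewrite !inE => /andP[xY xX].
rewrite (matching_in mX xX) andbT; apply/negP => /sY.
by rewrite mm (negbTE xY).
Qed.

Lemma stableU m Y Z : stable m Y -> stable m Z -> stable m (Y :|: Z).
Proof.
move=> /stableP sY /stableP sZ; apply/stableP=> x; rewrite !inE.
by case/orP=> [/sY->|/sZ->]; rewrite ?orbT.
Qed.

Lemma stableI m Y Z : stable m Y -> stable m Z -> stable m (Y :&: Z).
Proof.
move=> /stableP sY /stableP sZ; apply/stableP=> x; rewrite !inE.
by case/andP=> /sY-> /sZ->.
Qed.

Lemma out0_stable m Y : out m Y = 0 -> stable m Y.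
Proof. by move/eqP/out0P=> H; apply/stableP => y /H[]. Qed.

End Words.

Section Insertion.
Variable n : nat.
Local Notation T := [set: 'I_n.+1].
Implicit Types (X Y Z K : {set 'I_n.+1}) (m : {ffun 'I_n.+1 -> 'I_n.+1}).

Definition insertion K m := [&& stable m K, word 1 1 K (resf K m)
  & word 0 1 (~: K) (resf (~: K) m)].

(** If [K] reached an end of the word, the rest would itself be an interval closed under the
    matching. So [K] must sit in an inner gap of the rest. *)
Definition interior K := [&& convex T K, K != set0, ord0 \notin K & ord_max \notin K].

Lemma resE K m : {in K, resf K m =1 m}.
Proof. by move=> x xK; rewrite ffunE xK. Qed.

Lemma convex_init K : convex T K -> ord0 \in K -> convex T (~: K).
Proof.
move=> /convexP[_ cK] K0; apply/convexP; split; first exact: subsetT.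
move=> x y z; rewrite !inE => xK zK _ xy yz; apply/negP=> yK.
by case/negP: xK; apply: (cK ord0 _ y); rewrite ?inE.
Qed.

Lemma convex_final K : convex T K -> ord_max \in K -> convex T (~: K).
Proof.
move=> /convexP[_ cK] K0; apply/convexP; split; first exact: subsetT.
move=> x y z; rewrite !inE => xK zK _ xy yz; apply/negP=> yK.
by case/negP: zK; apply: (cK y _ ord_max); rewrite ?inE //= -ltnS.
Qed.

(* [K] is the largest interval around the unmatched letter that avoids both ends
   of the word and contains no half of a chord. *)
Lemma insertion_ex m : 0 < n -> word 1 1 T m -> exists2 K, interior K & insertion K m.
Proof.
move=> n0 /word1P[mT /eqP/cards1P[j fixj] conn].
have [mm _] := matchingP _ _ mT.
have fixE x := fixpts1 fixj (in_setT x).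
have notstable Y : convex T Y -> stable m Y -> j \notin Y -> Y = set0.
  move=> cY sY jY; apply/eqP/negPn/negP => /(conn _ cY).
  rewrite stable_out // card_gt0 => /set0Pn[x]; rewrite !inE fixE => /andP[xY /eqP e].
  by rewrite -e xY in jY.
have mj : m j = j by apply/eqP; rewrite fixE.
have stabC Y : stable m Y -> stable m (~: Y).
  by rewrite -setTD; apply: stableC.
(* The complement of a closed interval containing an end is a closed interval; not containing [j],
   it is empty. *)
have ends Y (x : 'I_n.+1) : (x == ord0) || (x == ord_max) -> convex T Y ->
  stable m Y -> j \in Y -> x \in Y -> Y = T.
  move=> xe cY sY jY xY; suff: ~: Y = set0 by move/(congr1 (@setC _)); rewrite setCK setC0.
  apply: notstable; rewrite ?inE ?jY //; last exact: stabC.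
  by case/orP: xe => /eqP xe; [apply: convex_init|apply: convex_final]; rewrite // -xe.
pose P K := [&& interior K, stable m K & j \in K].
have Pj : P [set j].
  have cj : convex T [set j] by apply: convex1.
  have sj : stable m [set j] by apply/stableP=> y /set1P->; rewrite mj set11.
  have nT : [set j] != T.
    by apply/eqP => /(congr1 (fun A : {set _} => #|A|)); rewrite cards1 cardsT card_ord; lia.
  rewrite /P sj set11 !andbT /interior cj -card_gt0 cards1 /=.
  by apply/andP; split; apply/negP=> h; case/eqP: nT; apply: ends h; rewrite ?eqxx ?orbT ?set11.
have [K /maxsetP[/and3P[Ki sK jK] Kmax]] := ex_maxset (ex_intro (fun A => P A) _ Pj).
exists K => //; have /and4P[cK K0 K1 K2] := Ki.
have mK := matching_resl mT (stableP _ _ sK).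
have mK' := matching_resr mT (stableP _ _ sK); rewrite setTD in mK'.
apply/and3P; split=> //.
  apply/word1P; split=> //.
    apply/eqP/cards1P; exists j; apply/setP=> x; rewrite !inE ffunE.
    case: (boolP (x \in K)) => [xK|xK]; first by rewrite fixE.
    by apply/esym; apply: contraNF xK => /eqP->.
  move=> Y cY Y0; rewrite (@out_eq _ _ m); last first.
    by have [YK _] := convexP _ _ cY => x /(subsetP YK); apply: resE.
  by apply: conn Y0; apply: convex_trans cY.
apply/wordP; split=> //.
  apply/eqP; rewrite cards_eq0; apply/eqP/setP=> x; rewrite !inE ffunE inE.
  by case: (boolP (x \in K)) => //= xK; rewrite fixE; apply: contraNF xK => /eqP->.
move=> Y cY; have [YK cY'] := convexP _ _ cY; rewrite card_gt0 => Y0 YX; rewrite lt0n; apply/eqP.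
rewrite (@out_eq _ _ m) => [oY|]; last by move=> x /(subsetP YK); apply: resE.
have sY := out0_stable oY.
have jY : j \notin Y by apply/negP=> /(subsetP YK); rewrite inE jK.
have YKP x y : x \in Y -> y \in K -> x != y.
  by move=> /(subsetP YK); rewrite inE => xK yK; apply: contraNneq xK => ->.
have [cTY|] := boolP (convex T Y); first by rewrite (notstable _ cTY) ?eqxx in Y0.
move=> ncY.
(* [Y] is an interval of the rest but not of the word, so it surrounds [K]. Then [Y :|: K] is an
   admissible interval larger than [K], against maximality. *)
have [y1 [k [y2 [Hy1 Hk Hy2 y1k ky2]]]] :
  exists y1 k y2, [/\ y1 \in Y, k \in K, y2 \in Y, y1 <= k & k <= y2].
  move: ncY; rewrite /convex subsetT /= negb_forall_in => /exists_inP[y1 Hy1].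
  rewrite negb_forall_in => /exists_inP[y2 Hy2].
  rewrite negb_forall_in => /exists_inP[k _]; rewrite negb_imply => /andP[/andP[l1 l2] kY].
  exists y1, k, y2; split=> //; apply/negPn/negP => kK; case/negP: kY.
  by apply: (cY' y1 k y2); rewrite ?inE.
have [_ cK'] := convexP _ _ cK.
have cU : convex T (Y :|: K).
  apply/convexP; split; first exact: subsetT.
  move=> p q r; rewrite !inE => pYK rYK _ pq qr.
  case: (boolP (q \in K)) => qK; rewrite ?orbT // orbF.
  have [qk|kq] := leqP q k.
    have pY : p \in Y.
      case/orP: pYK => // pK; case/negP: qK; apply: (cK' p q k); by rewrite ?inE.
    by apply: (cY' p q y2); rewrite ?inE // (leq_trans qk ky2).
  have rY : r \in Y.
    case/orP: rYK => // rK; case/negP: qK; by apply: (cK' k q r); rewrite ?inE // ltnW.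
  by apply: (cY' y1 q r); rewrite ?inE // (leq_trans y1k (ltnW kq)).
have sU : stable m (Y :|: K) by apply: stableU.
have jU : j \in Y :|: K by rewrite inE jK orbT.
have nU : Y :|: K != T.
  apply/eqP => e; move: YX; rewrite ltnNge; case/negP; apply: subset_leq_card.
  by apply/subsetP=> x; rewrite inE => /negbTE xK; have := in_setT x; rewrite -e inE xK orbF.
have UK : Y :|: K = K.
  apply: Kmax; last exact: subsetUr.
  rewrite /P sU jU !andbT /interior cU /=.
  apply/and3P; split; first by apply/set0Pn; exists j.
  - by apply/negP=> h; case/eqP: nU; apply: ends h; rewrite ?eqxx.
  - by apply/negP=> h; case/eqP: nU; apply: ends h; rewrite ?eqxx ?orbT.
by move: (YKP y1 y1 Hy1); rewrite eqxx -UK inE Hy1 => /(_ isT).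
Qed.

(** [K2 :\: K1] is an interval of the diagram outside [K1], closed under [m] and missing the first
    letter; connectedness of that diagram leaves it empty. *)
Lemma insertion_sub m K1 K2 : word 1 1 T m -> interior K1 -> interior K2 ->
  insertion K1 m -> insertion K2 m -> K2 \subset K1.
Proof.
move=> /word1P[mT /eqP/cards1P[j fixj] _] /and4P[c1 _ K10 _] /and4P[c2 _ K20 _].
case/and3P=> s1 w1 v1 /and3P[s2 w2 v2].
have fixE x := fixpts1 fixj (in_setT x).
have jK K : word 1 1 K (resf K m) -> j \in K.
  move=> /word1P[_ /eqP/cards1P[x fx] _]; have : x \in [set x] by rewrite set11.
  by rewrite -fx inE ffunE => /andP[xK]; rewrite xK fixE => /eqP <-.
have j1 := jK _ w1; rewrite -setD_eq0.
have sY : stable m (K2 :\: K1) by rewrite setDE; apply: stableI; rewrite // -setTD; apply: stableC.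
apply/negPn/negP=> Y0; have [_ _] := wordP _ _ _ _ v1.
move/(_ (K2 :\: K1)); rewrite (@out_eq _ _ m) => [|x]; last first.
  by rewrite inE => /andP[xK _]; rewrite resE // inE.
rewrite stable_out // (_ : fixpts _ _ = set0) ?cards0; last first.
  apply/setP=> x; rewrite !inE fixE; apply/negP => /andP[/andP[xK _] /eqP e].
  by rewrite e j1 in xK.
rewrite card_gt0 => H; suff: false by []; apply: H => //.
  have := @convexIsub _ T (~: K1) K2 (subsetT _) c2.
  by rewrite -setDE.
apply: proper_card; apply/properP; split; first by apply/subsetP=> x; rewrite !inE => /andP[].
by exists ord0; rewrite !inE // (negbTE K20) andbF.
Qed.

(** A closed interval without unmatched letter cannot meet [K], because its trace there would be
    closed too. Outside [K] it must be the whole diagram, and then it contains both ends of the word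
    and hence [K]. *)
Lemma insertion_word m1 m2 K : interior K -> word 1 1 K m1 -> word 0 1 (~: K) m2 ->
  word 1 1 T (joinf K m1 m2).
Proof.
move=> /and4P[cK K0 Kz Km] /word1P[M1 f1 c1] /wordP[M2 f2 c2].
have mT : matching T (joinf K m1 m2).
  by apply: matching_join; rewrite ?subsetT // setTD.
apply/word1P; split=> //.
  rewrite fixpts_join ?subsetT // setTD.
  by move/eqP: f2; rewrite cards_eq0 => /eqP->; rewrite setU0.
have eK x : x \in K -> joinf K m1 m2 x = m1 x by move=> xK; rewrite ffunE xK.
have eK' x : x \notin K -> joinf K m1 m2 x = m2 x by move=> xK; rewrite ffunE (negbTE xK).
move=> Y cY Y0; rewrite lt0n; apply/eqP => oY.
have sY := out0_stable oY.
have nf x : x \in Y -> joinf K m1 m2 x != x by move=> xY; move/eqP/out0P: oY => /(_ x xY)[].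
have sK : stable (joinf K m1 m2) K.
  by apply/stableP=> x xK; rewrite eK // (matching_in M1).
have [YK|] := eqVneq (Y :&: K) set0; last first.
  move=> YK; have := c1 _ (convexIsub (subsetT _) cY) YK.
  rewrite -(@out_eq _ (joinf K m1 m2)) => [|x]; last by rewrite inE => /andP[_ /eK].
  rewrite stable_out ?stableI // card_gt0 => /set0Pn[x]; rewrite !inE => /andP[/andP[xY _]].
  by apply/negP/nf.
have YC : Y \subset ~: K by rewrite subsetC -disjoints_subset disjoint_sym -setI_eq0 YK.
have oC : out m2 Y = 0.
  by rewrite -oY; apply: out_eq => x /(subsetP YC); rewrite inE => /eK'.
have cC := convex_sub (subsetT (~: K)) cY YC.
have [lt|ge] := ltnP #|Y| #|~: K|.
  by have := c2 Y cC; rewrite card_gt0 oC => /(_ Y0 lt).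
have YE : Y = ~: K by apply/eqP; rewrite eqEcard YC.
have [_ cY'] := convexP _ _ cY; case/set0Pn: K0 => k kK.
have : k \in Y by apply: (cY' ord0 k ord_max); rewrite ?YE ?inE //= -ltnS.
by rewrite YE inE kK.
Qed.

Definition segment (a l : nat) : {set 'I_n.+1} := [set i : 'I_n.+1 | a <= i < a + l].

Lemma card_segment a l : a + l <= n.+1 -> #|segment a l| = l.
Proof.
move=> aln; have lt (i : 'I_l) : a + i < n.+1 by have := ltn_ord i; lia.
rewrite -[RHS]card_ord -(@card_imset _ _ (fun i : 'I_l => inord (a + i) : 'I_n.+1)).
  congr #|pred_of_set _|; apply/setP=> i; rewrite inE; apply/idP/imsetP => [ai|[j _ ->]].
    have il : i - a < l by lia.
    have [ai1 _] := andP ai.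
    by exists (Ordinal il); rewrite //= subnKC // inord_val.
  by rewrite inordK ?lt // leq_addr ltn_add2l ltn_ord.
move=> i j /(congr1 val) /=; by rewrite !inordK ?lt // => /addnI/val_inj.
Qed.

Lemma interiorP K : interior K ->
  exists a l, [/\ 0 < a, 0 < l, a + l <= n & K = segment a l].
Proof.
move=> /and4P[/convexP[_ cK] /set0Pn[k kK] K0 Km].
pose a := [arg min_(i < k in K) i]; pose b := [arg max_(i > k in K) i].
have [aK amin] : a \in K /\ forall i, i \in K -> a <= i.
  by rewrite /a; case: arg_minnP.
have [bK bmax] : b \in K /\ forall i, i \in K -> i <= b.
  by rewrite /b; case: arg_maxnP.
have ab := amin _ bK; exists a, (b - a).+1; split=> //.
- by rewrite lt0n; apply: contraNneq K0 => a0; rewrite (_ : ord0 = a) //; apply: val_inj.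
- have bn : b != n :> nat.
    by apply: contraNneq Km => bn; rewrite (_ : ord_max = b) //; apply: val_inj.
  by have := ltn_ord b; lia.
- apply/setP=> i; rewrite inE; apply/idP/andP => [iK|[ai ib]].
    by have := bmax _ iK; have := amin _ iK; lia.
  by apply: (cK a i b); rewrite ?inE //; lia.
Qed.

Lemma segment_interior a l : 0 < a -> 0 < l -> a + l <= n -> interior (segment a l).
Proof.
move=> a0 l0 aln; apply/and4P; split.
- apply/convexP; split; first exact: subsetT.
  by move=> x y z; rewrite !inE; lia.
- by rewrite -card_gt0 card_segment //; lia.
- by rewrite inE /=; lia.
- by rewrite inE /=; lia.
Qed.

Lemma segment_inj a l a' l' : 0 < l -> a + l <= n -> 0 < l' -> a' + l' <= n ->
  segment a l = segment a' l' -> (a = a') * (l = l').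
Proof.
move=> l0 al l0' al' e.
have E i : i < n.+1 -> (a <= i < a + l) = (a' <= i < a' + l').
  by move=> ni; have := congr1 (fun A : {set _} => inord i \in A) e; rewrite !inE !inordK.
have := E (a' + l').-1; have := E (a + l).-1; have := E a'; have := E a.
split; lia.
Qed.

(** The inserted word has [l.+1] letters and the surrounding diagram [n - l] points, which have
    [(n - l).-1] inner gaps. *)
Lemma nword_insertion : 0 < n -> nword 1 1 n.+1 =
  \sum_(l < n) (n - l) .-1 * (nword 1 1 l.+1 * nword 0 1 (n - l)).
Proof.
(* A pair holds the start and the length, both lowered by one; [ok] keeps the last letter out of the
   segment. *)
move=> n0; pose seg (p : 'I_n * 'I_n) := segment p.1.+1 p.2.+1.
pose ok (p : 'I_n * 'I_n) := p.1.+1 + p.2.+1 <= n.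
have okI p : ok p -> interior (seg p) by move=> okp; apply: segment_interior.
rewrite /nword (@card_classify _ ('I_n * 'I_n)%type _
    (fun p m => ok p && insertion (seg p) m)); first last.
- move=> m p q; rewrite inE => wm /andP[okp ip] /andP[okq iq].
  have e : seg p = seg q.
    by apply/eqP; rewrite eqEsubset !(insertion_sub wm) ?okI.
  have [e1 e2] := segment_inj (ltn0Sn _) okp (ltn0Sn _) okq e.
  case: p q e1 e2 {okp okq ip iq e} => [p1 p2] [q1 q2] /= [/val_inj->] [/val_inj->] //.
- move=> m; rewrite inE => wm; have [K iK insK] := insertion_ex n0 wm.
  have [a [l [a0 l0 al eK]]] := interiorP iK.
  have ha : a.-1 < n by lia.
  have hl : l.-1 < n by lia.
  by exists (Ordinal ha, Ordinal hl); rewrite /ok /seg /= !prednK // al -eK.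
transitivity (\sum_(p : 'I_n * 'I_n) if ok p then nword 1 1 p.2.+1 * nword 0 1 (n - p.2) else 0).
  apply: eq_bigr => p _; case: ifP => okp; last first.
    by apply: eq_card0 => m; rewrite !inE /= andbF.
  have cs : #|seg p| = p.2.+1 by rewrite card_segment //; move: okp; rewrite /ok; lia.
  have cs' : #|~: seg p| = n - p.2.
    by have := cardsC (seg p); rewrite cs card_ord; move: okp; rewrite /ok; lia.
  rewrite -{1}cs -cs' -!card_word; first last.
  - by rewrite -card_gt0 cs.
  - by rewrite -card_gt0 cs' subn_gt0 ltn_ord.
  rewrite -(@card_split _ (seg p) (fun m => word 1 1 T m && insertion (seg p) m)).
  - by apply: eq_card => m; rewrite !inE /=.
  - by move=> m /andP[_ /and3P[_ -> ->]].
  - move=> m1 m2 w1 w2; rewrite insertion_word ?okI //=.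
    have [/matchingP[_ s1] _ _] := wordP _ _ _ _ w1.
    have [/matchingP[_ s2] _ _] := wordP _ _ _ _ w2.
    apply/and3P; split; last first.
    + by rewrite resf_joinr //; apply/supportedP.
    + by rewrite resf_joinl //; apply/supportedP.
    by apply/stableP => x xK; rewrite ffunE xK; apply: matching_in xK; case/and3P: w1.
  - by move=> m /and3P[/andP[]].
  - by move=> m /and3P[/andP[]].
rewrite -big_mkcond -(pair_big_dep xpredT (fun i j => ok (i, j)) (fun i j => nword 1 1 j.+1 * nword 0 1 (n - j))) /=.
rewrite (exchange_big_dep xpredT) //=; apply: eq_bigr => l _.
rewrite sum_nat_const; congr (_ * _).
rewrite -sum1_card (eq_bigl (fun i : 'I_n => i < (n - l).-1)); last first.
  by move=> i; rewrite unfold_in /ok /=; have := ltn_ord l; lia.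
rewrite (big_ord_narrow (n1 := (n - l).-1)) ?sum1_card ?card_ord //; lia.
Qed.

End Insertion.

(** * Substitution decomposition of words *)

Section Substitution.
Variable N : nat.
Variable X : {set 'I_N}.
Implicit Types (Y Z K R : {set 'I_N}) (m : {ffun 'I_N -> 'I_N}).

(** A concatenation of words with one unmatched letter each, described without naming the cut
    points. The unmatched letters are the places of the letters of the core. *)
Definition dressing m :=
  [&& matching X m,
   [forall Y, (convex X Y && (Y != set0) && stable m Y) ==> (fixpts m Y != set0)]
   & [forall x in X, exists K, [&& convex X K, x \in K, stable m K & #|fixpts m K| == 1]]].

Lemma dressingP m : reflect [/\ matching X m,
   forall Y, convex X Y -> Y != set0 -> stable m Y -> fixpts m Y != set0
   & forall x, x \in X ->
       exists K, [/\ convex X K, x \in K, stable m K & #|fixpts m K| = 1]]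
  (dressing m).
Proof.
apply: (iffP and3P) => -[mX H1 H2]; split=> //.
- by move=> Y cY Y0 sY; move/forallP/(_ Y)/implyP: H1; apply; rewrite cY Y0.
- move=> x xX; have /existsP[K /and4P[? ? ? /eqP?]] := forall_inP H2 x xX.
  by exists K.
- by apply/forallP=> Y; apply/implyP=> /andP[/andP[? ?] ?]; apply: H1.
- apply/forall_inP=> x /H2[K [? ? ? /eqP ?]]; apply/existsP; exists K; exact/and4P.
Qed.

(* Proper intervals left by exactly one chord: they are contracted to one letter. *)
Definition block m Y := [&& convex X Y, Y != X & out m Y == 1].

(* [x] leaves every block containing it, i.e. it represents the largest one. *)
Definition core_points m := [set x in X | [forall Y : {set 'I_N},
  (block m Y && (x \in Y)) ==> ((m x \notin Y) || (m x == x))]].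

(** The letters of [R] form a 2-connected diagram, and removing its chords leaves a dressing. The
    last condition makes [R] the set of all unmatched letters of this dressing, one in each cell. *)
Definition core R m := [&& R \subset X, 1 < #|R|, stable m R, word 1 2 R (resf R m),
  dressing (resf (~: R) m) & fixpts (resf (~: R) m) X == R].

Lemma core_pointsP m x : reflect (x \in X /\ forall Y, block m Y -> x \in Y ->
  (m x \notin Y) || (m x == x)) (x \in core_points m).
Proof.
rewrite inE; apply: (iffP andP) => -[xX H]; split=> //.
  by move=> Y bY xY; move/forallP/(_ Y)/implyP: H; apply; rewrite bY.
by apply/forallP=> Y; apply/implyP=> /andP[]; apply: H.
Qed.

(* If the union were everything, the block containing the unmatched letter would have
   a complement that is an interval closed under [m]. *)
Lemma blockU m Y Z : word 1 1 X m -> block m Y -> block m Z -> Y :&: Z != set0 ->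
  block m (Y :|: Z).
Proof.
move=> /word1P[mX fX conn] /and3P[cY nY /eqP oY] /and3P[cZ nZ /eqP oZ] YZ.
have cU := convexU cY cZ YZ; have := outD m Y Z.
have := conn _ (convexI cY cZ) YZ; have YX := proj1 (convexP _ _ cY).
rewrite oY oZ => o1 o2; apply/and3P; split=> //; last first.
  have U0 : Y :|: Z != set0.
    by case/set0Pn: YZ => x; rewrite inE => /andP[xY _]; apply/set0Pn; exists x; rewrite inE xY.
  by have := conn _ cU U0; lia.
apply/eqP=> eX; have /eqP/cards1P[j fj] := fX.
have jf : (j \in X) && (m j == j) by have := set11 j; rewrite -fj inE.
have {jf} [jX mj] := andP jf.
have key A B : convex X A -> convex X B -> A != X -> out m A = 1 -> B != X ->
    A :|: B = X -> j \in A -> False.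
  move=> cA cB nA oA nB AB jA.
  have XA : X :\: A = B :\: A by rewrite -AB setDUl setDv set0U.
  have AX := proj1 (convexP _ _ cA).
  have c : convex X (X :\: A).
    rewrite XA; apply: convexD => //; apply/negP=> AB'.
    by case/eqP: nB; rewrite -AB; apply/esym/setUidPr.
  have n0 : X :\: A != set0.
    rewrite setD_eq0; apply/negP=> XA'; case/eqP: nA.
    by apply/eqP; rewrite eqEsubset AX.
  have := conn _ c n0; suff -> : out m (X :\: A) = 0 by [].
  have /eqP/out1P[y [yA Hy Hz]] := oA.
  have jy : j = y.
    by apply/eqP/negPn/negP => jy; have [_] := Hz j jA jy; rewrite mj.
  apply/eqP/out0P => z; rewrite !inE => /andP[zA zX].
  have mz : m z != z.
    apply: contraNneq zA => mz; suff -> : z = j by [].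
    by apply/set1P; rewrite -fj inE zX mz eqxx.
  split=> //; rewrite (matching_in mX zX) andbT; apply/negP=> mzA.
  have [mm _] := matchingP _ _ mX.
  have mzj : m z != y.
    rewrite -jy; apply: contraNneq mz => e.
    by rewrite e -(eqP mj) -e mm.
  have [] := Hz _ mzA mzj; rewrite mm => zA'; by rewrite zA' in zA.
have : j \in Y :|: Z by rewrite eX.
rewrite inE => /orP[jY|jZ]; first by apply: (key Y Z).
by apply: (key Z Y) => //; rewrite setUC.
Qed.

(** The cells of the dressing are blocks. A cell contains only one letter [r] of [R], and the
    partner of [r] is in [R], hence outside the cell unless it is [r] itself. *)
Lemma core_cell m R x : core R m -> x \in X -> exists K r,
  [/\ block m K, x \in K, r \in K, r \in R &
   forall z, z \in K -> z != r -> m z \in K /\ m z != z].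
Proof.
move=> /and5P[RX R1 sR wR /andP[dR /eqP fR]] xX.
have [_ _ /(_ x xX)[K [cK xK sK /eqP/cards1P[r fK]]]] := dressingP _ dR.
have rf : (r \in K) && (resf (~: R) m r == r) by have := set11 r; rewrite -fK inE.
have {rf} [rK mr] := andP rf.
have KX := proj1 (convexP _ _ cK).
have KR z : z \in K -> z \in R -> z = r.
  move=> zK; rewrite -fR !inE => /andP[_ mz]; apply/set1P; rewrite -fK inE zK; exact: mz.
have rR : r \in R by rewrite -fR inE (subsetP KX).
have inn z : z \in K -> z != r -> m z \in K /\ m z != z.
  move=> zK zr; have zR : z \notin R by apply: contra zr => /(KR _ zK)->.
  have e : resf (~: R) m z = m z by rewrite ffunE inE zR.
  rewrite -e (stableP _ _ sK) //; split=> //.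
  apply: contra zr => ez; apply/eqP/set1P; rewrite -fK inE zK; exact: ez.
exists K, r; split=> //; apply/and3P; split=> //.
  apply/eqP=> eK; suff: #|R| <= 1 by rewrite leqNgt R1.
  rewrite -(cards1 r); apply: subset_leq_card; apply/subsetP=> z zR; apply/set1P/KR => //.
  by rewrite eK (subsetP RX).
apply/out1P; exists r; split=> //.
have [mrK|//] := boolP (m r \in K); rewrite (KR (m r)) ?eqxx //.
exact: (stableP _ _ sR).
Qed.

(** The trace on [R] of a maximal block is an interval left at most once, so 2-connectedness makes
    it small or all of [R]. In the second case the block would absorb the cell of any letter outside
    it, by [blockU]. *)
Lemma core_block m R Y : word 1 1 X m -> core R m -> block m Y -> #|Y :&: R| <= 1.
Proof.
move=> wm cm bY0; have /and5P[RX R1 sR wR _] := cm; rewrite leqNgt; apply/negP=> YR2.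
have [Y1 /maxsetP[bY Ymax] YY1] := maxset_exists (P := block m) bY0.
have {YR2} Y2 : 1 < #|Y1 :&: R| by apply: leq_trans YR2 _; apply: subset_leq_card; apply: setSI.
have /and3P[cY nY /eqP oY] := bY.
have YX := proj1 (convexP _ _ cY).
have [mR _ cR] := wordP _ _ _ _ wR.
have cZ : convex R (Y1 :&: R) by apply: convexIsub cY.
have oZ : out (resf R m) (Y1 :&: R) <= 1.
  rewrite (@out_eq _ _ m); last by move=> x; rewrite inE ffunE => /andP[_ ->].
  rewrite -oY /out [X in X <= _]big_mkcond [X in _ <= X]big_mkcond; apply: leq_sum => y _.
  rewrite !inE; case: (y \in Y1) => //=; case: (boolP (y \in R)) => //= yR.
  by rewrite (stableP _ _ sR) ?andbT.
have YR : Y1 :&: R = R.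
  apply/eqP; rewrite eqEcard subsetIr leqNgt; apply/negP => lt.
  by have := cR _ cZ Y2 lt; rewrite leqNgt ltnS oZ.
have /subsetPn[x xX xY] : ~~ (X \subset Y1).
  by apply: contra nY => XY; rewrite eqEsubset YX.
have [K [r [bK xK rK rR _]]] := core_cell cm xX.
have KY : Y1 :&: K != set0.
  by apply/set0Pn; exists r; rewrite inE rK andbT; move: rR; rewrite -YR inE => /andP[].
case/negP: xY; rewrite -(Ymax _ (blockU wm bY bK KY)) ?subsetUl //.
by rewrite inE xK orbT.
Qed.

(** A letter of [R] leaves each block around it, as its partner would be a second letter of [R]
    there; any other letter is matched inside its own cell. *)
Lemma core_unique m R : word 1 1 X m -> core R m -> R = core_points m.
Proof.
move=> wm cm; have /and5P[RX _ sR _ _] := cm.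
apply/setP=> x; apply/idP/core_pointsP => [xR|[xX H]].
  split=> [|Y bY xY]; first exact: (subsetP RX).
  rewrite -implybE; apply/implyP=> mxY.
  have := core_block wm cm bY; rewrite leqNgt => /negP h; apply/negPn/negP=> mx; case: h.
  apply/card_gt1P; exists (m x), x; rewrite !inE mxY xY xR (stableP _ _ sR) //.
apply/negPn/negP => xR; have [K [r [bK xK rK rR inn]]] := core_cell cm xX.
have xr : x != r by apply: contraNneq xR => ->.
have [h1 h2] := inn x xK xr.
by have := H K bK xK; rewrite h1 (negbTE h2).
Qed.

(** A closed interval avoiding [R] would be closed in the dressing and have no fixed letter; one
    meeting [R] would have a trace on [R] that no chord of the core leaves. *)
Lemma core_join m1 m2 R : R \subset X -> 1 < #|R| -> word 1 2 R m1 -> dressing m2 ->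
  fixpts m2 X = R -> word 1 1 X (joinf R m1 m2) && core R (joinf R m1 m2).
Proof.
move=> RX R1 w1 d2 fR; have [M1 f1 c1] := wordP _ _ _ _ w1.
have [M2 conn _] := dressingP _ d2; have [mm2 mn2] := matchingP _ _ M2.
have m2R x : x \in R -> m2 x = x by rewrite -fR inE => /andP[_ /eqP].
have s2 : supported (~: R) m2 by apply/supportedP=> x; rewrite inE negbK => /m2R.
have s1 : supported R m1 by case/andP: M1.
have M2' : matching (X :\: R) m2.
  apply/matchingP; split=> // x; rewrite inE negb_and negbK => /orP[/m2R//|/mn2//].
set m := joinf R m1 m2.
have mR x : x \in R -> m x = m1 x by move=> xR; rewrite ffunE xR.
have mR' x : x \notin R -> m x = m2 x by move=> xR; rewrite ffunE (negbTE xR).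
have sR : stable m R by apply/stableP => x xR; rewrite mR // (matching_in M1).
apply/andP; split; last first.
  by rewrite /core RX R1 sR resf_joinl // resf_joinr // w1 d2 fR eqxx.
apply/word1P; split; first exact: matching_join.
  rewrite fixpts_join // (_ : fixpts m2 _ = set0) ?setU0 //.
  apply/setP=> x; rewrite !inE -fR inE.
  by case: (x \in X); case: (m2 x == x).
move=> Y cY Y0; rewrite lt0n; apply/eqP=> oY; have sY := out0_stable oY.
have nf x : x \in Y -> m x != x by move=> xY; move/eqP/out0P: oY => /(_ x xY)[].
have [YR|YR] := eqVneq (Y :&: R) set0.
  have yR y : y \in Y -> y \notin R.
    by move=> yY; apply/negP=> yR; have := in_set0 y; rewrite -YR inE yY yR.
  have sY2 : stable m2 Y.
    by apply/stableP=> y yY; rewrite -mR' ?yR // (stableP _ _ sY).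
  have /set0Pn[y] := conn Y cY Y0 sY2.
  by rewrite inE => /andP[yY]; rewrite -mR' ?yR // (negbTE (nf _ yY)).
have cZ : convex R (Y :&: R) by apply: convexIsub cY.
have oZ : out m1 (Y :&: R) = 0.
  rewrite -(@out_eq _ m); last by move=> x; rewrite inE => /andP[_ /mR].
  rewrite stable_out ?stableI //; apply/eqP; rewrite cards_eq0; apply/eqP/setP=> x.
  rewrite !inE; apply/negP=> /andP[/andP[xY _]]; exact/negP/nf.
have [lt|ge] := ltnP #|Y :&: R| #|R|; last first.
  have YR' : Y :&: R = R by apply/eqP; rewrite eqEcard subsetIr.
  by move: oZ; rewrite YR' out_full // f1.
have [gt|le] := ltnP 1 #|Y :&: R|; first by have := c1 _ cZ gt lt; rewrite oZ.
have /cards1P[z zE] : #|Y :&: R| == 1 by rewrite eqn_leq le card_gt0.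
by move: oZ; rewrite zE out_set1.
Qed.

Definition hull m x := \bigcup_(Y | block m Y && (x \in Y)) Y.

Section Decompose.
Variable m : {ffun 'I_N -> 'I_N}.
Hypotheses (wm : word 1 1 X m) (X1 : 1 < #|X|).

Lemma block_set1 x : x \in X -> block m [set x].
Proof.
move=> xX; rewrite /block out_set1 convex1 // eqxx andbT /=.
by apply/eqP=> e; move: X1; rewrite -e cards1.
Qed.

Lemma mem_hull x : x \in X -> x \in hull m x.
Proof.
move=> xX; apply/bigcupP; exists [set x]; rewrite ?set11 //.
by rewrite block_set1 ?set11.
Qed.

Lemma sub_hull x Y : block m Y -> x \in Y -> Y \subset hull m x.
Proof. by move=> bY xY; apply: bigcup_sup; rewrite bY. Qed.

Lemma block_hull x : x \in X -> block m (hull m x).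
Proof.
move=> xX; have [Y /maxsetP[bY Ymax]] := maxset_exists (P := block m) (block_set1 xX).
rewrite sub1set => xY; suff -> : hull m x = Y by [].
apply/eqP; rewrite eqEsubset sub_hull // andbT; apply/bigcupsP=> Z /andP[bZ xZ].
have YZ : Y :&: Z != set0 by apply/set0Pn; exists x; rewrite inE xY.
by rewrite -(Ymax _ (blockU wm bY bZ YZ)) ?subsetUl ?subsetUr.
Qed.

Lemma hull_sub x : x \in X -> hull m x \subset X.
Proof. by move/block_hull => /and3P[/convexP[]]. Qed.

Lemma hull_eq x y : x \in X -> y \in hull m x -> hull m y = hull m x.
Proof.
move=> xX yx; have yX := subsetP (hull_sub xX) _ yx; apply/eqP; rewrite eqEsubset.
rewrite (sub_hull (block_hull xX)) // andbT (sub_hull (block_hull yX)) //.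
have xy := subsetP (sub_hull (block_hull xX) yx) x (mem_hull xX).
exact: xy.
Qed.

(** The core point of a maximal block is the one letter leaving it: every other block around that
    letter is smaller and is left by it as well. *)
Lemma hull_core x : x \in X -> exists y, [/\ y \in core_points m,
  hull m x :&: core_points m = [set y] &
  forall z, z \in hull m x -> z != y -> m z \in hull m x /\ m z != z].
Proof.
move=> xX; have bH := block_hull xX; have /and3P[cH nH /out1P[y [yH Hy Hz]]] := bH.
have yR : y \in core_points m.
  apply/core_pointsP; split=> [|Y bY yY]; first exact: (subsetP (hull_sub xX)).
  have YH : Y \subset hull m x by rewrite -(hull_eq xX yH) sub_hull.
  by case/orP: Hy => [my|->]; rewrite ?orbT //; rewrite (contra (subsetP YH _) my).
exists y; split=> //; apply/setP=> z; rewrite inE in_set1; apply/andP/eqP => [[zH]|->//].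
case/core_pointsP => _ /(_ _ bH zH) H; apply/eqP/negPn/negP=> /(Hz _ zH)[h1 h2].
by move: H; rewrite h1 (negbTE h2).
Qed.

Lemma core_pointsI x y z : x \in X -> y \in hull m x -> z \in hull m x ->
  y \in core_points m -> z \in core_points m -> y = z.
Proof.
move=> xX yx zx yR zR; have [w [_ e _]] := hull_core xX.
have /set1P-> : y \in [set w] by rewrite -e inE yx.
by have /set1P-> : z \in [set w] by rewrite -e inE zx.
Qed.

Lemma convex_disjoint A B (a b a' b' : 'I_N) : convex X A -> convex X B ->
  A :&: B = set0 -> a \in A -> b \in B -> a' \in A -> b' \in B -> a <= b -> a' <= b'.
Proof.
move=> /convexP[AX cA] /convexP[BX cB] AB aA bB aA' bB' ab.
have dis z : z \in A -> z \in B -> false by move=> zA zB; have := in_set0 z; rewrite -AB inE zA zB.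
rewrite leqNgt; apply/negP => /ltnW ba.
have [a'b|ba'] := leqP a' b.
  by have := dis a' aA' (cB b' a' b bB' bB (subsetP AX _ aA') ba a'b).
by have := dis b (cA a b a' aA aA' (subsetP BX _ bB) ab (ltnW ba')) bB.
Qed.

Lemma core_ex : core (core_points m) m.
Proof.
set R := core_points m; have [mX fX conn] := word1P _ _ wm.
have [mm mn] := matchingP _ _ mX.
have RX : R \subset X by apply/subsetP => x /core_pointsP[].
have sR : stable m R.
  apply/stableP=> x /core_pointsP[xX H]; apply/core_pointsP; split=> [|Y bY mxY].
    exact: (matching_in mX).
  rewrite mm -implyNb negbK; apply/implyP=> xY.
  by have := H Y bY xY; rewrite mxY /= eq_sym.
have fixR x : x \in X -> m x = x -> x \in R.
  by move=> xX e; apply/core_pointsP; split=> // Y _ _; rewrite e eqxx orbT.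
have inR x : x \in R -> x \in X by apply: (subsetP RX).
apply/and5P; split=> //.
- have /card_gt1P[x [_ [xX _ _]]] := X1.
  have [y [yR yH _]] := hull_core xX.
  have /and3P[cH nH _] := block_hull xX.
  have /subsetPn[x' xX' xH'] : ~~ (X \subset hull m x).
    by apply: contra nH => h; rewrite eqEsubset hull_sub.
  have [y' [yR' yH' _]] := hull_core xX'.
  have h1 : y \in hull m x by have := set11 y; rewrite -yH inE => /andP[].
  have h2 : y' \in hull m x' by have := set11 y'; rewrite -yH' inE => /andP[].
  apply/card_gt1P; exists y, y'; split=> //; apply: contraNneq xH' => e.
  by rewrite -(hull_eq xX h1) e (hull_eq xX' h2) mem_hull.
- apply/wordP; split.
  + by apply: (matching_resl mX); apply/stableP.
  + rewrite -fX; congr #|pred_of_set _|; apply/setP=> x; rewrite [LHS]inE [RHS]inE ffunE.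
    apply/andP/andP => -[]; first by move=> xR; rewrite xR; split=> //; apply: inR.
    by move=> xX /eqP e; rewrite fixR ?e.
  move=> Z /convexP[ZR cZ] Z2 ZlR.
  rewrite (@out_eq _ _ m); last by move=> x /(subsetP ZR) xR; rewrite ffunE xR.
  rewrite ltnNge; apply/negP=> oZ.
  (* If an interval [Z] of the core with two letters were left at most once, its inflation [U] would
     be a block with two core points, although a block lies in a single hull. *)
  pose U := \bigcup_(z in Z) hull m z.
  have ZX z : z \in Z -> z \in X by move=> zZ; apply/inR/(subsetP ZR).
  have ZU z : z \in Z -> z \in U.
    by move=> zZ; apply/bigcupP; exists z; rewrite ?mem_hull ?ZX.
  have UR z : z \in U -> z \in R -> z \in Z.
    case/bigcupP=> w wZ zw zR; suff -> : z = w by [].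
    by apply: (core_pointsI (ZX _ wZ)) => //; rewrite ?mem_hull ?ZX // (subsetP ZR).
  have cU : convex X U.
    apply/convexP; split; first by apply/bigcupsP=> z /ZX; apply: hull_sub.
    move=> a b c /bigcupP[z1 z1Z az1] /bigcupP[z2 z2Z cz2] bX ab bc.
    have [y [yR yE _]] := hull_core bX.
    have yb : y \in hull m b by have := set11 y; rewrite -yE inE => /andP[].
    have [e1|n1] := eqVneq (hull m z1 :&: hull m b) set0; last first.
      case/set0Pn: n1 => t; rewrite inE => /andP[t1 tb]; apply/bigcupP; exists z1 => //.
      by rewrite -(hull_eq (ZX _ z1Z) t1) (hull_eq bX tb) mem_hull.
    have [e2|n2] := eqVneq (hull m b :&: hull m z2) set0; last first.
      case/set0Pn: n2 => t; rewrite inE => /andP[tb t1]; apply/bigcupP; exists z2 => //.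
      by rewrite -(hull_eq (ZX _ z2Z) t1) (hull_eq bX tb) mem_hull.
    have cH x : x \in X -> convex X (hull m x) by move/block_hull=> /and3P[].
    (* Disjoint intervals are ordered as wholes, so the core point of the hull of [b] inherits the
       position of [b] between the two hulls. *)
    have l1 : z1 <= y.
      by apply: (convex_disjoint (cH _ (ZX _ z1Z)) (cH _ bX) e1 az1 (mem_hull bX)) => //;
         apply: mem_hull; apply: ZX.
    have l2 : y <= z2.
      by apply: (convex_disjoint (cH _ bX) (cH _ (ZX _ z2Z)) e2 (mem_hull bX) cz2) => //;
         apply: mem_hull; apply: ZX.
    apply/bigcupP; exists y; first exact: (cZ z1 y z2).
    by rewrite (hull_eq bX yb) mem_hull.
  (* Letters of a hull other than its core point are matched inside it, so only letters of [Z] can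
     leave [U]. *)
  have oU : out m U <= out m Z.
    rewrite /out [X in X <= _]big_mkcond [X in _ <= X]big_mkcond; apply: leq_sum => y _.
    case: (boolP (y \in U)) => // yU; case/bigcupP: (yU) => z zZ yz.
    have [w [wR wE Hw]] := hull_core (ZX _ zZ).
    have [ew|nw] := eqVneq y w.
      have yR : y \in R by rewrite ew.
      rewrite UR //; case: (m y == y); rewrite ?orbT ?orbF //.
      by case: (boolP (m y \in Z)) => [/ZU->|_] //; case: (_ \in U).
    have [h1 h2] := Hw _ yz nw.
    rewrite (negbTE h2) orbF (_ : m y \in U) //; by apply/bigcupP; exists z.
  have [z1 [z2 [z1Z z2Z z12]]] := card_gt1P Z2.
  have U0 : U != set0 by apply/set0Pn; exists z1; apply: ZU.
  have bU : block m U.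
    apply/and3P; split=> //.
      apply/eqP=> UX; move: ZlR; rewrite ltnNge => /negP; apply; apply: subset_leq_card.
      by apply/subsetP=> w wR; apply: UR => //; rewrite UX inR.
    by rewrite eqn_leq (leq_trans oU oZ) (conn _ cU U0).
  case/eqP: z12; apply: (core_pointsI (ZX _ z1Z)) => //;
    try by apply: (subsetP ZR).
    exact/mem_hull/ZX.
  by apply: (subsetP (sub_hull bU (ZU _ z1Z))); apply: ZU.
have fE : fixpts (resf (~: R) m) X = R.
  apply/setP=> x; rewrite [LHS]inE ffunE in_setC; case: (boolP (x \in R)) => /= xR.
    by rewrite eqxx inR.
  by apply: contraNF xR => /andP[xX /eqP e]; apply: fixR.
rewrite fE eqxx andbT; apply/dressingP.
have mR x : x \notin R -> resf (~: R) m x = m x by move=> xR; rewrite ffunE in_setC xR.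
have mR' x : x \in R -> resf (~: R) m x = x by move=> xR; rewrite ffunE in_setC xR.
split.
- have := matching_resr mX (stableP _ _ sR) => /matchingP[h1 h2]; apply/matchingP; split=> // x xX.
  by apply: h2; rewrite inE (negbTE xX) andbF.
- move=> Y cY Y0 sY; have := conn Y cY Y0; apply: contraTneq => fY.
  have YR y : y \in Y -> y \notin R.
    move=> yY; apply/negP=> yR; have := in_set0 y; rewrite -fY inE yY.
    by rewrite mR' // eqxx.
  rewrite -eqn0Ngt; apply/out0P => y yY; rewrite -mR ?YR // (stableP _ _ sY) //; split=> //.
  by apply/negP=> h; have := in_set0 y; rewrite -fY inE yY h.
(* The cells of the dressing are the hulls: once its core point is fixed, a hull is closed. *)
move=> x xX; exists (hull m x); have [y [yR yE Hy]] := hull_core xX.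
have /and3P[cH _ _] := block_hull xX; split; rewrite ?mem_hull //.
  apply/stableP=> z zH; have [zR|zR] := boolP (z \in R); first by rewrite mR'.
  by rewrite mR //; case: (Hy z zH) => //; apply: contraNneq zR => ->.
rewrite -(cards1 y) -yE; congr #|pred_of_set _|; apply/setP=> z.
rewrite [LHS]inE [RHS]in_setI; case: (boolP (z \in hull m x)) => //= zH.
by have /setP/(_ z) := fE; rewrite [LHS]inE (subsetP (hull_sub xX)).
Qed.

End Decompose.

Lemma word_substitution : 1 < #|X| ->
  #|[set m | word 1 1 X m]| =
  \sum_(2 <= k < #|X|.+1) #|[set m | dressing m && (#|fixpts m X| == k)]| * nword 1 2 k.
Proof.
move=> X1; rewrite (@card_classify _ _ _ core); first last.
- by move=> m R1 R2; rewrite inE => wm c1 c2; rewrite (core_unique wm c1) (core_unique wm c2).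
- by move=> m; rewrite inE => wm; exists (core_points m); apply: core_ex.
transitivity (\sum_(R : {set 'I_N} | (R \subset X) && (1 < #|R|))
  #|[set m | dressing m && (fixpts m X == R)]| * nword 1 2 #|R|).
  rewrite [RHS]big_mkcond; apply: eq_bigr => R _; case: ifP => [/andP[RX R1]|nR]; last first.
    apply: eq_card0 => m; rewrite !inE; apply/negP=> /andP[_ /and5P[h1 h2 _ _ _]].
    by rewrite h1 h2 in nR.
  rewrite -(@card_word _ R) -?card_gt0 ?(ltnW R1) // mulnC.
  rewrite -(@card_split _ R (fun m => word 1 1 X m && core R m)).
  - by apply: eq_card => m; rewrite !inE.
  - by move=> m /andP[_ /and5P[_ _ _ -> /andP[-> ->]]].
  - by move=> m1 m2 w1 /andP[d2 /eqP f2]; apply: core_join.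
  - by move=> m /and3P[/andP[]].
  - move=> m /andP[_ /eqP fR]; apply/supportedP=> x; rewrite inE negbK -fR inE.
    by case/andP=> _ /eqP.
transitivity (\sum_(2 <= k < #|X|.+1) \sum_(R : {set 'I_N} | (R \subset X) && (#|R| == k))
    #|[set m | dressing m && (fixpts m X == R)]| * nword 1 2 k); last first.
  apply: eq_bigr => k _; rewrite -big_distrl /=; congr (_ * _).
  rewrite (@card_classify _ {set 'I_N} _ (fun R m => fixpts m X == R)); first last.
  - by move=> m R1 R2 _ /eqP-> /eqP.
  - by move=> m _; exists (fixpts m X).
  rewrite big_mkcond; apply: eq_bigr => R _; case: ifP => h.
    apply: eq_card => m; rewrite !inE; case: (dressing m) => //=.
    by case: (fixpts m X =P R) => [->|_]; rewrite ?andbF //; case/andP: h => _ ->.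
  apply/esym; apply: eq_card0 => m; rewrite !inE; apply/negP => /andP[/andP[_ e] /eqP f].
  move/negP: h; apply; rewrite -f e andbT; apply/subsetP => x; rewrite inE; by case/andP.
pose F R k := #|[set m | dressing m && (fixpts m X == R)]| * nword 1 2 k.
rewrite (eq_bigr (fun R : {set _} => \sum_(2 <= k < #|X|.+1 | k == #|R|) F R k)); last first.
  by move=> R /andP[RX R1]; rewrite big_nat1_eq R1 ltnS subset_leq_card.
rewrite (exchange_big_dep xpredT) //=; apply: eq_big_nat => k /andP[k2 _].
apply: eq_bigl => R; rewrite eq_sym; case: eqP => [->|]; rewrite ?andbF //.
by rewrite k2 !andbT.
Qed.

End Substitution.

(** * Words dressed by blocks *)

Section Peel.
Variable N : nat.
Implicit Types (X Y Z K : {set 'I_N}) (m : {ffun 'I_N -> 'I_N}).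

Definition initseg n := [set i : 'I_N | i < n].

Lemma card_initseg n : n <= N -> #|initseg n| = n.
Proof.
move=> nN; rewrite -sum1_card (eq_bigl (fun i : 'I_N => i < n)); last by move=> i; rewrite inE.
by rewrite (big_ord_narrow nN) sum1_card card_ord.
Qed.

(** The length [n] is separate from the ambient [N], so that peeling off a final cell does not
    change the type. *)
Definition ndressing k n :=
  #|[set m | dressing (initseg n) m && (#|fixpts m (initseg n)| == k)]|.

Definition finalseg n l := initseg n :\: initseg (n - l).

Lemma convex_finalseg n l : convex (initseg n) (finalseg n l).
Proof.
apply/convexP; split; first exact: subsetDl.
by move=> x y z; rewrite !inE; lia.
Qed.

Lemma convex_initseg n p : p <= n -> convex (initseg n) (initseg p).
Proof.
move=> pn; apply/convexP; split; first by apply/subsetP=> x; rewrite !inE; lia.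
by move=> x y z; rewrite !inE; lia.
Qed.

Definition peel n l m := [&& 0 < l <= n, stable m (finalseg n l),
  word 1 1 (finalseg n l) (resf (finalseg n l) m)
  & dressing (initseg (n - l)) (resf (~: finalseg n l) m)].


Lemma fixU m K1 K2 r : fixpts m K1 = [set r] -> fixpts m K2 = [set r] ->
  fixpts m (K1 :|: K2) = [set r].
Proof.
move=> /setP f1 /setP f2; apply/setP=> x; have := f1 x; have := f2 x; rewrite !inE.
by case: (x \in K1); case: (x \in K2) => //= <-.
Qed.

(** The final cell is the largest closed interval around the last letter with one fixed letter. A
    cell meeting it would share its fixed letter and could be united with it, so the remaining
    letters keep their cells. *)
Lemma peel_ex n m : dressing (initseg n) m -> initseg n != set0 -> n <= N ->
  exists l, peel n l m.
Proof.
set X := initseg n => /dressingP[mX conn cov] X0 nN.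
have n0 : 0 < n by rewrite -(card_initseg nN) card_gt0.
have [mm mn] := matchingP _ _ mX.
have xN : n.-1 < N by lia.
pose x := Ordinal xN; have xX : x \in X by rewrite inE /=; lia.
pose P K := [&& convex X K, x \in K, stable m K & #|fixpts m K| == 1].
have [K0 PK0] : exists K, P K.
  by have [K [? ? ? e]] := cov x xX; exists K; apply/and4P; rewrite e.
have [K /maxsetP[/and4P[cK xK sK fK1] Kmax] _] := maxset_exists PK0.
have /cards1P[r fK] := fK1.
have [KX cK'] := convexP _ _ cK.
have [p pn pK] : exists2 p, p < n & K = [set i in X | p <= i].
  pose a := [arg min_(i < x in K) i].
  have [aK amin] : a \in K /\ forall i, i \in K -> a <= i.
    by rewrite /a; case: arg_minnP.
  exists a; first by have := subsetP KX _ aK; rewrite inE.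
  apply/setP=> i; rewrite inE; apply/idP/andP => [iK|[iX ai]].
    by rewrite (subsetP KX) // amin.
  by apply: (cK' a i x); rewrite //= ; move: iX; rewrite inE; lia.
have KE : K = finalseg n (n - p).
  by rewrite pK; apply/setP=> i; rewrite !inE; lia.
have KE' : X :\: K = initseg p by rewrite pK; apply/setP=> i; rewrite !inE; lia.
exists (n - p); rewrite /peel -KE subKn ?(ltnW pn) // subn_gt0 pn leq_subr /= sK /=.
apply/andP; split.
  apply/word1P; split; first exact: matching_resl mX (stableP _ _ sK).
    rewrite -(eqP fK1); congr #|pred_of_set _|; apply: fixpts_eq => y yK.
    by rewrite ffunE yK.
  move=> Y cY Y0; have YK := proj1 (convexP _ _ cY).
  rewrite (@out_eq _ _ m) => [|y /(subsetP YK) yK]; last by rewrite ffunE yK.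
  rewrite lt0n; apply/eqP=> oY.
  have := conn Y (convex_trans cK cY) Y0 (out0_stable oY).
  by rewrite -card_gt0 -stable_out ?oY // out0_stable.
have mK y : y \notin K -> resf (~: K) m y = m y by move=> yK; rewrite ffunE in_setC yK.
have inI y : y \in initseg p -> y \notin K by rewrite -KE' inE => /andP[].
have cI := convex_initseg (ltnW pn).
apply/dressingP; split.
- by rewrite -KE'; apply: (matching_resr mX); apply/stableP.
- move=> Y cY Y0 /stableP sY; have YI := proj1 (convexP _ _ cY).
  have eY y : y \in Y -> resf (~: K) m y = m y by move=> /(subsetP YI)/inI/mK.
  rewrite (fixpts_eq (m' := m)) //; apply: conn => //; first exact: convex_trans cY.
  by apply/stableP=> y yY; rewrite -eY // sY.
- move=> y yI; have yX : y \in X by apply: (subsetP (proj1 (convexP _ _ cI))).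
  have [L [cL yL sL /eqP/cards1P[r' fL]]] := cov y yX.
  have KL : K :&: L = set0.
    apply/eqP/negPn/negP=> KL0.
    have /set0Pn[z] := conn _ (convexI cK cL) KL0 (stableI sK sL).
    rewrite !inE => /andP[/andP[zK zL] mz].
    have zr : z = r by apply/set1P; rewrite -fK inE zK.
    have zr' : z = r' by apply/set1P; rewrite -fL inE zL.
    have PU : P (K :|: L).
      rewrite /P convexU // stableU // inE xK /= (@fixU _ _ _ r) ?cards1 //.
      by rewrite fL -zr'; rewrite zr.
    by case/negP: (inI _ yI); rewrite -(Kmax _ PU) ?subsetUl // inE yL orbT.
  have LK z : z \in L -> z \notin K.
    by move=> zL; apply/negP=> zK; have := in_set0 z; rewrite -KL inE zK zL.
  have LI : L \subset initseg p.
    by rewrite -KE'; apply/subsetP=> z zL; rewrite inE LK // (subsetP (proj1 (convexP _ _ cL))).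
  have eL : {in L, resf (~: K) m =1 m} by move=> z /LK/mK.
  exists L; split=> //.
  + by apply: (convex_sub _ cL LI); case/convexP: cI.
  + by apply/stableP=> z zL; rewrite eL // (stableP _ _ sL).
  + by rewrite (fixpts_eq eL) fL cards1.
Qed.

(** Nested final cells have the same unmatched letter, so their difference would be a closed
    interval without one. *)
Lemma peel_unique n m l l' : n <= N -> dressing (initseg n) m -> peel n l m -> peel n l' m -> l <= l'.
Proof.
move=> nN /dressingP[mX conn _] /and4P[/andP[l0 ln] s w _] /and4P[/andP[l0' ln'] s' w' _].
rewrite leqNgt; apply/negP=> ll.
have sub : finalseg n l' \subset finalseg n l by apply/subsetP=> i; rewrite !inE; lia.
have fe K : fixpts (resf K m) K = fixpts m K.
  by apply: fixpts_eq => y yK; rewrite ffunE yK.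
have [_ /eqP/cards1P[r fr] _] := word1P _ _ w.
have [_ /eqP/cards1P[r' fr'] _] := word1P _ _ w'.
rewrite !fe in fr fr'.
have rr : r' = r.
  have : r' \in [set r'] by rewrite set11.
  rewrite -fr' inE => /andP[h1 h2]; apply/set1P; rewrite -fr inE h2 andbT.
  exact: (subsetP sub).
pose Y := finalseg n l :\: finalseg n l'.
have cY : convex (initseg n) Y.
  by apply/convexP; split; [apply/subsetP=> i; rewrite !inE; lia|move=> x y z; rewrite !inE; lia].
have Y0 : Y != set0.
  have h : n - l < N by lia.
  by apply/set0Pn; exists (Ordinal h); rewrite !inE /=; lia.
have sY : stable m Y.
  have -> : Y = finalseg n l :&: (initseg n :\: finalseg n l').
    by apply/setP=> i; rewrite !inE; lia.
  by apply: stableI => //; apply: stableC.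
have /set0Pn[z] := conn _ cY Y0 sY; rewrite inE in_setD => /andP[/andP[z1 z2] mz].
have zr : z = r by apply/set1P; rewrite -fr inE z2.
by case/negP: z1; have := set11 r'; rewrite -fr' inE rr -zr => /andP[].
Qed.

Lemma peel_join n l m1 m2 : 0 < l <= n -> n <= N ->
  word 1 1 (finalseg n l) m1 -> dressing (initseg (n - l)) m2 ->
  [/\ dressing (initseg n) (joinf (finalseg n l) m1 m2),
      peel n l (joinf (finalseg n l) m1 m2) &
      #|fixpts (joinf (finalseg n l) m1 m2) (initseg n)| =
      #|fixpts m2 (initseg (n - l))|.+1].
Proof.
move=> ln nN w1 d2; set K := finalseg n l; set m := joinf K m1 m2.
have [M1 f1 c1] := word1P _ _ w1; have [M2 conn cov] := dressingP _ _ d2.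
have KE : initseg n :\: K = initseg (n - l) by apply/setP=> i; rewrite !inE; lia.
have IK x : x \in initseg (n - l) -> x \notin K by rewrite -KE inE => /andP[].
have mK x : x \in K -> m x = m1 x by move=> xK; rewrite ffunE xK.
have mI x : x \notin K -> m x = m2 x by move=> xK; rewrite ffunE (negbTE xK).
have KX : K \subset initseg n by apply: subsetDl.
have sK : stable m K by apply/stableP => x xK; rewrite mK // (matching_in M1).
have cI := convex_initseg (leq_subr l n).
split.
- apply/dressingP; split; first by apply: matching_join; rewrite ?KE.
  + move=> Y cY Y0 sY; have [YK|YK] := eqVneq (Y :&: K) set0.
      have YI : Y \subset initseg (n - l).
        rewrite -KE; apply/subsetP=> y yY; rewrite inE (subsetP (proj1 (convexP _ _ cY))) // andbT.
        by apply/negP=> yK; have := in_set0 y; rewrite -YK inE yY yK.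
      have eY : {in Y, m =1 m2} by move=> y /(subsetP YI)/IK/mI.
      rewrite (fixpts_eq eY); apply: conn => //.
        by apply: (convex_sub _ cY YI); case/convexP: cI.
      by apply/stableP=> y yY; rewrite -eY // (stableP _ _ sY).
    have := c1 _ (convexIsub KX cY) YK.
    rewrite -(@out_eq _ m) => [|x]; last by rewrite inE => /andP[_ /mK].
    rewrite stable_out ?stableI // card_gt0 => /set0Pn[x]; rewrite !inE.
    by case/andP=> /andP[xY _] mx; apply/set0Pn; exists x; rewrite inE xY.
  + move=> x xX; have [xK|xK] := boolP (x \in K).
      exists K; split=> //; first exact: convex_finalseg.
      by rewrite (fixpts_eq (m' := m1)).
    have xI : x \in initseg (n - l) by rewrite -KE inE xK.
    have [L [cL xL sL fL]] := cov x xI; exists L.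
    have LI := proj1 (convexP _ _ cL).
    have eL : {in L, m =1 m2} by move=> y /(subsetP LI)/IK/mI.
    split=> //; first exact: convex_trans cL.
      by apply/stableP=> y yY; rewrite eL // (stableP _ _ sL).
    by rewrite (fixpts_eq eL).
- rewrite /peel ln sK /= resf_joinl; last by case/andP: M1.
  rewrite w1 resf_joinr //; apply/supportedP=> x; rewrite inE negbK => xK.
  by have [_ ->] := matchingP _ _ M2; rewrite //; apply: contraL xK; apply: IK.
- rewrite fixpts_join // KE cardsU f1 add1n (_ : _ :&: _ = set0) ?cards0 ?subn0 //.
  apply/setP=> x; rewrite !inE; apply/negP; lia.
Qed.

Lemma ndressingS k n : n <= N ->
  ndressing k.+1 n = \sum_(l < n.+1 | 0 < l) nword 1 1 l * ndressing k (n - l).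
Proof.
move=> nN; rewrite /ndressing (@card_classify _ 'I_n.+1 _ (fun l m => peel n l m)); first last.
- move=> m l l'; rewrite inE => /andP[d _] p p'; apply/val_inj/eqP.
  by rewrite eqn_leq (peel_unique nN d p p') (peel_unique nN d p' p).
- move=> m; rewrite inE => /andP[d f]; have [|l pl] := peel_ex d _ nN.
    apply: contraTneq f => ->; rewrite (_ : fixpts _ _ = set0) ?cards0 //.
    by apply/setP=> x; rewrite !inE.
  have ln : l < n.+1 by case/and4P: pl => /andP[].
  by exists (Ordinal ln).
rewrite [RHS]big_mkcond; apply: eq_bigr => l _; case: ifP => l0; last first.
  by apply: eq_card0 => m; rewrite !inE /peel l0 /= andbF.
have ln : 0 < l <= n by rewrite l0 -ltnS ltn_ord.
have cK : #|finalseg n l| = l.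
  rewrite cardsD (setIidPr _) ?card_initseg //; try lia.
  by apply/subsetP=> x; rewrite !inE; lia.
rewrite -{2}cK -card_word; last by rewrite -card_gt0 cK.
have sK m : word 1 1 (finalseg n l) m -> supported (finalseg n l) m by case/and3P=> /andP[].
have sI m : dressing (initseg (n - l)) m -> supported (~: finalseg n l) m.
  move=> /dressingP[/matchingP[_ H] _ _]; apply/supportedP=> x; rewrite inE negbK => xK.
  by apply: H; move: xK; rewrite !inE; lia.
rewrite -(@card_split _ (finalseg n l)
   (fun m => [&& dressing (initseg n) m, #|fixpts m (initseg n)| == k.+1 & peel n l m])).
- by apply: eq_card => m; rewrite !inE /= andbA.
- move=> m /and3P[d f p]; have /and4P[_ _ w d'] := p; rewrite w d' /=.
  have [_ _] := peel_join ln nN w d'; rewrite joinf_res (eqP f).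
  by case=> ->.
- move=> m1 m2 w /andP[d f]; have [-> -> ->] := peel_join ln nN w d.
  by rewrite (eqP f) eqxx.
- exact: sK.
- by move=> m /andP[/sI].
Qed.

Lemma ndressing0 n : n <= N -> ndressing 0 n = (n == 0).
Proof.
move=> nN; rewrite /ndressing; case: eqP => [->|/eqP n0].
  apply: etrans (cards1 ([ffun x => x] : {ffun 'I_N -> 'I_N})); apply: eq_card => m; rewrite !inE.
  have X0 : initseg 0 = set0 by apply/setP=> x; rewrite !inE.
  rewrite X0; apply/andP/eqP => [[/dressingP[/matchingP[_ H] _ _] _]|->].
    by apply/ffunP=> x; rewrite ffunE H // inE.
  split; last by rewrite cards_eq0; apply/eqP/setP=> x; rewrite !inE.
  apply/dressingP; split.
  - by apply/matchingP; split=> x; rewrite !ffunE.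
  - by move=> Y /convexP[]; rewrite subset0 => /eqP-> _; rewrite eqxx.
  - by move=> x; rewrite inE.
apply: eq_card0 => m; rewrite inE; apply/negP=> /andP[d]; rewrite cards_eq0 => /eqP f.
have h : 0 < N by lia.
have [_ _ /(_ (Ordinal h))[|K [/convexP[KX _] xK _ fK]]] := dressingP _ _ d.
  by rewrite inE lt0n.
suff: fixpts m K = set0 by move=> e; rewrite e cards0 in fK.
apply/setP=> x; rewrite !inE; apply/negP => /andP[/(subsetP KX) xX mx].
by have := in_set0 x; rewrite -f inE xX mx.
Qed.

End Peel.

Lemma nword_substitution n : 1 < n -> nword 1 1 n =
  \sum_(2 <= k < n.+1) @ndressing n k n * nword 1 2 k.
Proof.
move=> n1; have E : [set: 'I_n] = initseg n n by apply/setP=> x; rewrite !inE ltn_ord.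
by rewrite {1}/nword word_substitution ?cardsT ?card_ord // E.
Qed.

(** * Connected and 2-connected chord diagrams as words *)

Section ChordGraph.
Variables (N : nat) (X : {set 'I_N}) (m : {ffun 'I_N -> 'I_N}).
Hypotheses (mm : forall x, m (m x) = x) (mX : forall x, x \in X -> m x \in X).

Definition chord i := [set i; m i].
(** Relative to a letter set, because 2-connectedness also concerns the diagram on the complement of
    a chord. *)
Definition chords_on := [set chord i | i in X].

Lemma chord_m i : chord (m i) = chord i.
Proof. by rewrite /chord mm setUC. Qed.

Lemma mem_chord i x : x \in chord i -> chord x = chord i.
Proof. by rewrite !inE => /orP[/eqP->|/eqP->]; rewrite ?chord_m. Qed.

Lemma crossing_sym (c d : {set 'I_N}) : crossing c d = crossing d c.
Proof.
have imp (c' d' : {set 'I_N}) : crossing c' d' -> crossing d' c'.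
  move=> /existsP[a /existsP[b /existsP[x /existsP[y /and3P[h1 h2 h3]]]]].
  apply/existsP; exists x; apply/existsP; exists y; apply/existsP; exists a.
  apply/existsP; exists b; rewrite h1 h2 /=; move: h3; lia.
by apply/idP/idP; apply: imp.
Qed.

Notation adj := (fun x y : {set 'I_N} => [&& x \in chords_on, y \in chords_on & crossing x y]).

Lemma adj_connect_sym : connect_sym adj.
Proof. by apply: sym_connect_sym => c d; rewrite /= crossing_sym andbCA. Qed.

Lemma mem_chords_on c : c \in chords_on -> exists2 i, i \in X & c = chord i.
Proof. by case/imsetP=> i iX ->; exists i. Qed.

Lemma chord_in i : i \in X -> chord i \in chords_on.
Proof. by move=> iX; apply: imset_f. Qed.

Lemma chord_sub i : i \in X -> chord i \subset X.
Proof. by move=> iX; apply/subsetP=> x; rewrite !inE => /orP[]/eqP->; rewrite ?mX. Qed.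

Lemma crossing_between (c d : {set 'I_N}) : crossing c d -> exists a b x,
  [/\ a \in c, b \in c, x \in d, a <= x & x <= b].
Proof.
move=> /existsP[a /existsP[b /existsP[x /existsP[y /and3P[/eqP-> /eqP->]]]]].
case/orP=> /and3P[h1 h2 h3].
  by exists a, b, x; rewrite !inE !eqxx ?orbT; split=> //; apply: ltnW.
by exists a, b, y; rewrite !inE !eqxx ?orbT; split=> //; apply: ltnW.
Qed.

(** A chord crossing a chord of [Y] has an end between two letters of [Y], so the chords of [Y] form
    a union of components. *)
Lemma gconnected_convex (Y : {set 'I_N}) : gconnected chords_on ->
  convex X Y -> Y != set0 -> stable m Y -> Y = X.
Proof.
move=> /andP[_ /forall_inP conn] /convexP[YX cY] /set0Pn[y0 y0Y] /stableP sY.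
apply/eqP; rewrite eqEsubset YX; apply/subsetP=> x xX.
have inY i : (chord i \subset Y) = (i \in Y).
  apply/subsetP/idP => [|iY z]; first by apply; rewrite !inE eqxx.
  by rewrite !inE => /orP[]/eqP->; rewrite ?sY.
have imp (c d : {set 'I_N}) : c \in chords_on -> d \in chords_on -> crossing c d -> c \subset Y -> d \subset Y.
  move=> cS dS /crossing_between[a [b [z [ac bc zd az zb]]]] cY'.
  have [i iX di] := mem_chords_on dS; subst d.
  rewrite -(mem_chord zd) inY; apply: (cY a z b) => //; try exact: (subsetP cY').
  exact: (subsetP (chord_sub iX)).
have cl : closed adj [pred c : {set 'I_N} | c \subset Y].
  move=> c d /and3P[cS dS cd]; rewrite !inE; apply/idP/idP; apply: imp => //.
  by rewrite crossing_sym.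
have := conn _ (chord_in (subsetP YX _ y0Y)) => /forall_inP/(_ _ (chord_in xX)).
by move/(closed_connect cl); rewrite !inE !inY y0Y => <-.
Qed.

(** Every component contains the chord at the smallest letter [x0]: its hull is a closed interval,
    hence everything, so some end of the component is at most [x0] and therefore equal to it. *)
Lemma convex_gconnected : X != set0 -> (forall x, x \in X -> m x != x) ->
  (forall Y, convex X Y -> Y != set0 -> stable m Y -> Y = X) -> gconnected chords_on.
Proof.
move=> X0 nf H; have [u uX] := set0Pn _ X0.
have S0 : chords_on != set0 by apply/set0Pn; exists (chord u); apply: chord_in.
rewrite /gconnected S0 /=.
pose x0 := [arg min_(i < u in X) i].
have [x0X xmin] : x0 \in X /\ forall i, i \in X -> x0 <= i.
  by rewrite /x0; case: arg_minnP.
suff key c : c \in chords_on -> connect adj c (chord x0).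
  apply/forall_inP=> c cS; apply/forall_inP=> d dS.
  by apply: connect_trans (key c cS) _; rewrite adj_connect_sym key.
move=> cS; pose Q := [set x in X | connect adj c (chord x)].
have mQ x : x \in Q -> m x \in Q by rewrite !inE chord_m => /andP[xX ->]; rewrite mX.
(* The convex hull of a component is closed under [m]: a chord escaping from a gap of
   the component would cross one of its chords. *)
pose H' := [set x in X | [exists a in Q, [exists b in Q, a <= x <= b]]].
have QH x : x \in Q -> x \in H'.
  move=> xQ; rewrite inE; have := xQ; rewrite inE => /andP[-> _] /=.
  by apply/exists_inP; exists x => //; apply/exists_inP; exists x; rewrite ?leqnn.
have HP x : x \in H' -> x \in X /\ exists a b, [/\ a \in Q, b \in Q, a <= x & x <= b].
  rewrite inE => /andP[xX /exists_inP[a aQ /exists_inP[b bQ /andP[? ?]]]].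
  by split=> //; exists a, b.
have Hi x a b : x \in X -> a \in Q -> b \in Q -> a <= x -> x <= b -> x \in H'.
  move=> xX aQ bQ ax xb; rewrite inE xX; apply/exists_inP; exists a => //.
  by apply/exists_inP; exists b; rewrite ?ax.
have cH : convex X H'.
  apply/convexP; split; first by apply/subsetP=> x /HP[].
  move=> x y z /HP[xX [a [b [aQ bQ ax xb]]]] /HP[zX [a' [b' [aQ' bQ' ax' xb']]]] yX xy yz.
  by apply: (Hi y a b') => //; [apply: leq_trans xy|apply: leq_trans xb'].
have [i iX ci] := mem_chords_on cS.
have iQ : i \in Q by rewrite inE iX -ci connect0.
have sH : stable m H'.
  apply/stableP=> x xH; have [xX [a [b [aQ bQ ax xb]]]] := HP x xH.
  have [xQ|xQ] := boolP (x \in Q); first exact/QH/mQ.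
  have nQ z : z \in Q -> z != x by move=> zQ; apply: contraNneq xQ => <-.
  have [/exists_inP[z zQ /andP[zx xz]]|] := boolP [exists z in Q, (z < x) && (x < m z)].
    apply: contraNT xQ => mxH; rewrite inE xX.
    have zX : z \in X by move: zQ; rewrite inE => /andP[].
    have mxX := mX xX.
    have out1 : ~~ ((z <= m x) && (m x <= m z)).
      by apply: contra mxH => /andP[h1 h2]; apply: (Hi _ z (m z)) => //; apply: mQ.
    have cz : connect adj c (chord z) by move: zQ; rewrite inE => /andP[].
    apply: connect_trans cz _; apply: connect1; rewrite /= !chord_in //=.
    apply/existsP; exists z; apply/existsP; exists (m z).
    have [lt|ge] := ltnP (m x) z.
      apply/existsP; exists (m x); apply/existsP; exists x.
      by rewrite /chord eqxx setUC eqxx lt zx xz orbT.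
    apply/existsP; exists x; apply/existsP; exists (m x).
    rewrite /chord !eqxx zx xz /=; apply/orP; left.
    by move: out1; rewrite ge /= -ltnNge.
  rewrite negb_exists_in => /forall_inP ns; exfalso.
  (* No chord of the component straddles [x]. So its chords to the left of [x] never cross those to
     the right, although the chords at [a] and [b] are connected. *)
  have side z : z \in Q -> (z < x) = (m z < x).
    move=> zQ; apply/idP/idP => zx.
      have := ns z zQ; rewrite zx /= -leqNgt leq_eqVlt => /orP[/eqP/val_inj e|//].
      by have := nQ _ (mQ _ zQ); rewrite e eqxx.
    have := ns _ (mQ _ zQ); rewrite zx mm /= -leqNgt leq_eqVlt => /orP[/eqP/val_inj e|//].
    by have := nQ _ zQ; rewrite e eqxx.
  pose A := [pred d : {set 'I_N} | connect adj c d && (d \subset [set y : 'I_N | y < x])].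
  have sub z : z \in Q -> (chord z \subset [set y : 'I_N | y < x]) = (z < x).
    move=> zQ; apply/subsetP/idP => [/(_ z)|zx w]; first by rewrite !inE eqxx; apply.
    by rewrite !inE => /orP[]/eqP-> //; rewrite -side.
  have Qof (d : {set 'I_N}) : d \in chords_on -> connect adj c d -> exists2 z, z \in Q & d = chord z.
    by move=> /mem_chords_on[z zX ->] cd; exists z; rewrite // inE zX.
  have imp (d e : {set 'I_N}) : d \in chords_on -> e \in chords_on -> crossing d e -> d \in A -> e \in A.
    move=> dS eS de; rewrite !inE => /andP[cd sd].
    have ce : connect adj c e by apply: connect_trans cd _; apply: connect1; rewrite dS eS.
    rewrite ce /=; have [z zQ ez] := Qof e eS ce; have [w wQ ew] := Qof d dS cd; subst d e.
    have [p [q [r [_ qd re _ rq]]]] := crossing_between de.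
    have rQ : r \in Q by move: re; rewrite !inE => /orP[]/eqP->; [move: zQ|move: (mQ _ zQ)]; rewrite inE.
    rewrite -(mem_chord re) sub //; apply: leq_ltn_trans rq _.
    by have := subsetP sd q qd; rewrite inE.
  have clA : closed adj A.
    by move=> d e /and3P[dS eS de]; apply/idP/idP; apply: imp => //; rewrite crossing_sym.
  have ca : connect adj c (chord a) by move: aQ; rewrite inE => /andP[].
  have cb : connect adj c (chord b) by move: bQ; rewrite inE => /andP[].
  have ltne (p q : 'I_N) : p <= q -> p != q -> p < q by rewrite ltn_neqAle => -> ->.
  have : connect adj (chord a) (chord b).
    by apply: connect_trans cb; rewrite adj_connect_sym.
  move/(closed_connect clA); rewrite !inE ca cb !sub //=.
  by rewrite (ltne a x ax (nQ _ aQ)) ltnNge xb.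
have H0 : H' != set0 by apply/set0Pn; exists i; apply: QH.
have : x0 \in H' by rewrite (H _ cH H0 sH).
move/HP=> [_ [a [b [aQ _ ax _]]]].
have aX : a \in X by move: aQ; rewrite inE => /andP[].
have -> : x0 = a by apply/val_inj/eqP; rewrite eqn_leq ax xmin.
by rewrite ci; move: aQ; rewrite inE ci => /andP[].
Qed.

End ChordGraph.

Lemma perfectP k (m : {ffun 'I_k -> 'I_k}) :
  reflect (matching setT m /\ fixpts m setT = set0) (perfect m).
Proof.
apply: (iffP forallP) => [H|[/matchingP[mm _] f] x].
  split; first by apply/matchingP; split=> x; [case/andP: (H x) => /eqP|rewrite inE].
  by apply/setP=> x; rewrite !inE; case/andP: (H x) => _ /negbTE.
by rewrite mm eqxx; apply/negP => e; have := in_set0 x; rewrite -f !inE e.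
Qed.

Lemma perfect_connected k (m : {ffun 'I_k -> 'I_k}) : 0 < k ->
  perfect m && chord_connected m = word 0 1 setT m.
Proof.
move=> k0; have T0 : [set: 'I_k] != set0 by apply/set0Pn; exists (Ordinal k0).
have CE : matching setT m -> chords m = chords_on setT m.
  by move=> _; apply/setP=> c; apply/imsetP/imsetP => -[i _ ->]; exists i.
apply/andP/wordP => [[/perfectP[mT f] cm]|[mT /eqP f H]].
  have [mm _] := matchingP _ _ mT.
  rewrite f cards0; split=> // Y cY; rewrite card_gt0 => Y0 YT; rewrite lt0n; apply/eqP => oY.
  rewrite /chord_connected CE // in cm.
  have hT x : x \in setT -> m x \in setT by rewrite !inE.
  have := gconnected_convex mm hT cm cY Y0 (out0_stable oY).
  by move=> e; rewrite e ltnn in YT.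
rewrite cards_eq0 in f; have {}f := eqP f.
have [mm _] := matchingP _ _ mT.
have nf x : m x != x by apply/negP=> e; have := in_set0 x; rewrite -f !inE e.
split; first exact/perfectP.
rewrite /chord_connected CE //; apply: convex_gconnected => //.
  by move=> x _; rewrite inE.
move=> Y cY Y0 sY.
apply/eqP; rewrite eqEcard subsetT leqNgt; apply/negP=> lt.
have := H Y cY; rewrite card_gt0 => /(_ Y0 lt).
rewrite stable_out // card_gt0 => /set0Pn[x]; rewrite inE.
by rewrite (negbTE (nf x)) andbF.
Qed.

Lemma cC_nword n : 0 < n -> cC n = nword 0 1 n.*2.
Proof.
move=> n0; apply: eq_card => m; rewrite !inE perfect_connected //; lia.
Qed.

Lemma cC0 : cC 0 = 0.
Proof.
apply: eq_card0 => m; rewrite inE; apply/negP=> /andP[_ /andP[/set0Pn[c /imsetP[[i ?] _ _]]]] //.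
Qed.

(** * Erasing the first point of a diagram *)

Section CutRoot.
Variable n : nat.
Local Notation T := [set: 'I_n.+1].
Local Notation R := (~: [set (@ord0 n)]).
Implicit Types (m : {ffun 'I_n.+1 -> 'I_n.+1}) (Y : {set 'I_n.+1}).

Definition cut0 m : {ffun 'I_n.+1 -> 'I_n.+1} :=
  [ffun x => if (x == ord0) || (x == m ord0) then x else m x].

(** The inverse of [cut0]: the first point is matched with the unmatched letter. The default value
    of [odflt] occurs only when there is no such letter. *)
Definition glue0 m : {ffun 'I_n.+1 -> 'I_n.+1} :=
  let j := odflt ord0 [pick x in fixpts m R] in
  [ffun x => if x == ord0 then j else if x == j then ord0 else m x].

Lemma cardR : #|R| = n.
Proof. by have := cardsC [set (@ord0 n)]; rewrite cards1 card_ord; lia. Qed.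

Lemma convexR : convex T R.
Proof.
apply/convexP; split; first exact: subsetT.
move=> x y z; rewrite !inE -!(inj_eq val_inj) /= => ? _ _; lia.
Qed.

Lemma perfect_prop m : perfect m -> (forall x, m (m x) = x) /\ (forall x, m x != x).
Proof.
case/perfectP=> /matchingP[mm _] f; split=> // x; apply/negP=> e.
by have := in_set0 x; rewrite -f !inE e.
Qed.

Lemma cut0_matching m : perfect m ->
  matching R (cut0 m) /\ fixpts (cut0 m) R = [set m ord0].
Proof.
move=> /perfect_prop[mm nf]; split.
  apply/matchingP; split=> x; rewrite !ffunE; last by rewrite !inE negbK => ->.
  case: (boolP ((x == ord0) || (x == m ord0))) => [->//|/norP[x0 x1]].
  rewrite (can2_eq mm mm) (negbTE x1) (inj_eq (can_inj mm)) (negbTE x0) /=.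
  exact: mm.
apply/setP=> x; rewrite !inE ffunE; case: eqP => [->|_] /=.
  by apply/esym/negbTE; rewrite eq_sym nf.
by case: ifP => // e; rewrite ?eqxx // (negbTE (nf x)).
Qed.

Lemma cut0K m : perfect m -> glue0 (cut0 m) = m.
Proof.
move=> pm; have [mm nf] := perfect_prop pm; have [_ f] := cut0_matching pm.
rewrite /glue0 f; case: pickP => [j /set1P->|/(_ (m ord0))] /=; last by rewrite set11.
apply/ffunP=> x; rewrite !ffunE; case: eqP => [->//|_]; case: eqP => [->|//].
by rewrite mm.
Qed.

Lemma glue0K m : matching R m -> #|fixpts m R| = 1 -> perfect (glue0 m) /\ cut0 (glue0 m) = m.
Proof.
move=> /matchingP[mm mR] /eqP/cards1P[j fj]; rewrite /glue0 fj.
case: pickP => [j' /set1P->|/(_ j)] /=; last by rewrite set11.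
have : j \in [set j] by rewrite set11.
rewrite -fj !inE => /andP[j0 /eqP mj].
have m0 : m ord0 = ord0 by rewrite mR // !inE negbK.
have nf x : x != ord0 -> x != j -> m x != x.
  move=> x0; apply: contra => mx; apply/eqP/set1P; rewrite -fj !inE x0; exact: mx.
have m_eq x y : (m x == m y) = (x == y) by rewrite (inj_eq (can_inj mm)).
split.
  apply/forallP=> x; rewrite !ffunE.
  have [->|x0] := eqVneq x ord0; first by rewrite (negbTE j0) !eqxx.
  have [->|xj] := eqVneq x j; first by rewrite !eqxx eq_sym j0.
  have -> : (m x == ord0) = false by rewrite -m0 m_eq (negbTE x0).
  have -> : (m x == j) = false by rewrite -mj m_eq (negbTE xj).
  by rewrite mm eqxx nf.
apply/ffunP=> x; rewrite !ffunE eqxx.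
have [->|x0] := eqVneq x ord0; first by rewrite m0.
by have [->|xj] := eqVneq x j; rewrite ?mj.
Qed.

(** The former partner of the first point leaves [Y] in both cases: its chord led outside [Y], and
    now it is unmatched. *)
Lemma cut0_out m Y : perfect m -> Y \subset R -> out (cut0 m) Y = out m Y.
Proof.
move=> /perfect_prop[mm nf] YR; apply: eq_bigr => y yY; rewrite ffunE.
have : y != ord0 by have := subsetP YR y yY; rewrite !inE.
move/negbTE => -> /=; have [->|//] := eqVneq y (m ord0).
rewrite mm eqxx orbT; case: (boolP (ord0 \in Y)) => // /(subsetP YR).
by rewrite !inE eqxx.
Qed.

Lemma card_cut0 (P Q : pred {ffun 'I_n.+1 -> 'I_n.+1}) :
  (forall m, P m -> perfect m) -> (forall m, Q m -> matching R m /\ #|fixpts m R| = 1) ->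
  (forall m, perfect m -> P m = Q (cut0 m)) ->
  #|[set m | P m]| = #|[set m | Q m]|.
Proof.
move=> Pp Qp PQ; apply: (@card_can_in _ _ _ _ cut0 glue0) => m; rewrite !inE.
- by move=> Pm; rewrite -PQ ?Pp.
- by move=> Qm; have [mR f] := Qp _ Qm; have [pg e] := glue0K mR f; rewrite PQ // e.
- by move/Pp/cut0K.
- by case/Qp=> mR f; case: (glue0K mR f).
Qed.

Lemma perfect_stable m Y : perfect m -> stable m Y = (out m Y == 0).
Proof.
move=> /perfect_prop[mm nf]; apply/stableP/out0P => H y /H; first by split.
by case.
Qed.

Lemma perfect_outC m Y : perfect m -> (out m (~: Y) == 0) = (out m Y == 0).
Proof.
move=> pm; have [mT _] := perfectP _ pm.
rewrite -!perfect_stable //; apply/idP/idP => s.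
  by rewrite -[Y]setCK -setTD; apply: stableC.
by rewrite -setTD; apply: stableC.
Qed.

Lemma sub_R Y : (Y \subset R) = (ord0 \notin Y).
Proof. by rewrite subsetC sub1set inE. Qed.

Lemma word_perfect b m : word 0 b T m -> perfect m.
Proof.
case/wordP=> mT /eqP f _; apply/perfectP; split=> //.
by move: f; rewrite cards_eq0 => /eqP.
Qed.

(** An interval containing the first point is replaced by its complement, which is again an interval
    and is closed exactly when the interval is. *)
Lemma cut0_connected m : 0 < n -> perfect m -> word 0 1 T m = word 1 1 R (cut0 m).
Proof.
move=> n0 pm; have [mR fR] := cut0_matching pm.
apply/wordP/wordP => -[_ _ H]; split=> //; first by rewrite fR cards1.
- move=> Y cY Y1; rewrite cardR => Yn; have YR := proj1 (convexP _ _ cY).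
  rewrite cut0_out // H //; first exact: convex_trans convexR cY.
  by rewrite cardsT card_ord ltnW.
- by case/perfectP: pm.
- by case/perfectP: pm => _ ->; rewrite cards0.
have key Y : convex T Y -> 0 < #|Y| -> ord0 \notin Y -> 0 < out m Y.
  move=> cY Y1; rewrite -sub_R => YR; rewrite -cut0_out //.
  have [lt|ge] := ltnP #|Y| #|R|; first by apply: H => //; apply: convex_sub cY YR.
  have -> : Y = R by apply/eqP; rewrite eqEcard YR.
  by rewrite out_full // fR cards1.
move=> Y cY Y1 YT; have [Y0|] := boolP (ord0 \in Y); last exact: key.
rewrite lt0n -perfect_outC // -lt0n; apply: key; rewrite ?inE ?Y0 //.
  exact: convex_init.
have := cardsC Y; move: YT; rewrite cardsT card_ord; lia.
Qed.

Lemma nword_cut0 : 0 < n -> nword 0 1 n.+1 = nword 1 1 n.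
Proof.
move=> n0; rewrite -[in RHS]cardR -card_word -?card_gt0 ?cardR //.
apply: card_cut0 => m; first exact: word_perfect.
  by case/wordP.
exact: cut0_connected.
Qed.

Lemma mem_chords m y : chord m y \in chords m.
Proof. by apply/imsetP; exists y. Qed.

Lemma chords_del m y : perfect m -> chords m :\ chord m y = chords_on (~: chord m y) m.
Proof.
move=> pm; have [mm nf] := perfect_prop pm.
apply/setP=> c; apply/setD1P/imsetP => [[cy /imsetP[x _ cx]]|[x xy ->]].
  exists x => //; rewrite inE; apply: contra cy => xy.
  by rewrite cx -/(chord m x) (mem_chord mm xy).
split; last by apply/imsetP; exists x.
by apply: contraTneq xy => <-; rewrite !inE eqxx.
Qed.

Lemma card_chords m : perfect m -> (1 < #|chords m|) = (2 < n.+1).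
Proof.
move=> pm; have [mm nf] := perfect_prop pm.
apply/card_gt1P/idP => [[c [d [/imsetP[x _ ->] /imsetP[y _ ->] cd]]]|n2].
  have xmx : x != m x by rewrite eq_sym.
  have yx : y \notin [set x; m x].
    by apply: contra cd => h; rewrite -!/(chord m _) (mem_chord mm h).
  have := subset_leq_card (subsetT (y |: [set x; m x])).
  by rewrite cardsU1 yx cards2 xmx cardsT card_ord.
have [y yc] : exists y, y \notin chord m ord0.
  apply/existsP; rewrite -negb_forall; apply/negP=> /forallP h.
  have : #|T| <= #|chord m ord0| by apply: subset_leq_card; apply/subsetP => z _; apply: h.
  rewrite cardsT card_ord cards2 leqNgt; case: (_ != _) => //=; rewrite ?n2 //.
  by rewrite (ltnW n2).
exists (chord m ord0), (chord m y); split; rewrite ?mem_chords //.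
by apply: contraNneq yc => ->; rewrite !inE eqxx.
Qed.

(** A chord disconnects the diagram exactly when it is the only one to leave some interval of
    suitable size; passing to complements, the interval may be taken to avoid the first point. *)
Lemma cut0_2connected m : 1 < n -> perfect m ->
  chord_2connected m = word 1 2 R (cut0 m).
Proof.
move=> n1 pm; have [mm nf] := perfect_prop pm; have [mR fR] := cut0_matching pm.
rewrite /chord_2connected card_chords // ltnS n1 /=.
have connE : gconnected (chords m) = word 1 1 R (cut0 m).
  by rewrite -cut0_connected ?(ltnW n1) // -perfect_connected // pm.
have xsub y x : x \in ~: chord m y -> m x \in ~: chord m y.
  rewrite !inE => /norP[xy xmy]; apply/norP; split.
    by rewrite (can2_eq mm mm).
  by rewrite (inj_eq (can_inj mm)).
apply/idP/idP => [/andP[]|w].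
  rewrite connE => cm /forall_inP del.
  have [_ _ H1] := word1P _ _ cm.
  apply/wordP; split=> //; first by rewrite fR cards1.
  move=> Y cY Y2; rewrite cardR => Yn; have YR := proj1 (convexP _ _ cY).
  have Y0 : Y != set0 by rewrite -card_gt0 ltnW.
  have cTY := convex_trans convexR cY.
  have o1 := H1 Y cY Y0; rewrite ltn_neqAle o1 andbT; apply/negP => /eqP o.
  have /eqP := esym o; rewrite cut0_out // => /out1P[y [yY Hy Hz]].
  have my : m y \notin Y by move: Hy; rewrite (negbTE (nf y)) orbF.
  have := del _ (mem_chords m y); rewrite chords_del // => g.
  (* Without the only chord leaving it, [Y] becomes a closed interval of the rest. Connectedness
     makes it everything, against its size. *)
  have cY' : convex (~: chord m y) (Y :\ y).
    have -> : Y :\ y = Y :&: ~: chord m y.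
      apply/setP=> x; rewrite !inE negb_or andbC; case: (boolP (x \in Y)) => //= xY.
      by case: eqP => //= _; apply/esym; apply: contraNneq my => <-.
    exact: convexIsub (subsetT _) cTY.
  have sY : stable m (Y :\ y).
    apply/stableP=> z; rewrite !inE => /andP[zy zY]; have [mzY _] := Hz z zY zy.
    by rewrite mzY andbT; apply: contraNneq my => <-; rewrite mm.
  have n0 : Y :\ y != set0.
    by rewrite -card_gt0; move: Y2; rewrite (cardsD1 y Y) yY add1n ltnS.
  have e := gconnected_convex mm (@xsub y) g cY' n0 sY.
  move: Yn; rewrite (cardsD1 y Y) e yY; have := cardsC (chord m y).
  by rewrite card_ord cards2 (eq_sym y) nf /= !addSn !add0n => -[h]; rewrite h ltnn.
have [_ _ H2] := wordP _ _ _ _ w.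
have conn : word 1 1 R (cut0 m).
  apply/wordP; split=> //; first by rewrite fR cards1.
  move=> Y cY Y1 YR; have [lt|le] := ltnP 1 #|Y|; first exact/ltnW/H2.
  have /cards1P[z ->] : #|Y| == 1 by rewrite eqn_leq le.
  by rewrite out_set1.
rewrite connE conn /=; apply/forall_inP => c /imsetP[y _ ->].
rewrite -/(chord m y) chords_del //; set e := chord m y.
have ce : #|~: e|.+2 = n.+1.
  by have := cardsC e; rewrite card_ord cards2 (eq_sym y) nf; clear; lia.
have connT : word 0 1 T m by rewrite cut0_connected // ltnW.
have [_ _ HT] := wordP _ _ _ _ connT.
have noclosed Y : convex T Y -> Y != set0 -> stable m Y -> Y = T.
  move=> cY Y0 sY; apply/eqP; rewrite eqEcard subsetT leqNgt; apply/negP=> lt.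
  have := HT Y cY; rewrite card_gt0 => /(_ Y0 lt).
  by rewrite perfect_stable // in sY; rewrite lt0n sY.
apply: convex_gconnected => //; first exact: xsub.
  by rewrite -card_gt0 -2!ltnS ce ltnS.
move=> Y cY Y0 sY.
have [YX cY'] := convexP _ _ cY.
apply/eqP; rewrite eqEsubset YX; apply/negPn/negP => /subsetPn[v vX vY].
(* [H] fills the gaps of [Y] in the full word; outside [Y] it can only contain ends of the deleted
   chord [e]. *)
pose H := [set x : 'I_n.+1 | [exists a in Y, exists b in Y, a <= x <= b]].
have HP (x : 'I_n.+1) : reflect (exists a b, [/\ a \in Y, b \in Y, a <= x & x <= b]) (x \in H).
  rewrite inE; apply: (iffP exists_inP) => [[a aY /exists_inP[b bY /andP[? ?]]]|[a [b [? ? ? ?]]]].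
    by exists a, b.
  by exists a => //; apply/exists_inP; exists b => //; apply/andP.
have YH x : x \in Y -> x \in H by move=> xY; apply/HP; exists x, x.
have HY x : x \in H -> x \in ~: e -> x \in Y.
  by case/HP=> a [b [aY bY ax xb]] xe; apply: (cY' a x b).
have cH : convex T H.
  apply/convexP; split; first exact: subsetT.
  move=> x z t /HP[a [b [? ? ? ?]]] /HP[a' [b' [? ? ? ?]]] _ xz zt.
  by apply/HP; exists a, b'; split=> //; [apply: leq_trans xz|apply: leq_trans zt _].
have vH : v \notin H by apply: contra vY => vH; apply: HY.
have [u uY] := set0Pn _ Y0.
have H0 : H != set0 by apply/set0Pn; exists u; apply: YH.
have HT' : H != T by apply: contraNneq vH => ->; rewrite inE.
have eH x : x \in H -> x \notin Y -> x \in e.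
  by move=> xH xY; apply/negPn/negP => xe; case/negP: xY; apply: HY => //; rewrite in_setC.
have eY x : x \in e -> x \notin Y.
  by move=> xe; apply/negP=> /(subsetP YX); rewrite inE xe.
have emx x : x \in e -> m x \in e.
  by rewrite !inE => /orP[]/eqP->; rewrite ?mm eqxx ?orbT.
have eq2 x z : x \in e -> z \in e -> z = x \/ z = m x.
  by rewrite !inE => /orP[]/eqP-> /orP[]/eqP->; rewrite ?mm; auto.
(* A proper nonempty interval is not closed, and the only chord that can leave [H] is [e]. *)
have [z zH mzH] : exists2 z, z \in H & m z \notin H.
  apply/exists_inP; rewrite -negb_forall_in; apply/negP=> sH.
  by case/eqP: HT'; apply: noclosed => //; apply/stableP; apply/forall_inP.
have ze : z \in e.
  apply: eH => //; apply: contra mzH => zY; apply/YH/(stableP _ _ sY)/zY.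
have Hz x : x \in H -> x != z -> x \in Y.
  move=> xH xz; apply/negPn/negP => xY; case: (eq2 z x ze (eH x xH xY)) => ex.
    by rewrite ex eqxx in xz.
  by rewrite -ex xH in mzH.
have zY := eY z ze; have mzY := eY _ (emx _ ze).
have oH : out m H = 1.
  apply/eqP/out1P; exists z; rewrite zH mzH; split=> // x xH xz.
  by rewrite YH ?nf // (stableP _ _ sY) // Hz.
have oHC : out m (~: H) = 1.
  apply/eqP/out1P; exists (m z); rewrite !in_setC mm negbK zH mzH; split=> // x.
  rewrite !in_setC => xH xz; split; rewrite ?nf //; apply/negP => mxH.
  have mxz : m x != z by rewrite (can2_eq mm mm).
  by case/negP: xH; apply: YH; rewrite -[x]mm (stableP _ _ sY) // Hz.
(* To be applied to whichever of [H] and its complement avoids the first point. *)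
have final K : convex T K -> ord0 \notin K -> 1 < #|K| -> #|K| < n -> out m K = 1 -> False.
  move=> cK; rewrite -sub_R => KR K1 Kn oK.
  by have := H2 K (convex_sub (subsetT _) cK KR) K1; rewrite cardR cut0_out // oK => /(_ Kn).
have cardHC := cardsC H; rewrite card_ord in cardHC.
have mu : m u \in Y by apply: (stableP _ _ sY).
have two : 1 < #|H| by apply/card_gt1P; exists u, (m u); rewrite !YH // eq_sym nf.
(* Each side contains a whole chord besides one end of [e], hence three letters; this bounds the
   size of the other side. *)
have three : 2 < #|H|.
  have : z |: [set u; m u] \subset H.
    by apply/subsetP=> x; rewrite in_setU1 in_set2 => /or3P[]/eqP->; rewrite ?zH //; apply: YH.
  move/subset_leq_card; rewrite cardsU1 cards2 (eq_sym u) nf in_set2.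
  by case: eqP => [zu|_]; [rewrite zu uY in zY|case: eqP => [zu|_]; [rewrite zu mu in zY|]].
have vC : v \in ~: H by rewrite in_setC.
have mvC : m v \in ~: H.
  rewrite in_setC; apply: contra vY => mvH; rewrite -[v]mm (stableP _ _ sY) //.
  by apply: HY => //; apply: xsub.
have mzC : m z \in ~: H by rewrite in_setC.
have three' : 2 < #|~: H|.
  have : m z |: [set v; m v] \subset ~: H.
    by apply/subsetP=> x; rewrite in_setU1 in_set2 => /or3P[]/eqP->.
  move/subset_leq_card; rewrite cardsU1 cards2 (eq_sym v) nf.
  have -> // : m z \notin [set v; m v].
  have zv x : x \in ~: e -> m z != x.
    by move=> xe; apply: contraTneq xe => <-; rewrite inE negbK; apply: emx.
  by rewrite in_set2 negb_or !zv ?xsub.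
have aux (a b : nat) : a + b = n.+1 -> (2 < b -> a < n) /\ (2 < a -> b < n).
  by clear; lia.
have [h0|h0] := boolP (ord0 \in H); last first.
  by apply: (final H) => //; apply: (proj1 (aux _ _ cardHC)).
apply: (final (~: H)) => //; first exact: convex_init.
- by rewrite in_setC h0.
- exact: ltnW.
- exact: (proj2 (aux _ _ cardHC)).
Qed.

End CutRoot.

Lemma cC2_nword n : 1 < n -> cC2 n = nword 1 2 n.*2.-1.
Proof.
move=> n1; rewrite /cC2; case E : n.*2 => [|k]; first by lia.
have k1 : 1 < k by lia.
rewrite /= -[in RHS](@cardR k) -card_word -?card_gt0 ?cardR ?(ltnW k1) //.
apply: card_cut0 => m; first by case/andP.
  by case/wordP.
by move=> pm; rewrite pm cut0_2connected.
Qed.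

Lemma cCS_nword n : cC n.+1 = nword 1 1 n.*2.+1.
Proof. by rewrite cC_nword // doubleS nword_cut0. Qed.

(** * Closed Yukawa graphs as involutions on half-edges *)

(* [Some true], [Some false], [None]: outgoing fermion, incoming fermion, boson. *)
Definition ty := option bool.
Definition dual (t : ty) : ty := omap negb t.

Lemma dualK : involutive dual.
Proof. by case=> [[]|]. Qed.

Section Graphs.
Variable T : finType.
Implicit Types (X Y A : {set T}) (e : {ffun T * ty -> T * ty}) (h : T * ty).

(** The involution pairs the half-edges at [X] and is the identity elsewhere. As the boson type is
    self-dual, [e h != h] is what keeps a boson half-edge from being paired with itself. *)
Definition graph X e := [forall h, (e (e h) == h) &&
  (if h.1 \in X then (e h != h) && ((e h).2 == dual h.2) else e h == h)].

Definition cut e Y := \sum_h ((h.1 \in Y) && ((e h).1 \notin Y) : nat).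

(** This includes connectedness, since a union of components has an empty cut. *)
Definition bridgeless X e :=
  [forall Y : {set T}, [&& Y \subset X, Y != set0 & Y != X] ==> (1 < cut e Y)].

(* In a bridgeless graph: no two-edge cut contains the half-edge [(r, t)]. *)
Definition uncut X r e t :=
  [forall Y : {set T}, [&& Y \subset X, r \notin Y & (e (r, t)).1 \in Y] ==> (2 < cut e Y)].

(** [F] grows from [set0], all bridgeless graphs, to the full set of types, the graphs that come
    from 1PI ones. *)
Definition rooted (F : {set ty}) X r e :=
  [&& graph X e, bridgeless X e & [forall t in F, uncut X r e t]].

Definition halves X := [set h : T * ty | h.1 \in X].

Lemma graphP X e : reflect [/\ forall h, e (e h) = h, forall h, h.1 \notin X -> e h = h
    & forall h, h.1 \in X -> e h != h /\ (e h).2 = dual h.2] (graph X e).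
Proof.
apply: (iffP forallP) => [H|[ee eX eY] h].
  split=> h; have := H h; first by case/andP=> /eqP.
    by move=> /andP[_] /[swap] /negbTE-> /eqP.
  by move=> /andP[_] /[swap] -> /andP[-> /eqP->].
rewrite ee eqxx /=; case: ifP => hX; first by have [-> ->] := eY h hX; rewrite eqxx.
by rewrite eX ?hX.
Qed.

Lemma graph_in X e h : graph X e -> ((e h).1 \in X) = (h.1 \in X).
Proof.
move=> /graphP[ee eX _]; apply/idP/idP => hX; apply/negPn/negP => nX.
  by move: hX; rewrite eX ?(negbTE nX).
by have := eX _ nX; rewrite ee => e'; move: nX; rewrite -e' hX.
Qed.

Lemma half_partner X e x t : graph X e -> x \in X -> e (x, t) = ((e (x, t)).1, dual t).
Proof. by case/graphP=> _ _ H xX; have [_ <-] := H (x, t) xX; case: (e _). Qed.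

Lemma bridgelessP X e : reflect
  (forall Y : {set T}, Y \subset X -> Y != set0 -> Y != X -> 1 < cut e Y)
  (bridgeless X e).
Proof.
apply: (iffP forallP) => H Y; last by apply/implyP=> /and3P[]; apply: H.
by move=> Y1 Y2 Y3; move/implyP: (H Y); apply; rewrite Y1 Y2.
Qed.

Lemma uncutP X r e t : reflect
  (forall Y : {set T}, Y \subset X -> r \notin Y -> (e (r, t)).1 \in Y -> 2 < cut e Y)
  (uncut X r e t).
Proof.
apply: (iffP forallP) => H Y; last by apply/implyP=> /and3P[]; apply: H.
by move=> Y1 Y2 Y3; move/implyP: (H Y); apply; rewrite Y1 Y2.
Qed.

Lemma rootedP (F : {set ty}) X r e : reflect
  [/\ graph X e, bridgeless X e & forall t, t \in F -> uncut X r e t] (rooted F X r e).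
Proof. by apply: (iffP and3P) => -[? ? H]; split=> //; apply/forall_inP. Qed.

Lemma cut_submod e Y Z : cut e (Y :|: Z) + cut e (Y :&: Z) <= cut e Y + cut e Z.
Proof.
rewrite /cut -!big_split; apply: leq_sum => h _ /=; rewrite !inE.
by case: (h.1 \in Y); case: (h.1 \in Z); case: (_ \in Y); case: (_ \in Z).
Qed.

Lemma cutC X e Y : graph X e -> Y \subset X -> cut e (X :\: Y) = cut e Y.
Proof.
move=> gX YX; have [ee _ _] := graphP _ _ gX.
rewrite /cut (reindex_inj (can_inj ee)); apply: eq_bigr => h _ /=.
rewrite ee !in_setD (graph_in _ gX) negb_and negbK.
case: (boolP (h.1 \in X)) => hX; rewrite ?andbF ?orbF ?andbT; first by rewrite andbC.
by rewrite (contraNF (subsetP YX _)).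
Qed.

Lemma cut_eq e e' Y : (forall h, h.1 \in Y -> e h = e' h) -> cut e Y = cut e' Y.
Proof. by move=> E; apply: eq_bigr => h _; case: (boolP (h.1 \in Y)) => // /E->. Qed.

Lemma cut_join X A e1 e2 Y : graph A e1 -> graph (X :\: A) e2 -> Y \subset X ->
  cut (joinf (halves A) e1 e2) Y = cut e1 (Y :&: A) + cut e2 (Y :\: A).
Proof.
move=> g1 g2 YX; rewrite /cut -big_split; apply: eq_bigr => h _ /=; rewrite ffunE !inE.
case: (boolP (h.1 \in A)) => hA /=; first by rewrite (graph_in _ g1) hA !andbT addn0.
case: (boolP (h.1 \in Y)) => hY //=.
have := graph_in h g2; rewrite !inE hA (subsetP YX _ hY) /= => /andP[-> _].
by [].
Qed.

(* Conjugation by [tperm a b] exchanges the partners of the half-edges [a] and [b]. *)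
Definition conjf (s : {perm T * ty}) e : {ffun T * ty -> T * ty} := [ffun h => s (e (s h))].

Lemma conj_tpermK a b : involutive (conjf (tperm a b)).
Proof. by move=> e; apply/ffunP=> h; rewrite !ffunE !tpermK. Qed.

Section Switch.
Variables (e : {ffun T * ty -> T * ty}) (a b : T * ty).
Hypotheses (ee : forall h, e (e h) = h) (ab : a != b) (ae : e a != a) (be : e b != b)
  (eab : e a != b).
Local Notation e' := (conjf (tperm a b) e).

Let eba : e b != a.
Proof. by apply: contraNneq eab => <-; rewrite ee. Qed.
Let eaeb : e a != e b.
Proof. by rewrite (inj_eq (can_inj ee)). Qed.

Lemma conj_a : e' a = e b.
Proof. by rewrite ffunE tpermL tpermD // eq_sym. Qed.

Lemma conj_b : e' b = e a.
Proof. by rewrite ffunE tpermR tpermD // eq_sym. Qed.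

Lemma conj_ea : e' (e a) = b.
Proof. by rewrite ffunE [tperm _ _ (e a)]tpermD 1?eq_sym // ee tpermL. Qed.

Lemma conj_eb : e' (e b) = a.
Proof. by rewrite ffunE [tperm _ _ (e b)]tpermD 1?eq_sym // ee tpermR. Qed.

Lemma conj_other h : h != a -> h != b -> h != e a -> h != e b -> e' h = e h.
Proof.
move=> ha hb ha' hb'; rewrite ffunE [tperm _ _ h]tpermD 1?eq_sym // tpermD // eq_sym.
  by apply: contra ha' => /eqP<-; rewrite ee.
by apply: contra hb' => /eqP<-; rewrite ee.
Qed.

(** An edge contributes to the cut the exclusive or of its ends. The edges from [a] to [e a] and
    from [b] to [e b] give way to those from [a] to [e b] and from [b] to [e a]; the balance is
    written without subtraction. *)
Lemma cut_switch Y : let y h := h.1 \in Y in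
  cut e' Y + (y a (+) y (e a)) + (y b (+) y (e b)) =
  cut e Y + (y a (+) y (e b)) + (y b (+) y (e a)).
Proof.
move=> y; rewrite /cut.
have D (f : T * ty -> nat) : \sum_h f h =
    f a + (f b + (f (e a) + (f (e b) + \sum_(h | (h != a) && (h != b) && (h != e a) && (h != e b)) f h))).
  rewrite (bigD1 a) //= (bigD1 b) 1?eq_sym //= (bigD1 (e a)) /=; last by rewrite ae.
  by rewrite (bigD1 (e b)) //= eba be eq_sym.
rewrite !D conj_a conj_b conj_ea conj_eb !ee.
set S := (\sum_(_ | _) _); set S' := (\sum_(_ | _) _).
have <- : S = S'.
  apply: eq_bigr => h /andP[/andP[/andP[h1 h2] h3] h4]; by rewrite conj_other.
rewrite -/(y a) -/(y b) -/(y (e a)) -/(y (e b)).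
by case: (y a); case: (y b); case: (y (e a)); case: (y (e b)); rewrite /=; lia.
Qed.

End Switch.

Lemma graph_conj X e a b : graph X e -> a.2 = b.2 -> a.1 \in X -> b.1 \in X ->
  graph X (conjf (tperm a b) e).
Proof.
move=> g a2 aX bX; have [ee eX eY] := graphP _ _ g.
have s2 h : (tperm a b h).2 = h.2 by case: tpermP => [->|->|].
have s1 h : ((tperm a b h).1 \in X) = (h.1 \in X) by case: tpermP => [->|->|]; rewrite ?aX ?bX.
apply/graphP; split=> h.
- by rewrite !ffunE tpermK ee tpermK.
- move=> hX; rewrite ffunE eX ?s1 // tpermK //.
- move=> hX; rewrite ffunE; have [] := eY (tperm a b h); rewrite ?s1 // => n1 n2.
  split; last by rewrite s2 n2 s2.
  by apply: contra n1 => /eqP e1; rewrite -{2}e1 tpermK.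
Qed.

End Graphs.

(** * Relabelling the vertices of rooted graphs *)

Section Transport.
Variables (T T' : finType) (X : {set T}) (X' : {set T'}) (f : T -> T') (g : T' -> T).
Hypotheses (fX : forall x, x \in X -> f x \in X') (gX : forall x, x \in X' -> g x \in X)
  (fK : {in X, cancel f g}) (gK : {in X', cancel g f}).

Definition relabel (e : {ffun T * ty -> T * ty}) : {ffun T' * ty -> T' * ty} :=
  [ffun h => if h.1 \in X' then let k := e (g h.1, h.2) in (f k.1, k.2) else h].

Lemma relabel_in e h : h.1 \in X' -> relabel e h = (f (e (g h.1, h.2)).1, (e (g h.1, h.2)).2).
Proof. by move=> hX; rewrite ffunE hX. Qed.

Lemma cut_relabel e (Y : {set T'}) : graph X e -> Y \subset X' ->
  cut (relabel e) Y = cut e [set x in X | f x \in Y].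
Proof.
move=> ge YX; rewrite /cut.
transitivity (\sum_(h : T' * ty | h.1 \in X') ((h.1 \in Y) && ((relabel e h).1 \notin Y) : nat)).
  rewrite [RHS]big_mkcond; apply: eq_bigr => h _; case: ifP => // hX.
  by rewrite (contraFF (subsetP YX _) hX).
rewrite [RHS](bigID (fun h : T * ty => h.1 \in X)) /= [X in _ = _ + X]big1 ?addn0; last first.
  by move=> h hX; rewrite !inE (negbTE hX).
rewrite (reindex_onto (fun h : T * ty => (f h.1, h.2)) (fun h : T' * ty => (g h.1, h.2))) /=; last first.
  by case=> x t xX; rewrite /= gK.
rewrite [LHS](eq_bigl (fun h : T * ty => h.1 \in X)).
  apply: eq_bigr => -[x t] xX; rewrite relabel_in ?fX //= fK // !inE /= xX /=.
  by rewrite (graph_in (x, t) ge) xX.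
case=> x t /=; apply/andP/idP => [[xX /eqP[<-]]|xX]; first exact: gX.
by rewrite fX // fK.
Qed.

Lemma relabel_rooted F r e : r \in X -> rooted F X r e -> rooted F X' (f r) (relabel e).
Proof.
move=> rX /rootedP[ge /bridgelessP be ue]; have [ee eX eY] := graphP _ _ ge.
have sub Y : [set x in X | f x \in Y] \subset X by apply/subsetP=> x; rewrite inE => /andP[].
apply/rootedP; split.
- apply/graphP; split=> h.
  + case: (boolP (h.1 \in X')) => hX; last by rewrite /relabel !ffunE (negbTE hX) /= (negbTE hX).
    have kX : (e (g h.1, h.2)).1 \in X by rewrite (graph_in _ ge) gX.
    rewrite relabel_in // relabel_in /= ?fX // fK // -surjective_pairing ee /= gK //.
    by rewrite -surjective_pairing.
  + by move=> hX; rewrite ffunE (negbTE hX).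
  + move=> hX; rewrite relabel_in //; have := eY (g h.1, h.2); rewrite gX // => /(_ isT)[n1 n2].
    split=> //=; apply: contra n1 => /eqP E; apply/eqP.
    have := congr1 fst E => /= E1; have := congr1 snd E => /= E2.
    have xX : (e (g h.1, h.2)).1 \in X by rewrite (graph_in _ ge) gX.
    rewrite [LHS]surjective_pairing; congr (_, _) => //.
    by rewrite -[in RHS]E1 fK.
- apply/bridgelessP=> Y YX Y0 YnX; rewrite cut_relabel //; apply: be; rewrite ?sub //.
    case/set0Pn: Y0 => y yY; apply/set0Pn; exists (g y).
    by rewrite inE gX ?gK ?(subsetP YX).
  apply: contra YnX => /eqP E; rewrite eqEsubset YX; apply/subsetP=> y yX.
  have : g y \in [set x in X | f x \in Y] by rewrite E gX.
  by rewrite inE gK // => /andP[].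
- move=> t tF; apply/uncutP=> Y YX rY; rewrite relabel_in ?fX //= fK // => eY'.
  rewrite cut_relabel //; apply: (uncutP _ _ _ _ (ue t tF)); rewrite ?sub // !inE.
    by rewrite rX.
  by rewrite eY' (graph_in _ ge) rX.
Qed.

End Transport.

Lemma relabelK (T T' : finType) (X : {set T}) (X' : {set T'}) f g e :
  (forall x, x \in X -> f x \in X') -> {in X, cancel f g} -> graph X e ->
  relabel X g f (relabel X' f g e) = e.
Proof.
move=> fX fK ge; apply/ffunP=> -[x t]; rewrite ffunE /=; case: ifP => xX; last first.
  by have [_ -> //] := graphP _ _ ge; rewrite xX.
rewrite ffunE /= fX //= fK // fK ?(graph_in _ ge) //.
by case: (e _).
Qed.

Lemma set_bijection (T T' : finType) (X : {set T}) (X' : {set T'}) r r' :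
  r \in X -> r' \in X' -> #|X| = #|X'| ->
  exists f g, [/\ forall x, x \in X -> f x \in X', forall x, x \in X' -> g x \in X,
    {in X, cancel f g}, {in X', cancel g f} & f r = r'].
Proof.
move=> rX rX' E.
pose f0 x := enum_val (cast_ord E (enum_rank_in rX x)).
pose g0 y := enum_val (cast_ord (esym E) (enum_rank_in rX' y)).
have f0X x : f0 x \in X' by apply: enum_valP.
have g0X x : g0 x \in X by apply: enum_valP.
have sX x : x \in X' -> tperm (f0 r) r' x \in X' by case: tpermP => // ->.
exists (fun x => tperm (f0 r) r' (f0 x)), (fun y => g0 (tperm (f0 r) r' y)); split.
- by move=> x _; apply: sX.
- by move=> x _.
- by move=> x xX; rewrite tpermK /g0 /f0 enum_valK_in cast_ordK enum_rankK_in.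
- by move=> y yX; rewrite /g0 /f0 enum_valK_in cast_ordKV enum_rankK_in ?sX // tpermK.
- by rewrite tpermL.
Qed.

Lemma card_rooted (T T' : finType) (X : {set T}) (X' : {set T'}) r r' F :
  r \in X -> r' \in X' -> #|X| = #|X'| ->
  #|[set e | rooted F X r e]| = #|[set e | rooted F X' r' e]|.
Proof.
move=> rX rX' E; have [f [g [fX gX fK gK fr]]] := set_bijection rX rX' E.
have gr : g r' = r by rewrite -fr fK.
apply: (@card_can_in _ _ _ _ (relabel X' f g) (relabel X g f)) => e; rewrite !inE => He.
- by rewrite -fr; apply: relabel_rooted He.
- by rewrite -gr; apply: relabel_rooted He.
- by case/rootedP: He => ge _ _; apply: relabelK.
- by case/rootedP: He => ge _ _; apply: relabelK.
Qed.

(** [n] counts the vertices other than the root. *)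
Definition nrooted F n := #|[set e : {ffun 'I_n.+1 * ty -> 'I_n.+1 * ty} | rooted F setT ord0 e]|.

Lemma card_rooted_n (T : finType) (X : {set T}) r F n : r \in X -> #|X| = n.+1 ->
  #|[set e | rooted F X r e]| = nrooted F n.
Proof. by move=> rX E; apply: card_rooted; rewrite ?inE // cardsT card_ord. Qed.

(** * Two-edge cuts through a root half-edge *)

Section Strip.
Variable T : finType.
Implicit Types (X Y A : {set T}) (e : {ffun T * ty -> T * ty}) (h : T * ty).

Lemma graph_res X A e : A \subset X -> graph X e ->
  (forall h, h.1 \in A -> (e h).1 \in A) ->
  graph A (resf (halves A) e) /\ graph (X :\: A) (resf (~: halves A) e).
Proof.
move=> AX /graphP[ee eX eY] st; split; apply/graphP; split=> h; rewrite !ffunE !inE.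
- by case: (boolP (h.1 \in A)) => hA /=; rewrite ?st ?(negbTE hA).
- by move/negbTE->.
- by move=> hA; rewrite hA; apply: eY; apply: (subsetP AX).
- case: (boolP (h.1 \in A)) => hA /=; first by rewrite hA.
  case: (boolP ((e h).1 \in A)) => //= eA.
  by have := st _ eA; rewrite ee (negbTE hA).
- by case: (h.1 \in A) => //= hX; apply: eX.
- by case/andP=> hA hX; rewrite hA; apply: eY.
Qed.

Lemma graph_join X A e1 e2 : A \subset X -> graph A e1 -> graph (X :\: A) e2 ->
  graph X (joinf (halves A) e1 e2).
Proof.
move=> AX g1 g2; have [ee1 eX1 eY1] := graphP _ _ g1; have [ee2 eX2 eY2] := graphP _ _ g2.
apply/graphP; split=> h; rewrite !ffunE !inE.
- case: (boolP (h.1 \in A)) => hA; first by rewrite (graph_in _ g1) hA.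
  case: (boolP (h.1 \in X)) => hX.
    have := graph_in h g2; rewrite !inE hA hX => /andP[/negbTE-> _]; exact: ee2.
  by rewrite eX2 ?(negbTE hA) ?eX2 // inE (negbTE hX) andbF.
- move=> hX; case: ifP => [/(subsetP AX)|_]; first by rewrite (negbTE hX).
  by rewrite eX2 // inE (negbTE hX) andbF.
- move=> hX; case: (boolP (h.1 \in A)) => hA; first exact: eY1.
  by apply: eY2; rewrite inE hA.
Qed.

Lemma graph_supported X e : graph X e -> supported (halves X) e.
Proof. by case/graphP=> _ H _; apply/supportedP=> h; rewrite inE; apply: H. Qed.

Lemma graph_supportedC X A e : graph (X :\: A) e -> supported (~: halves A) e.
Proof.
case/graphP=> _ H _; apply/supportedP=> h; rewrite !inE negbK => hA.
by apply: H; rewrite inE hA.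
Qed.

Lemma cut_full X e : graph X e -> cut e X = 0.
Proof.
move=> g; apply: big1 => h _; rewrite (graph_in _ g).
by case: (h.1 \in X).
Qed.

Lemma cut_set0 e : cut e set0 = 0.
Proof. by apply: big1 => h _; rewrite inE. Qed.

Definition leaves e A h := (h.1 \in A) && ((e h).1 \notin A).

Lemma cut_uniq e A (s : seq (T * ty)) : uniq s -> all (leaves e A) s -> size s <= cut e A.
Proof.
move=> us al; have -> : cut e A = #|[set h | leaves e A h]|.
  by rewrite -sum1_card [RHS]big_mkcond; apply: eq_bigr => h _; rewrite inE /leaves; case: (_ && _).
by rewrite -(card_uniqP us); apply: subset_leq_card; apply/subsetP=> h /(allP al); rewrite inE.
Qed.

Definition tcut e A t := \sum_(x in A) ((e (x, t)).1 \notin A : nat).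

(** Each vertex has one half-edge of each type, and the edges inside [A] pair type [t] with its
    dual; what is left over on either side leaves [A]. *)
Lemma tcut_dual X A e t : graph X e -> A \subset X -> tcut e A (dual t) = tcut e A t.
Proof.
move=> g AX; have [ee _ eY] := graphP _ _ g.
pose inn t := #|[set x in A | (e (x, t)).1 \in A]|.
have sum t' : inn t' + tcut e A t' = #|A|.
  rewrite /inn /tcut -!sum1_card [X in X + _]big_mkcond [X in _ + X]big_mkcond [RHS]big_mkcond.
  rewrite -big_split; apply: eq_bigr => x _ /=; rewrite inE.
  by case: (x \in A) => //=; case: (_ \in A).
have : inn (dual t) = inn t; last by have := sum t; have := sum (dual t); lia.
have key t' x : x \in A -> e (x, t') = ((e (x, t')).1, dual t').
  by move=> xA; apply: (half_partner _ g); apply: (subsetP AX).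
apply: (@card_can_in _ _ _ _ (fun x => (e (x, dual t)).1) (fun x => (e (x, t)).1)) => x;
  rewrite !inE => /andP[xA eA].
- have := key (dual t) x xA; rewrite dualK => k.
  by rewrite eA -k ee.
- by have := key t x xA => k; rewrite eA -k ee.
- by have := key (dual t) x xA; rewrite dualK => <-; rewrite ee.
- by have <- := key t x xA; rewrite ee.
Qed.

Lemma cut_tcut e A : cut e A = \sum_(t : ty) tcut e A t.
Proof.
transitivity (\sum_x \sum_t ((x \in A) && ((e (x, t)).1 \notin A) : nat)).
  by rewrite pair_bigA; apply: eq_bigr => -[x t'].
rewrite exchange_big; apply: eq_bigr => t _; rewrite /tcut [RHS]big_mkcond.
by apply: eq_bigr => x _; case: (x \in A).
Qed.

Lemma sum_ty (f : ty -> nat) : \sum_t f t = f None + (f (Some true) + f (Some false)).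
Proof.
rewrite (bigD1 None) //= (bigD1 (Some true)) //= (bigD1 (Some false)) //= big1 ?addn0 //.
by case=> [[]|].
Qed.

Section Cutset.
Variables (X : {set T}) (r : T) (F : {set ty}) (t : ty).
Hypotheses (rX : r \in X) (tF : t \notin F).
Local Notation a := (r, t).

Definition two_cut e Y := [&& Y \subset X, r \notin Y, (e a).1 \in Y & cut e Y == 2].

(** [A] is the largest side and [w] the vertex at its second leaving half-edge. The first one,
    [e (r, t)], has the dual type of [t], so by [tcut_dual] the second has type [t]. For bosons the
    two types agree, and [(w, t) != e a] tells the half-edges apart. *)
Definition cutset (A : {set T}) w e := [&& two_cut e A, w \in A, (w, t) != e a,
  (e (w, t)).1 \notin A & [forall Y, two_cut e Y ==> (Y \subset A)]].

Lemma cutset_unique A w A' w' e : rooted F X r e -> cutset A w e -> cutset A' w' e ->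
  A = A' /\ w = w'.
Proof.
move=> /rootedP[g _ _] /and5P[cA wA nw ew /forallP mA] /and5P[cA' wA' nw' ew' /forallP mA'].
have [ee _ _] := graphP _ _ g.
have E : A = A'.
  by apply/eqP; rewrite eqEsubset; move: (mA A') (mA' A); rewrite cA cA' /= => -> ->.
split=> //; subst A'; have /and4P[AX rA aA /eqP c2] := cA.
have [//|nww] := eqVneq w w'.
have : size [:: e a; (w, t); (w', t)] <= cut e A.
  apply: cut_uniq.
    by rewrite /= !inE !negb_or ![e a == _]eq_sym nw nw' xpair_eqE (negbTE nww).
  by rewrite /= /leaves /= ee aA rA wA wA' ew ew'.
by rewrite c2.
Qed.

Lemma cutset_exists e : rooted F X r e -> ~~ uncut X r e t -> exists A w, cutset A w e.
Proof.
move=> /rootedP[g /bridgelessP br _] nu; have [ee _ eY] := graphP _ _ g.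
have bY Y : Y \subset X -> r \notin Y -> Y != set0 -> 1 < cut e Y.
  by move=> YX rY Y0; apply: br => //; apply: contraNneq rY => ->.
have [Y0 cY0] : exists Y, two_cut e Y.
  move: nu; rewrite negb_forall => /existsP[Y]; rewrite negb_imply => /andP[/and3P[YX rY aY]].
  rewrite -leqNgt => c2; exists Y; rewrite /two_cut YX rY aY /= eqn_leq c2 bY //.
  by apply/set0Pn; exists (e a).1.
have [A /maxsetP[cA Amax] _] := maxset_exists cY0.
have /and4P[AX rA aA /eqP c2] := cA.
have [w [wA nw ew]] : exists w, [/\ w \in A, (w, t) != e a & (e (w, t)).1 \notin A].
  have tpos t' : 0 < tcut e A t' -> exists2 x, x \in A & (e (x, t')).1 \notin A.
    rewrite lt0n sum_nat_eq0 negb_forall => /existsP[x].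
    by rewrite negb_imply eqb0 negbK => /andP[xA xe]; exists x.
  have E : e a = ((e a).1, dual t) by apply: half_partner g rX.
  have dpos : 0 < tcut e A (dual t).
    by rewrite /tcut (bigD1 (e a).1) //= -E ee /= rA.
  (* For the self-dual boson type the balance is void. But the fermion half-edges contribute evenly
     to the cut of size 2, so a positive boson contribution equals 2. *)
  have [td|td] := eqVneq t (dual t).
    have tN : t = None by move: td; case: (t) => [[]|].
    have d1 : 0 < tcut e A None by move: dpos; rewrite -td tN.
    have d2 := cut_tcut e A; rewrite sum_ty c2 -(tcut_dual (Some true) g AX) /= in d2.
    have d3 : tcut e A t = 2.
      have aux x y : 0 < x -> 2 = x + (y + y) -> x = 2 by clear; lia.
      by rewrite tN; apply: aux d1 d2.
    case: (pickP (fun x => [&& x \in A, x != (e a).1 & (e (x, t)).1 \notin A])) => [x|none].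
      case/and3P=> xA nx ex; exists x; split=> //.
      by rewrite E xpair_eqE negb_and nx.
    move: d3; rewrite /tcut (bigD1 (e a).1) //= big1 ?addn0; first by case: (_ \notin _).
    by move=> x /andP[xA nx]; have := none x; rewrite xA nx /= => ->.
  move: dpos; rewrite (tcut_dual t g AX) => /tpos[w wA ew]; exists w; split=> //.
  by rewrite E xpair_eqE negb_and td orbT.
exists A, w; apply/and5P; split=> //; apply/forallP=> Y; apply/implyP => cY.
have /and4P[YX rY aY /eqP c2'] := cY.
have UX : A :|: Y \subset X by rewrite subUset AX.
have rU : r \notin A :|: Y by rewrite inE negb_or rA.
(* Union and intersection both contain [(e a).1] and avoid the root, so each has cut at least 2;
   submodularity then fixes that of the union. *)
suff cU : two_cut e (A :|: Y) by rewrite -(Amax _ cU) ?subsetUl ?subsetUr.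
rewrite /two_cut UX rU inE aA /=.
have U0 : A :|: Y != set0 by apply/set0Pn; exists (e a).1; rewrite inE aA.
have I0 : A :&: Y != set0 by apply/set0Pn; exists (e a).1; rewrite inE aA.
have IX : A :&: Y \subset X by rewrite subIset ?AX.
have rI : r \notin A :&: Y by rewrite inE negb_and rA.
have := cut_submod e A Y; have := bY _ UX rU U0; have := bY _ IX rI I0.
rewrite c2 c2'; clear; lia.
Qed.

Section Fixed.
Variables (A : {set T}) (w : T).
Hypotheses (AX : A \subset X) (rA : r \notin A) (wA : w \in A).
Local Notation b := (w, t).
Local Notation c := (conjf (tperm a b)).

Let ab : a != b.
Proof. by rewrite xpair_eqE negb_and; apply/orP; left; apply: contraNneq rA => ->. Qed.

(* Exchanging the partners of [(r, t)] and of the other end [(w, t)] of the two-edge cut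
   splits the graph into a closed graph on [A] and a shorter rooted graph. *)
Lemma detach e : rooted F X r e -> cutset A w e ->
  rooted set0 A w (resf (halves A) (c e)) &&
  rooted (t |: F) (X :\: A) r (resf (~: halves A) (c e)).
Proof.
move=> /rootedP[g /bridgelessP br un] /and5P[/and4P[_ _ aA /eqP c2] _ nw ew /forallP mA].
have [ee eX eY] := graphP _ _ g.
have [ae _] := eY a rX; have [be _] := eY b (subsetP AX _ wA).
have eab : e a != b by rewrite eq_sym.
set e0 := c e.
have g0 : graph X e0 by apply: graph_conj => //; apply: (subsetP AX).
have [E1 E2 E3 E4] := And4 (conj_a ee be eab) (conj_b ae eab)
   (conj_ea ee ae eab) (conj_eb ee be eab).
rewrite -/e0 in E1 E2 E3 E4; have E5 := conj_other ee (b := b) (a := a).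
(* The two half-edges leaving [A] are now paired with each other, and a third one would exceed the
   cut. *)
have st h : h.1 \in A -> (e0 h).1 \in A.
  have [->|hb] := eqVneq h b; first by rewrite E2.
  have [->|hea] := eqVneq h (e a); first by rewrite E3.
  move=> hA; have ha : h != a by apply: contraNneq rA => E; move: hA; rewrite E.
  have heb : h != e b by apply: contraNneq ew => <-.
  rewrite /e0 E5 //; apply/negPn/negP => eh.
  have : size [:: e a; b; h] <= cut e A.
    apply: cut_uniq; first by rewrite /= !inE !negb_or eab eq_sym hea eq_sym hb.
    by rewrite /= /leaves /= ee aA rA wA ew hA eh.
  by rewrite c2.
have [gA gC] := graph_res AX g0 st.
have cE Y : r \notin Y -> cut e0 Y + ((e a).1 \in Y) + ((w \in Y) (+) ((e b).1 \in Y)) =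
   cut e Y + ((e b).1 \in Y) + ((w \in Y) (+) ((e a).1 \in Y)).
  by move=> rY; have := cut_switch ee ab ae be eab Y; rewrite /= (negbTE rY).
have cA Y : Y \subset A -> cut (resf (halves A) e0) Y = cut e0 Y.
  by move=> YA; apply: cut_eq => h /(subsetP YA) hA; rewrite ffunE inE hA.
have cC Y : Y \subset X :\: A -> cut (resf (~: halves A) e0) Y = cut e0 Y.
  move=> YA; apply: cut_eq => h /(subsetP YA); rewrite inE => /andP[hA _].
  by rewrite ffunE !inE hA.
have eqC Y : Y \subset X :\: A -> r \notin Y -> cut e0 Y = cut e Y.
  move=> /subsetP YA rY; have nA x : x \in A -> (x \in Y) = false.
    by move=> xA; apply/negP => /YA; rewrite inE xA.
  by have := cE Y rY; rewrite (nA _ wA) (nA _ aA) /= !addn0 => /addIn.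
have subC Y : Y \subset X :\: A -> Y \subset X by rewrite subsetD => /andP[].
apply/andP; split; apply/rootedP; split=> //.
- apply/bridgelessP=> Y YA Y0 YnA.
  (* The new edge joins [w] to [(e a).1]. A set lacking one of them keeps its cut under the
     exchange; for a set with both, its complement in [A] has neither. *)
  have key (Z : {set T}) : Z \subset A -> Z != set0 -> ~~ ((w \in Z) && ((e a).1 \in Z)) ->
      1 < cut (resf (halves A) e0) Z.
    move=> ZA Z0 nb; rewrite cA //.
    have rZ : r \notin Z by apply: contra rA; apply: (subsetP ZA).
    have ebZ : ((e b).1 \in Z) = false by apply/negP => /(subsetP ZA); apply/negP.
    have -> : cut e0 Z = cut e Z.
      by have := cE Z rZ; rewrite ebZ; move: nb; case: (w \in Z); case: (_ \in Z) => //= _; rewrite ?addn0 => // /addIn.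
    by apply: br => //; [apply: subset_trans AX|apply: contraNneq rZ => ->].
  have [/andP[wY aY]|nb] := boolP ((w \in Y) && ((e a).1 \in Y)); last exact: key.
  rewrite -(cutC gA YA); apply: key; rewrite ?subsetDl // ?inE ?wY //.
  by rewrite setD_eq0; apply: contra YnA => AY; rewrite eqEsubset YA.
- by move=> t'; rewrite inE.
- apply/bridgelessP=> Y YA Y0 YnA.
  have key (Z : {set T}) : Z \subset X :\: A -> Z != set0 -> r \notin Z -> 1 < cut (resf (~: halves A) e0) Z.
    move=> ZA Z0 rZ; rewrite cC // eqC //; apply: br => //; first exact: subC.
    by apply: contraNneq rZ => ->.
  have [rY|rY] := boolP (r \in Y); last exact: key.
  rewrite -(cutC gC YA); apply: key; rewrite ?subsetDl // ?inE ?rY //.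
  by rewrite setD_eq0; apply: contra YnA => AY; rewrite eqEsubset YA.
- move=> t'; rewrite !inE => /orP[/eqP->|t'F]; apply/uncutP => Y YA rY;
    rewrite ffunE !inE /= rA /= cC // eqC //.
    rewrite E1 => bY; have YX := subC _ YA.
    have Y0 : Y != set0 by apply/set0Pn; exists (e b).1.
    have YnX : Y != X by apply: contraNneq rY => ->.
    have c1 := br Y YX Y0 YnX; rewrite ltn_neqAle c1 andbT; apply/negP=> /eqP cY2.
    (* A two-edge cut through the new partner of [(r, t)] would, together with [A], give a larger
       one in the original graph. *)
    have := mA (Y :|: A); rewrite /two_cut subUset YX AX !inE negb_or rY rA aA orbT /=.
    have YA0 : (Y :|: A) :&: A = A by rewrite setIC; apply/setIidPl/subsetUr.
    have YA1 : (Y :|: A) :\: A = Y.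
      rewrite setDUl setDv setU0; apply/setDidPl.
      by move: YA; rewrite subsetD => /andP[].
    have cU : cut e (Y :|: A) = 2.
      have rU : r \notin Y :|: A by rewrite inE negb_or rY.
      have := cE _ rU; rewrite !inE wA aA bY !orbT /= !addn0 => /addIn <-.
      have gJ := cut_join gA gC (Y := Y :|: A); rewrite joinf_res YA0 YA1 in gJ.
      rewrite gJ ?subUset ?YX //.
      by rewrite (cut_full gA) cC // eqC // -cY2.
    rewrite cU /= => /subsetP/(_ (e b).1); rewrite inE bY => /(_ isT).
    exact/negP.
  (* If both edges of the cut end at the root, the exchange closes them to a loop at [r], out of
     reach of sets avoiding [r]. *)
  have [tb|tb] := eqVneq (r, t') (e b).
    by rewrite tb E4 /= => rY'; rewrite rY' in rY.
  rewrite /e0 E5 //.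
  + by move=> eY'; apply: (uncutP _ _ _ _ (un t' t'F)) => //; apply: subC.
  + by rewrite xpair_eqE eqxx /=; apply: contraNneq tF => <-.
  + by rewrite xpair_eqE negb_and; apply/orP; left; apply: contraNneq rA => ->.
  + by apply: contraNneq rA => E; rewrite -[r]/((r, t').1) E.
Qed.

(** The converse of [detach]. Before the exchange the cut of [Y] is the sum of the cuts of its
    traces on [A] and on the rest. The bounds follow by taking the trace on [A] empty, full or
    proper, with a third edge from [uncut] when [Y] contains the partner of [(r, t)]. *)
Lemma attach e1 e2 : rooted set0 A w e1 -> rooted (t |: F) (X :\: A) r e2 ->
  rooted F X r (c (joinf (halves A) e1 e2)) && cutset A w (c (joinf (halves A) e1 e2)).
Proof.
move=> /rootedP[g1 /bridgelessP b1 _] /rootedP[g2 /bridgelessP b2 u2].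
set e0 := joinf _ e1 e2; set e := c e0.
have rC : r \in X :\: A by rewrite inE rA.
have wX := subsetP AX _ wA.
have g0 : graph X e0 by apply: graph_join.
have g : graph X e by apply: graph_conj.
have [ee eX eY] := graphP _ _ g0.
have [ae aty] := eY a rX; have [be _] := eY b wX.
have h3A : (e0 a).1 \notin A.
  rewrite /e0 ffunE inE /= (negbTE rA).
  by have := graph_in a g2; rewrite rC inE => /andP[].
have h1A : (e0 b).1 \in A by rewrite /e0 ffunE inE /= wA (graph_in _ g1).
have eab : e0 a != b by apply: contraNneq h3A => ->.
have [E1 E2 E3 E4] := And4 (conj_a ee be eab) (conj_b ae eab)
   (conj_ea ee ae eab) (conj_eb ee be eab).
rewrite -/e in E1 E2 E3 E4; have E5 := conj_other ee (b := b) (a := a).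
have cE Y : r \notin Y -> cut e Y + ((e0 a).1 \in Y) + ((w \in Y) (+) ((e0 b).1 \in Y)) =
   cut e0 Y + ((e0 b).1 \in Y) + ((w \in Y) (+) ((e0 a).1 \in Y)).
  by move=> rY; have := cut_switch ee ab ae be eab Y; rewrite /= (negbTE rY).
have cJ Y : Y \subset X -> cut e0 Y = cut e1 (Y :&: A) + cut e2 (Y :\: A).
  by move=> YX; apply: cut_join g1 g2 YX.
have cA (Z : {set T}) : Z \subset A -> Z != set0 -> Z != A -> 1 < cut e1 Z by apply: b1.
have cC (Z : {set T}) : Z \subset X :\: A -> r \notin Z -> Z != set0 -> 1 < cut e2 Z.
  by move=> ZC rZ Z0; apply: b2 => //; apply: contraNneq rZ => ->.
have cC3 (Z : {set T}) : Z \subset X :\: A -> r \notin Z -> (e0 a).1 \in Z -> 2 < cut e2 Z.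
  move=> ZC rZ aZ; apply: (uncutP _ _ _ _ (u2 t (setU11 _ _))) => //.
  by move: aZ; rewrite /e0 ffunE inE /= (negbTE rA).
have rb : r != w by apply: contraNneq rA => ->.
have YD Y : Y \subset X -> Y :\: A \subset X :\: A by move=> YX; apply: setSD.
have mem0 Y (x : T) : x \in A -> Y :&: A = set0 -> (x \in Y) = false.
  by move=> xA YA; apply/negP => xY; have := in_set0 x; rewrite -YA inE xY xA.
have memA Y (x : T) : x \in A -> Y :&: A = A -> x \in Y.
  by move=> xA YA; move: xA; rewrite -YA inE => /andP[].
have memD Y : ((e0 a).1 \in Y) = ((e0 a).1 \in Y :\: A) by rewrite inE h3A.
have rD Y : r \notin Y -> r \notin Y :\: A by rewrite inE rA.
have cut2 Y : Y \subset X -> r \notin Y -> Y != set0 -> 1 < cut e Y.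
  move=> YX rY Y0; have := cE Y rY; rewrite cJ // memD.
  have [YA0|YA0] := eqVneq (Y :&: A) set0.
    have YD0 : Y :\: A != set0 by apply: contra Y0 => /eqP YD0; rewrite -(setID Y A) YA0 YD0 setU0.
    rewrite YA0 cut_set0 !(mem0 Y) //=; have := cC _ (YD _ YX) (rD _ rY) YD0; clear; lia.
  have [YA|YA] := eqVneq (Y :&: A) A.
    rewrite YA (cut_full g1) !(memA Y) //=.
    have [->|YD0] := eqVneq (Y :\: A) set0; first by rewrite cut_set0 inE /=; clear; lia.
    have := cC _ (YD _ YX) (rD _ rY) YD0; case: (_ \in Y :\: A) => /=; clear; lia.
  have := cA _ (subsetIr _ _) YA0 YA; have := cC3 _ (YD _ YX) (rD _ rY).
  case: (_ \in Y :\: A) => /= [/(_ isT)|_]; case: (w \in Y); case: (_ \in Y) => /=; clear; lia.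
have brX : bridgeless X e.
  apply/bridgelessP=> Y YX Y0 YnX; have [rY|rY] := boolP (r \in Y); last exact: cut2.
  rewrite -(cutC g YX); apply: cut2; rewrite ?subsetDl // ?inE ?rY //.
  by rewrite setD_eq0; apply: contra YnX => XY; rewrite eqEsubset YX.
apply/andP; split.
  apply/rootedP; split=> // t' t'F; apply/uncutP => Y YX rY gY.
  have tt : t' != t by apply: contraNneq tF => <-.
  have gD : (e2 (r, t')).1 \in Y :\: A.
    have n1 : (r, t') != a by rewrite xpair_eqE eqxx.
    have n2 : (r, t') != b by rewrite xpair_eqE (negbTE rb).
    have n4 : (r, t') != e0 b.
      by apply: contraNneq rA => E; rewrite -[r]/((r, t').1) E.
    (* A fermion loop at the root would leave only its boson edge as a cut around [r]; and if [r]
       were alone, its boson half-edge would be paired with itself. *)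
    have n3 : (r, t') != e0 a.
      apply/eqP => E.
      have [XA|XA] := eqVneq (X :\: A) [set r].
        have [_ _ eY2] := graphP _ _ g2; have [n m] := eY2 (r, None) rC.
        have := graph_in (r, None) g2; rewrite rC XA => /set1P r1.
        by case/eqP: n; rewrite [LHS]surjective_pairing r1 m.
      have r0 : [set r] != set0 by rewrite -card_gt0 cards1.
      have := b2 [set r]; rewrite sub1set rC r0 eq_sym XA => /(_ isT isT isT).
      have E2a : e2 a = (r, t') by move: E; rewrite /e0 ffunE inE /= (negbTE rA).
      have E2b : e2 (r, t') = a by have [ee2 _ _] := graphP _ _ g2; rewrite -E2a ee2.
      rewrite cut_tcut sum_ty /tcut !big_set1 !inE.
      have z1 : (e2 (r, t)).1 == r by rewrite E2a.
      have z2 : (e2 (r, t')).1 == r by rewrite E2b.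
      move: tt z1 z2; case: (t') => [[]|]; case: (t) => [[]|] //= _ -> -> /=; 
        by do ![case: (_ == _)].
    move: gY; rewrite /e E5 // /e0 ffunE inE /= (negbTE rA) inE => ->; rewrite andbT.
    by have := graph_in (r, t') g2; rewrite rC inE => /andP[].
  have c3 : 2 < cut e2 (Y :\: A).
    apply: (uncutP _ _ _ _ (u2 t' _)) => //; first by rewrite inE t'F orbT.
      exact: YD.
    exact: rD.
  have := cE Y rY; rewrite cJ // memD.
  have [YA0|YA0] := eqVneq (Y :&: A) set0.
    by rewrite YA0 cut_set0 !(mem0 Y) //=; move: c3; clear; lia.
  have [YA|YA] := eqVneq (Y :&: A) A.
    by rewrite YA (cut_full g1) !(memA Y) //=; move: c3; case: (_ \in Y :\: A) => /=; clear; lia.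
  have := cA _ (subsetIr _ _) YA0 YA; move: c3.
  by case: (_ \in Y :\: A); case: (w \in Y); case: (_ \in Y) => /=; clear; lia.
have cutA : cut e A == 2.
  have := cE A rA; rewrite cJ // setIid setDv (cut_full g1) cut_set0 wA h1A (negbTE h3A) /=.
  by rewrite !addn0 => ->.
apply/and5P; split=> //.
- by rewrite /two_cut AX rA E1 h1A.
- by rewrite E1 eq_sym.
- by rewrite E2.
(* Maximality of [A]: when [Y :\: A] is nonempty, the cuts of the two traces add up to more than a
   two-edge cut allows. *)
apply/forallP=> Y; apply/implyP=> /and4P[YX rY aY /eqP cY]; rewrite E1 in aY.
have := cE Y rY; rewrite cJ // memD cY aY.
rewrite -setD_eq0; apply: contra_eqT => YD0.
have d2 := cC _ (YD _ YX) (rD _ rY) YD0; have d3 := cC3 _ (YD _ YX) (rD _ rY).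
have YA0 : Y :&: A != set0 by apply/set0Pn; exists (e0 b).1; rewrite inE aY.
have [YA|YA] := eqVneq (Y :&: A) A.
  rewrite YA (cut_full g1) (memA Y w) //=; move: d2 d3; case: (_ \in Y :\: A) => [d2 /(_ isT)|d2 _] /=;
  move: d2; clear; lia.
have := cA _ (subsetIr _ _) YA0 YA; move: d2 d3.
case: (_ \in Y :\: A) => [d2 /(_ isT)|d2 _]; move: d2; case: (w \in Y) => /=; clear; lia.
Qed.

Lemma card_cutset :
  #|[set e | rooted F X r e && cutset A w e]| =
  #|[set e | rooted set0 A w e]| * #|[set e | rooted (t |: F) (X :\: A) r e]|.
Proof.
rewrite -(@card_split _ (halves A) (fun e => rooted F X r (c e) && cutset A w (c e))).
- apply: (@card_can_in _ _ _ _ c c) => e; rewrite ?inE ?conj_tpermK //;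
  by move=> _; apply: conj_tpermK.
- by move=> e /andP[re ce]; have := detach re ce; rewrite conj_tpermK.
- exact: attach.
- by move=> e /rootedP[/graph_supported].
- by move=> e /rootedP[/graph_supportedC].
Qed.

End Fixed.

(** Either no two-edge cut contains [(r, t)], or the pair of [cutset] is recorded. The detached
    graph is any bridgeless graph on [A], with [w] as a marked vertex. *)
Lemma card_strip :
  #|[set e | rooted F X r e]| = #|[set e | rooted (t |: F) X r e]| +
  \sum_(A : {set T} | A \subset X :\ r) \sum_(w in A)
     #|[set e | rooted set0 A w e]| * #|[set e | rooted (t |: F) (X :\: A) r e]|.
Proof.
rewrite -(cardsID [set e | uncut X r e t] [set e | rooted F X r e]); congr (_ + _).
  apply: eq_card => e; rewrite !inE; apply/andP/rootedP => [[/rootedP[g b u] ut]|[g b u]].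
    by split=> // t'; rewrite !inE => /orP[/eqP->|/u].
  split; first by apply/rootedP; split=> // t' t'F; apply: u; rewrite inE t'F orbT.
  by apply: u; rewrite setU11.
rewrite pair_big_dep /=.
rewrite (@card_classify _ ({set T} * T)%type _ (fun p e => cutset p.1 p.2 e)); first last.
- move=> e [A w] [A' w']; rewrite !inE => /andP[_ re] c1 c2.
  by have [/= -> ->] := cutset_unique re c1 c2.
- move=> e; rewrite !inE => /andP[nu re]; have [A [w cA]] := cutset_exists re nu.
  by exists (A, w).
rewrite [RHS]big_mkcond; apply: eq_bigr => -[A w] _ /=; case: ifP => [/andP[AX wA]|nA]; last first.
  apply: eq_card0 => e; rewrite !inE; apply/negP => /andP[_ /and5P[/and4P[AX rA _ _] wA _ _ _]].
  by move: nA; rewrite wA subsetD1 AX rA.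
move: AX; rewrite subsetD1 => /andP[AX rA]; rewrite -card_cutset //.
apply: eq_card => e; rewrite !inE; case: (boolP (cutset A w e)) => cA; rewrite ?andbF //= !andbT.
rewrite andbC; case: (boolP (rooted F X r e)) => //= re.
have /and5P[/and4P[_ _ aA /eqP c2] _ _ _ _] := cA.
apply/negP=> /uncutP/(_ A AX rA aA).
by rewrite c2.
Qed.

End Cutset.

End Strip.

(** * Deletion of the root boson edge *)

Local Notation fout := (Some true).
Local Notation fin := (Some false).

Lemma half_neq (T : finType) (u w : T) (s t : ty) : s != t -> (u, s) != (w, t).
Proof. by move=> st; rewrite xpair_eqE negb_and st orbT. Qed.

(* Exchanging the partners of [(v, fout)] and [(x, fout)], where [v] carries a fermion
   loop, inserts [v] into the fermion edge leaving [x]. *)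
Section Insert.
Variable T : finType.
Variables (X : {set T}) (e0 : {ffun T * ty -> T * ty}) (v x : T).
Hypotheses (g0 : graph X e0) (vX : v \in X) (xX : x \in X) (xv : x != v)
  (loop : e0 (v, fout) = (v, fin)).
Implicit Types Y : {set T}.
Local Notation z := (e0 (x, fout)).1.
Local Notation e := (conjf (tperm (v, fout) (x, fout)) e0).

Let ee : involutive e0. Proof. by case/graphP: g0. Qed.
Let zE : e0 (x, fout) = (z, fin).
Proof. exact: half_partner g0 xX. Qed.

Lemma insert_neq : z != v.
Proof.
apply: contraNneq xv => zv; have := ee (x, fout); rewrite zE zv -loop ee.
by case=> ->.
Qed.

Lemma insert_in : e (v, fin) = (x, fout).
Proof. by rewrite -loop conj_ea ?loop ?xpair_eqE ?andbF. Qed.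

Lemma insert_boson h : e (h, None) = e0 (h, None).
Proof.
apply: (conj_other ee); [exact: half_neq|exact: half_neq| |].
  by rewrite loop half_neq.
by rewrite zE half_neq.
Qed.

Lemma insert_cut Y : cut e Y + ((x \in Y) (+) (z \in Y)) =
  cut e0 Y + ((v \in Y) (+) (z \in Y)) + ((x \in Y) (+) (v \in Y)).
Proof.
have ab : (v, fout) != (x, fout) by rewrite xpair_eqE negb_and eq_sym xv.
have ae : e0 (v, fout) != (v, fout) by rewrite loop xpair_eqE andbF.
have be : e0 (x, fout) != (x, fout) by rewrite zE xpair_eqE andbF.
have eab : e0 (v, fout) != (x, fout) by rewrite loop xpair_eqE andbF.
by have := cut_switch ee ab ae be eab Y; rewrite /= loop /= addbb addn0.
Qed.

Lemma insert_cut_le Y : cut e0 Y <= cut e Y.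
Proof.
have := insert_cut Y; case: (x \in Y); case: (z \in Y); case: (v \in Y) => /=; clear; lia.
Qed.

Lemma insert_cut_eq Y : (v \in Y) = (x \in Y) -> cut e Y = cut e0 Y.
Proof.
by move=> vx; have := insert_cut Y; rewrite vx addbb addn0 => /addIn.
Qed.

(** Both halves of the subdivided edge cross when [v] and the two old ends lie on different
    sides. *)
Lemma insert_cut_sep Y : (x \in Y) = (z \in Y) -> (v \in Y) != (x \in Y) -> cut e Y = (cut e0 Y).+2.
Proof.
move=> xz; have := insert_cut Y; rewrite -xz addbb addn0 => ->.
by case: (v \in Y); case: (x \in Y) => //= _; rewrite !addn1.
Qed.

End Insert.

Section Delete.
Variable T : finType.
Variables (X : {set T}) (r : T).
Hypotheses (rX : r \in X) (X2 : 2 < #|X|).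
Implicit Types (Y : {set T}) (e : {ffun T * ty -> T * ty}).

Section Fixed.
Variables (v y x : T).
Hypotheses (vX : v \in X :\ r) (yX : y \in X :\ r :\ v) (xX : x \in X :\ r).
Local Notation X' := (X :\ r :\ v).
Local Notation c1 := (conjf (tperm (r, fout) (x, fout))).
Local Notation c2 := (conjf (tperm (v, fout) (y, fout))).

(** [v] is the boson partner of the root, [x] precedes the root on its fermion line, and [y]
    precedes [v] after the root has been taken out of that line. The case [x = v] is allowed. *)
Definition deletable e := [&& e (r, None) == (v, None), e (r, fin) == (x, fout)
  & c1 e (v, fin) == (y, fout)].

(** What remains on [r] and [v] after both are taken out of their fermion lines: the boson edge and
    a loop at each end. *)
Definition looped e := [&& graph (X :\: X') e, e (r, None) == (v, None),
  e (r, fout) == (r, fin) & e (v, fout) == (v, fin)].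

Let vX0 : v \in X. Proof. by move: vX; rewrite in_setD1 => /andP[]. Qed.
Let xX0 : x \in X. Proof. by move: xX; rewrite in_setD1 => /andP[]. Qed.
Let vr : v != r. Proof. by move: vX; rewrite in_setD1 => /andP[]. Qed.
Let xr : x != r. Proof. by move: xX; rewrite in_setD1 => /andP[]. Qed.
Let yX0 : y \in X. Proof. by move: yX; rewrite !inE => /and3P[]. Qed.
Let yv : y != v. Proof. by move: yX; rewrite !inE => /and3P[]. Qed.
Let yr : y != r. Proof. by move: yX; rewrite !inE => /and3P[]. Qed.
Let X'X : X' \subset X. Proof. by apply/subsetP=> u; rewrite !inE => /and3P[]. Qed.
Let XD u : (u \in X :\: X') = (u == r) || (u == v).
Proof.
rewrite !inE; have [->|ur] := eqVneq u r; first by rewrite rX andbF.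
by have [->|uv] := eqVneq u v; rewrite ?vX0 //=; case: (u \in X).
Qed.

Lemma looped_cut e Y : looped e -> Y \subset X :\: X' ->
  cut e Y = ((r \in Y) (+) (v \in Y) : nat).
Proof.
move=> /and4P[g /eqP e1 /eqP e2 /eqP e3] YX; have [ee _ _] := graphP _ _ g.
have e4 : e (v, None) = (r, None) by rewrite -e1 ee.
have e5 : e (r, fin) = (r, fout) by rewrite -e2 ee.
have e6 : e (v, fin) = (v, fout) by rewrite -e3 ee.
rewrite cut_tcut sum_ty /tcut ![\sum_(_ in Y) _]big_mkcond /=.
have D (f : T -> nat) : (forall u, u != r -> u != v -> f u = 0) -> \sum_u f u = f r + f v.
  move=> f0; rewrite (bigD1 r) //= (bigD1 v) //= big1 ?addn0 // => u /andP[ur uv].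
  exact: f0.
have nY u t : u != r -> u != v -> (if u \in Y then ((e (u, t)).1 \notin Y : nat) else 0) = 0.
  move=> ur uv; case: ifP => // /(subsetP YX); by rewrite XD (negbTE ur) (negbTE uv).
rewrite !D; try by move=> u; apply: nY.
rewrite e1 e2 e3 e4 e5 e6 /=.
by case: (r \in Y); case: (v \in Y).
Qed.

Lemma delete_bridgeless e : rooted [set None] X r e -> deletable e ->
  rooted set0 X' y (resf (halves X') (c2 (c1 e))) && looped (resf (~: halves X') (c2 (c1 e))).
Proof.
move=> /rootedP[g /bridgelessP br /(_ None (set11 _))/uncutP un] /and3P[/eqP eb /eqP ei /eqP ey].
have [ee _ eY] := graphP _ _ g.
set e1 := c1 e; rewrite -/e1 in ey.
have eb1 : c1 e1 = e by rewrite /e1 conj_tpermK.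
have g1 : graph X e1 by apply: graph_conj.
have [ee1 _ _] := graphP _ _ g1.
have l1 : e1 (r, fout) = (r, fin).
  have ex : e (x, fout) = (r, fin) by rewrite -ei ee.
  by rewrite ffunE tpermL ex tpermD // half_neq.
have b1 h : e (h, None) = e1 (h, None) by rewrite -eb1 (insert_boson g1).
set e0 := c2 e1.
have eb0 : c2 e0 = e1 by rewrite /e0 conj_tpermK.
have g0 : graph X e0 by apply: graph_conj.
have l0 : e0 (v, fout) = (v, fin).
  have ex : e1 (y, fout) = (v, fin) by rewrite -ey ee1.
  by rewrite ffunE tpermL ex tpermD // half_neq.
have [ee0 _ _] := graphP _ _ g0.
have b0 h : e1 (h, None) = e0 (h, None) by rewrite -eb0 (insert_boson g0).
have zr : e0 (y, fout) != (r, fin).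
  apply/eqP => E; have : e1 (r, fin) = (v, fout).
    rewrite -eb0 -E conj_eb ?l0 ?E ?xpair_eqE ?andbF //.
  by rewrite -l1 ee1 => -[] rv; move/eqP: vr; rewrite rv.
have l2 : e0 (r, fout) = (r, fin).
  rewrite -l1 -eb0 conj_other //.
  - by rewrite xpair_eqE eq_sym (negbTE vr).
  - by rewrite xpair_eqE eq_sym (negbTE yr).
  - by rewrite l0 xpair_eqE andbF.
  - by apply: contraTneq isT => E; have [_ _ /(_ (y, fout) yX0)[_]] := graphP _ _ g0; rewrite -E.
have l2' : e0 (r, fin) = (r, fout) by rewrite -l2 ee0.
have l0' : e0 (v, fin) = (v, fout) by rewrite -l0 ee0.
have lb : e0 (r, None) = (v, None) by rewrite -b0 -b1.
have lb' : e0 (v, None) = (r, None) by rewrite -lb ee0.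
have st h : h.1 \in X' -> (e0 h).1 \in X'.
  move=> hX; have hX0 := subsetP X'X _ hX.
  have nb : (e0 h).1 \notin X :\: X' -> (e0 h).1 \in X'.
    by rewrite inE negb_and negbK (graph_in _ g0) hX0 orbF.
  apply: nb; rewrite XD; apply/negP => eh.
  have : (h.1 == r) || (h.1 == v).
    rewrite -[h]ee0; case: (e0 h) eh => u [[]|] /= /orP[]/eqP->.
    - by rewrite l2 eqxx.
    - by rewrite l0 eqxx orbT.
    - by rewrite l2' eqxx.
    - by rewrite l0' eqxx orbT.
    - by rewrite lb eqxx orbT.
    - by rewrite lb' eqxx.
  by rewrite -XD inE hX.
have [gA gC] := graph_res X'X g0 st.
have lp : looped (resf (~: halves X') e0).
  have rC u t : u \notin X' -> resf (~: halves X') e0 (u, t) = e0 (u, t).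
    by move=> uX; rewrite [LHS]ffunE in_setC [_ \in halves _]in_set /= uX.
  have nr : r \notin X' by rewrite !inE eqxx andbF.
  have nv : v \notin X' by rewrite !inE eqxx.
  by rewrite /looped gC !rC // lb l2 l0 !eqxx.
rewrite lp andbT; apply/rootedP; split=> //; last by move=> t; rewrite inE.
apply/bridgelessP=> Y YX Y0 YnX.
have rY : r \notin Y by apply/negP => /(subsetP YX); rewrite !inE eqxx andbF.
have vY : v \notin Y by apply/negP => /(subsetP YX); rewrite !inE eqxx.
(* [v] goes to the side of [y], then [r] to the side of [x], so undoing the subdivisions changes no
   cut. The only possible excess over [Y] is the boson edge between [r] and [v], and then [uncut]
   supplies one more edge. *)
pose Y1 := if y \in Y then v |: Y else Y.
pose Y2 := if x \in Y1 then r |: Y1 else Y1.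
have m1 u : u != v -> (u \in Y1) = (u \in Y).
  by move=> uv; rewrite /Y1; case: ifP => //; rewrite !inE (negbTE uv).
have m2 u : u != r -> (u \in Y2) = (u \in Y1).
  by move=> ur; rewrite /Y2; case: ifP => //; rewrite !inE (negbTE ur).
have vY1 : (v \in Y1) = (y \in Y1).
  by rewrite (m1 y yv) /Y1; case: ifP; rewrite ?setU11 // (negbTE vY).
have rY1 : r \notin Y1 by rewrite m1 // eq_sym.
have rY2 : (r \in Y2) = (x \in Y2).
  by rewrite (m2 x xr) /Y2; case: ifP; rewrite ?setU11 // (negbTE rY1).
have vY2 : (v \in Y2) = (y \in Y2) by rewrite !m2.
have Y2X : Y2 \subset X.
  have Y1X : Y1 \subset X.
    by rewrite /Y1; case: ifP; rewrite ?subUset ?sub1set ?vX0 ?(subset_trans YX X'X).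
  by rewrite /Y2; case: ifP; rewrite ?subUset ?sub1set ?rX ?Y1X.
have memY2 u : u \in X' -> (u \in Y2) = (u \in Y).
  by rewrite !inE => /and3P[uv ur _]; rewrite m2 // m1.
have Y2I : Y2 :&: X' = Y.
  apply/setP=> u; rewrite in_setI; case: (boolP (u \in X')) => uX; first by rewrite andbT memY2.
  by rewrite andbF; apply/esym/negbTE; apply: contra uX; apply: (subsetP YX).
have Y20 : Y2 != set0 by apply: contraNneq Y0 => E; rewrite -Y2I E set0I.
have Y2nX : Y2 != X.
  by apply: contraNneq YnX => E; rewrite -Y2I E; apply/eqP/setIidPr.
have c2E : cut e Y2 = cut e0 Y2.
  rewrite -eb1 (insert_cut_eq g1 xX0 xr l1) // -eb0 (insert_cut_eq g0 yX0 yv l0) //.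
have := cut_join gA gC Y2X; rewrite joinf_res Y2I -c2E (looped_cut lp); last exact: setSD.
rewrite !inE !eqxx rX vX0 ?andbF /= => cE.
have := br _ Y2X Y20 Y2nX.
have [rin|rin] := boolP (r \in Y2); have [vin|vin] := boolP (v \in Y2).
- by move: cE; rewrite rin vin /= addn0 => ->.
- have := un (X :\: Y2); rewrite subsetDl in_setD rin eb in_setD vin vX0 (cutC g Y2X).
  by move=> /(_ isT isT isT); rewrite cE rin (negbTE vin) /= addn1 ltnS.
- have := un Y2; rewrite Y2X rin eb vin => /(_ isT isT isT).
  by rewrite cE (negbTE rin) vin /= addn1 ltnS.
- by move: cE; rewrite (negbTE rin) (negbTE vin) /= addn0 => ->.
Qed.

Lemma insert_bridgeless e1 e2 : rooted set0 X' y e1 -> looped e2 ->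
  rooted [set None] X r (c1 (c2 (joinf (halves X') e1 e2))) &&
  deletable (c1 (c2 (joinf (halves X') e1 e2))).
Proof.
move=> /rootedP[gA /bridgelessP brA _] lp; have /and4P[gC /eqP lb /eqP lr /eqP lv] := lp.
set e0 := joinf _ e1 e2; set e' := c2 e0; set e := c1 e'.
have g0 : graph X e0 by apply: graph_join.
have nr : r \notin X' by rewrite !inE eqxx andbF.
have nv : v \notin X' by rewrite !inE eqxx.
have e0C u t : u \notin X' -> e0 (u, t) = e2 (u, t).
  by move=> uX; rewrite /e0 ffunE in_set /= (negbTE uX).
have l0 : e0 (v, fout) = (v, fin) by rewrite e0C.
have g' : graph X e' by apply: graph_conj.
have [ee0 _ _] := graphP _ _ g0; have [ee' _ _] := graphP _ _ g'.
have zyX : (e0 (y, fout)).1 \in X'.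
  by rewrite /e0 ffunE [_ \in halves _]in_set /= yX (graph_in _ gA).
have l1 : e' (r, fout) = (r, fin).
  rewrite -lr -e0C // /e' conj_other //.
  - by rewrite xpair_eqE eq_sym (negbTE vr).
  - by rewrite xpair_eqE eq_sym (negbTE yr).
  - by rewrite l0 xpair_eqE andbF.
  - by apply: contraNneq nr => E; move: zyX; rewrite -E.
have g : graph X e by apply: graph_conj.
have eb : e (r, None) = (v, None).
  by rewrite /e (insert_boson g') // /e' (insert_boson g0) // e0C.
have [ee _ _] := graphP _ _ g'.
have zx : (e' (x, fout)).1 \in X :\ r.
  by rewrite in_setD1 (insert_neq g' xX0 xr l1) (graph_in _ g').
have cJ Y : Y \subset X -> cut e0 Y = cut e1 (Y :&: X') + ((r \in Y) (+) (v \in Y)).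
  move=> YX; rewrite (cut_join gA gC) // (looped_cut lp) ?setSD //.
  by rewrite ![_ \in Y :\: X']in_setD nr nv.
have le' Y : cut e0 Y <= cut e' Y by apply: (insert_cut_le g0 yX0 yv l0).
have le Y : cut e' Y <= cut e Y by apply: (insert_cut_le g' xX0 xr l1).
(* Both requirements at once: the cut is at least 2, and at least 3 when [Y] contains [v]. A proper
   trace on the smaller graph uses its bridgelessness; for an empty or full trace, [v] or [r] is
   inserted into an edge lying on the other side, which adds two. *)
have key Y : Y \subset X -> r \notin Y -> Y != set0 -> 1 + (v \in Y) < cut e Y.
  move=> YX rY Y0; have := cJ Y YX; rewrite (negbTE rY) /= => c0.
  have [YA0|YA0] := eqVneq (Y :&: X') set0.
    have YE : Y = [set v].
      apply/eqP; rewrite eqEcard cards1 card_gt0 Y0 andbT; apply/subsetP=> u uY.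
      rewrite inE; apply/negPn/negP=> uv; have := in_set0 u; rewrite -YA0 in_setI uY.
      suff -> : u \in X' by [].
      by rewrite !in_setD1 uv (subsetP YX) // andbT; apply: contraNneq rY => <-.
    have vY : v \in Y by rewrite YE set11.
    apply: leq_trans (le Y); rewrite (insert_cut_sep g0 yX0 yv l0).
    - by rewrite c0 YA0 cut_set0 vY.
    - rewrite YE !in_set1 (negbTE yv); apply/esym/negbTE.
      exact: (insert_neq g0 yX0 yv l0).
    - by rewrite vY YE in_set1 yv.
  have [YA|YA] := eqVneq (Y :&: X') X'; last first.
    have := brA _ (subsetIr _ _) YA0 YA; have := leq_trans (le' Y) (le Y); rewrite c0.
    by case: (v \in Y) => /=; clear; lia.
  have inY u : u \in X' -> u \in Y by rewrite -{1}YA in_setI => /andP[].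
  have [vY|vY] := boolP (v \in Y).
    have inY' u : u \in X :\ r -> u \in Y.
      have [->|uv] := eqVneq u v; first by move=> _; exact: vY.
      by move=> uX; apply: inY; rewrite in_setD1 uv.
    rewrite (insert_cut_sep g' xX0 xr l1) ?(inY' x xX) ?(inY' _ zx) ?(negbTE rY) //.
    by have := le' Y; rewrite c0 vY YA (cut_full gA) /=.
  apply: leq_trans (le Y); rewrite (insert_cut_sep g0 yX0 yv l0) ?(inY y yX) ?(inY _ zyX) ?(negbTE vY) //.
apply/andP; split.
  apply/rootedP; split=> //.
    apply/bridgelessP=> Y YX Y0 YnX; have [rY|rY] := boolP (r \in Y); last first.
      by apply: leq_trans (key Y YX rY Y0); rewrite addSn ltnS leq_addr.
    rewrite -(cutC g YX); apply: leq_trans (key (X :\: Y) _ _ _).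
    - by rewrite addSn ltnS leq_addr.
    - exact: subsetDl.
    - by rewrite in_setD rY.
    by rewrite setD_eq0; apply: contra YnX => XY; rewrite eqEsubset YX.
  move=> t /set1P->; apply/uncutP=> Y YX rY; rewrite eb => vY.
  have := key Y YX rY; rewrite vY; apply; apply/set0Pn; by exists v.
rewrite /deletable eb eqxx /= /e (insert_in x g' l1) eqxx /= conj_tpermK.
by rewrite /e' (insert_in y g0 l0).
Qed.

Lemma looped_card : #|[set e | looped e]| = 1.
Proof.
pose f : {ffun T * ty -> T * ty} := [ffun h => if (h.1 == r) || (h.1 == v) then
  if h.2 is Some _ then (h.1, dual h.2) else (if h.1 == r then v else r, None) else h].
apply/eqP/cards1P; exists f; apply/setP=> e; rewrite !inE; apply/idP/eqP => [|->].
  move=> /and4P[g /eqP e1 /eqP e2 /eqP e3]; have [ee eX _] := graphP _ _ g.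
  apply/ffunP=> -[u t]; rewrite ffunE /=; have [->|ur] := eqVneq u r => /=.
    by case: t => [[]|] //=; rewrite -e2 ee.
  have [->|uv] := eqVneq u v => /=.
    by case: t => [[]|] //=; [rewrite -e3 ee|rewrite -e1 ee].
  by apply: eX; rewrite XD /= (negbTE ur) (negbTE uv).
rewrite /looped !ffunE /= !eqxx (negbTE vr) ?orbT /= ?eqxx ?andbT.
apply/graphP; split=> -[u t]; rewrite ?XD !ffunE /=.
- have [->|ur] := eqVneq u r => /=.
    by case: t => [b|] /=; rewrite ?eqxx /= ?negbK // ?(negbTE vr) ?eqxx ?orbT.
  have [->|uv] := eqVneq u v => /=; last by rewrite (negbTE ur) (negbTE uv).
  by case: t => [b|] /=; rewrite ?eqxx ?orbT /= ?negbK ?(negbTE vr).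
- by case/norP=> /negbTE-> /negbTE->.
- move=> ->; case: t => [[]|] /=; rewrite ?xpair_eqE ?andbF //; split=> //.
  by rewrite andbT; have [->//|] := eqVneq u r; rewrite eq_sym.
Qed.

Lemma card_deletable :
  #|[set e | rooted [set None] X r e && deletable e]| = #|[set e | rooted set0 X' y e]|.
Proof.
rewrite -[RHS]muln1 -looped_card.
rewrite -(@card_split _ (halves X') (fun e => rooted [set None] X r (c1 (c2 e)) && deletable (c1 (c2 e)))).
- apply: (@card_can_in _ _ _ _ (fun e => c2 (c1 e)) (fun e => c1 (c2 e))) => e;
  rewrite ?inE ?conj_tpermK //; by move=> _; rewrite !conj_tpermK.
- by move=> e /andP[re ce]; have := delete_bridgeless re ce; rewrite !conj_tpermK.
- exact: insert_bridgeless.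
- by move=> e /rootedP[/graph_supported].
- by move=> e /and4P[/graph_supportedC].
Qed.

End Fixed.

Lemma deletable_ex e : rooted [set None] X r e ->
  exists v y x, [/\ v \in X :\ r, y \in X :\ r :\ v, x \in X :\ r & deletable v y x e].
Proof.
move=> /rootedP[g /bridgelessP br _]; have [ee _ eY] := graphP _ _ g.
pose v := (e (r, None)).1; pose x := (e (r, fin)).1.
have vE : e (r, None) = (v, None) by apply: half_partner g rX.
have xE : e (r, fin) = (x, fout) by apply: half_partner g rX.
have vr : v != r.
  by have [n _] := eY (r, None) rX; apply: contra n; rewrite vE => /eqP->.
have vX : v \in X by rewrite /v (graph_in _ g).
(* A vertex with a fermion loop would be cut off by its boson edge alone. *)
have small u : u \in X -> e (u, fin) != (u, fout).
  move=> uX; apply/eqP=> E; have := br [set u]; rewrite sub1set uX => /(_ isT).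
  rewrite -card_gt0 cards1 => /(_ isT); case: eqP => [E1 | _ /(_ isT)].
    by move: X2; rewrite -E1 cards1.
  have E' : e (u, fout) = (u, fin) by rewrite -E ee.
  rewrite cut_tcut sum_ty /tcut !big_set1 E E' !inE eqxx /= addn0.
  by case: (_ == _).
have xr : x != r by apply: contraNneq (small r rX) => E; rewrite xE E.
have xX : x \in X by rewrite /x (graph_in _ g).
pose e1 := conjf (tperm (r, fout) (x, fout)) e.
have e1b : conjf (tperm (r, fout) (x, fout)) e1 = e by rewrite /e1 conj_tpermK.
have g1 : graph X e1 by apply: graph_conj.
have [ee1 _ eY1] := graphP _ _ g1.
have l1 : e1 (r, fout) = (r, fin).
  have ex : e (x, fout) = (r, fin) by rewrite -xE ee.
  by rewrite ffunE tpermL ex tpermD // half_neq.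
pose y := (e1 (v, fin)).1.
have yE : e1 (v, fin) = (y, fout) by apply: half_partner g1 vX.
have yX : y \in X by rewrite /y (graph_in _ g1).
have yr : y != r.
  apply: contraNneq vr => E; have := ee1 (v, fin); rewrite yE E l1.
  by case=> ->.
have b1 h : e (h, None) = e1 (h, None) by rewrite -e1b (insert_boson g1).
(* If taking out the root left a loop at [v], then [v] had one before, or [r] and [v] form a fermion
   cycle and, with their boson edge, a whole component. *)
have yv : y != v.
  apply/negP=> /eqP E; rewrite E in yE.
  have yE' : e1 (v, fout) = (v, fin) by rewrite -yE ee1.
  have [xv|xv] := eqVneq x v.
    have := br [set r; v]; rewrite subUset !sub1set rX vX => /(_ isT).
    rewrite -card_gt0 cards2 eq_sym vr => /(_ isT); case: eqP => [E1|_ /(_ isT)].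
      by move: X2; rewrite -E1 cards2 eq_sym vr.
    rewrite -{1}e1b (insert_cut_eq g1 xX xr l1); last by rewrite xv !inE !eqxx orbT.
    have vb : e1 (v, None) = (r, None) by rewrite -b1 -vE ee.
    have l1' : e1 (r, fin) = (r, fout) by rewrite -l1 ee1.
    rewrite cut_tcut sum_ty /tcut !big_setU1 ?in_set1 1?eq_sym //=.
    by rewrite !big_set1 -b1 vE vb l1 l1' yE yE' !inE /= !eqxx !orbT.
  case/negP: (small v vX); rewrite -e1b conj_other // ?l1 ?yE // ?xpair_eqE ?andbF //=.
    by rewrite (negbTE vr).
  apply/eqP => E1; have := ee1 (x, fout); rewrite -E1 yE.
  by case=> xv'; rewrite xv' eqxx in xv.
exists v, y, x; rewrite !in_setD1 vr vX yv yr yX xr xX; split=> //.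
by rewrite /deletable vE xE -/e1 yE !eqxx.
Qed.

(** The factors count the choices of [v], [y] and [x]. The remaining graph has [#|X| - 2] vertices
    and is rooted at [y], whence the index. *)
Lemma card_delete : #|[set e | rooted [set None] X r e]| =
  #|X|.-1 * (#|X|.-2 * (#|X|.-1 * nrooted set0 (#|X| - 3))).
Proof.
pose ok (p : T * (T * T)) := [&& p.1 \in X :\ r, p.2.1 \in X :\ r :\ p.1 & p.2.2 \in X :\ r].
rewrite (@card_classify _ (T * (T * T))%type _
  (fun p e => ok p && deletable p.1 p.2.1 p.2.2 e)); first last.
- move=> e [v [y x]] [v' [y' x']] _ /andP[_ /and3P[/eqP /= h1 /eqP h2 /eqP h3]].
  case/andP=> _ /and3P[/eqP /=]; rewrite h1 => -[<-] /eqP; rewrite h2 => -[<-] /eqP.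
  by rewrite h3 => -[<-].
- move=> e; rewrite inE => /deletable_ex[v [y [x [vX yX xX de]]]].
  by exists (v, (y, x)); rewrite /ok /= vX yX xX.
transitivity (\sum_(v in X :\ r) \sum_(y in X :\ r :\ v) \sum_(x in X :\ r) nrooted set0 (#|X| - 3)).
  under [RHS]eq_bigr do rewrite pair_big_dep /=.
  rewrite pair_big_dep /= [RHS]big_mkcond; apply: eq_bigr => -[v [y x]] _ /=.
  case: ifP => [/andP[vX /andP[yX xX]]|H]; last first.
    by apply: eq_card0 => e; rewrite !inE /ok /= in H *; rewrite !in_setD1 H andbF.
  have cX : #|X :\ r :\ v| = (#|X| - 3).+1.
    have := cardsD1 v (X :\ r); rewrite vX; have := cardsD1 r X; rewrite rX /=; move: X2; clear; lia.
  rewrite -(card_rooted_n _ yX cX) -(card_deletable vX yX xX).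
  by apply: eq_card => e; rewrite !inE /ok /= vX yX xX.
have c1 : #|X :\ r| = #|X|.-1 by have := cardsD1 r X; rewrite rX => ->.
rewrite -c1 -[RHS]sum_nat_const; apply: eq_bigr => v vX.
have c2 : #|X :\ r :\ v| = #|X :\ r|.-1.
  by have := cardsD1 v (X :\ r); rewrite vX => ->.
by rewrite -c2 -[RHS]sum_nat_const; apply: eq_bigr => y yX; rewrite -[RHS]sum_nat_const.
Qed.

End Delete.

(** * Vertex-type Yukawa graphs as rooted closed graphs *)

Lemma connect_cutP (T : finType) (e : rel T) : symmetric e ->
  reflect (forall Y : {set T}, Y != set0 -> Y != setT ->
             exists x y, [/\ x \in Y, y \notin Y & e x y])
          [forall x, forall y, connect e x y].
Proof.
move=> se; apply: (iffP forallP) => [H Y /set0Pn[a aY] YT|H x].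
  have /subsetPn[b _ bY] : ~~ (setT \subset Y) by rewrite subTset.
  have ex : ~~ [forall x in Y, forall y, e x y ==> (y \in Y)].
    apply/negP => /forall_inP cl; case/negP: bY.
    have clY : closed e Y.
      apply: (intro_closed (sym_connect_sym se)) => x y exy xY.
      by move/forallP/(_ y)/implyP: (cl x xY); apply.
    by rewrite -(closed_connect clY (forallP (H a) b)).
  move: ex; rewrite negb_forall_in => /exists_inP[x xY].
  rewrite negb_forall => /existsP[y]; rewrite negb_imply => /andP[exy yY].
  by exists x, y.
apply/forallP=> y; apply/negPn/negP => nc.
pose Y := [set z | connect e x z].
have Y0 : Y != set0 by apply/set0Pn; exists x; rewrite inE connect0.
have YT : Y != setT by apply: contraNneq nc => E; have := in_setT y; rewrite -E inE.
have [a [b [aY bY eab]]] := H Y Y0 YT.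
case/negP: bY; rewrite inE; move: aY; rewrite inE => aY.
exact: connect_trans aY (connect1 eab).
Qed.

Section Correspondence.
Variable V : nat.
Local Notation O := (option 'I_V).
Local Notation E := {ffun O * ty -> O * ty}.
Implicit Types (g : ygraph V) (e : E) (Z : {set O}).

(* The three external legs are joined to an extra root vertex [None]. *)
Definition to_ygraph e : ygraph V :=
  ([ffun u => (e (Some u, fout)).1], [ffun u => (e (Some u, None)).1]).

(** Incoming half-edges are recovered as preimages. When [pick] finds none it returns [None], which
    is the root and thus the right partner of an external leg. *)
Definition of_ygraph g : E := [ffun h => match h with
  | (Some u, Some true) => (g.1 u, fin)
  | (None, Some true) => ([pick w | [forall u, g.1 u != Some w]], fin)
  | (x, Some false) => ([pick u | g.1 u == x], fout)
  | (Some u, None) => (g.2 u, None)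
  | (None, None) => ([pick u | g.2 u == None], None)
  end].

(** Excludes a fermion loop at the root, which would mean a graph without fermion legs. *)
Definition open_root e := (e (None, fout)).1 != None.

Lemma of_ygraphK : cancel of_ygraph to_ygraph.
Proof. by case=> f p; congr (_, _); apply/ffunP=> u; rewrite !ffunE. Qed.

Lemma vertex_typeP g : reflect
  [/\ forall u v w, g.1 u = Some w -> g.1 v = Some w -> u = v,
      forall u v, g.2 u = Some v -> g.2 v = Some u /\ u != v,
      exists u, forall v, (g.1 v == None) = (v == u),
      exists w, forall v, [forall u, g.1 u != Some v] = (v == w)
    & exists u, forall v, (g.2 v == None) = (v == u)] (vertex_type g).
Proof.
have card1 (P : pred 'I_V) : (#|[set u | P u]| == 1) <-> exists u, forall v, P v = (v == u).
  split=> [/cards1P[u Eu]|[u Eu]].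
    by exists u => v; have := congr1 (fun A : {set _} => v \in A) Eu; rewrite !inE.
  by apply/cards1P; exists u; apply/setP => v; rewrite !inE Eu.
apply: (iffP and5P) => -[h1 h2 h3 h4 h5]; split; try by apply/card1.
- move=> u v w gu gv; apply/eqP; move/forallP/(_ u)/forallP/(_ v)/forallP/(_ w)/implyP: h1.
  by apply; rewrite gu gv eqxx.
- move=> u v gu; move/forallP/(_ u)/forallP/(_ v)/implyP: h2; rewrite gu eqxx => /(_ isT).
  by case/andP=> /eqP.
- apply/forallP=> u; apply/forallP=> v; apply/forallP=> w; apply/implyP=> /andP[/eqP gu /eqP gv].
  by rewrite (h1 u v w).
- apply/forallP=> u; apply/forallP=> v; apply/implyP=> /eqP /h2[-> ->].
  by rewrite eqxx.
Qed.

Lemma of_ygraph_graph g : vertex_type g -> graph setT (of_ygraph g) /\ open_root (of_ygraph g).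
Proof.
move=> /vertex_typeP[h1 h2 [u0 hu0] [w0 hw0] [b0 hb0]].
have P1 : [pick w | [forall u, g.1 u != Some w]] = Some w0.
  by case: pickP => [w|/(_ w0)]; rewrite hw0 ?eqxx // => /eqP->.
have P2 : [pick u | g.1 u == None] = Some u0.
  by case: pickP => [w|/(_ u0)]; rewrite hu0 ?eqxx // => /eqP->.
have P3 : [pick u | g.2 u == None] = Some b0.
  by case: pickP => [w|/(_ b0)]; rewrite hb0 ?eqxx // => /eqP->.
have P4 u w : g.1 u = Some w -> [pick u | g.1 u == Some w] = Some u.
  move=> gu; case: pickP => [v /eqP gv|/(_ u)]; last by rewrite gu eqxx.
  by rewrite (h1 _ _ _ gu gv).
have P5 : [pick u | g.1 u == Some w0] = None.
  case: pickP => // u gu; have := hw0 w0; rewrite eqxx => /forallP/(_ u).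
  by rewrite gu.
split; last by rewrite /open_root ffunE P1.
apply/graphP; split=> [h|h|h _]; rewrite ?inE //.
- case: h => [[u|] [[]|]]; rewrite [of_ygraph g (_, _)]ffunE ?P1 ?P2 ?P3 ffunE.
  + by case E1: (g.1 u) => [w|]; rewrite ?P2 ?(P4 _ _ E1) //; move/eqP: E1; rewrite hu0 => /eqP->.
  + case: pickP => [v /eqP->//|none].
    by rewrite P1; have /eqP-> : u == w0 by rewrite -hw0; apply/forallP=> v; rewrite none.
  + case E1: (g.2 u) => [w|]; first by have [-> _] := h2 _ _ E1.
    by rewrite P3; move/eqP: E1; rewrite hb0 => /eqP->.
  + by rewrite P5.
  + by have := hu0 u0; rewrite eqxx => /eqP->.
  + by have := hb0 b0; rewrite eqxx => /eqP->.
- case: h => [[u|] [[]|]]; rewrite ffunE ?P1 ?P2 ?P3 /=; split=> //; try by rewrite half_neq.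
  by apply/eqP => -[] E1; have [_] := h2 _ _ E1; rewrite eqxx.
Qed.

Section Closed.
Variable e : E.
Hypotheses (ge : graph setT e) (oe : open_root e).

Let ee h : e (e h) = h.
Proof. by case/graphP: ge. Qed.

Let eE x t : e (x, t) = ((e (x, t)).1, dual t).
Proof. exact: half_partner ge (in_setT _). Qed.

Lemma open_root_all t : (e (None, t)).1 != None.
Proof.
case: t => [[]|]; first exact: oe.
  apply/eqP=> E1; have := eE None fin; rewrite E1 => E2.
  by move/eqP: oe; apply; rewrite -[(None, fout)]/(None, dual fin) -E2 ee.
apply/eqP=> E1; have [_ _ H] := graphP _ _ ge; have [] := H (None, None) (in_setT _).
by rewrite eE E1 eqxx.
Qed.

Lemma to_ygraph_vertex : vertex_type (to_ygraph e).
Proof.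
have g1 u : (to_ygraph e).1 u = (e (Some u, fout)).1 by rewrite ffunE.
have g2 u : (to_ygraph e).2 u = (e (Some u, None)).1 by rewrite ffunE.
have root t : exists u, e (None, t) = (Some u, dual t).
  by have := open_root_all t; case E1: (e (None, t)).1 => [u|//] _; exists u; rewrite eE E1.
have rootC t u : e (None, t) = (Some u, dual t) ->
    forall v, ((e (Some v, dual t)).1 == None) = (v == u).
  move=> Eu v; apply/eqP/eqP => [E1|->]; last by rewrite -Eu ee.
  have : e (e (Some v, dual t)) = (Some u, dual t) by rewrite eE E1 dualK.
  by rewrite ee => -[].
apply/vertex_typeP; split.
- move=> u v w; rewrite !g1 => E1 E2.
  have : e (Some u, fout) = e (Some v, fout) by rewrite eE E1 [RHS]eE E2.
  by move/(can_inj ee) => -[].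
- move=> u v; rewrite !g2 => E1; have E2 := eE (Some u) None; rewrite E1 in E2.
  split; first by rewrite -E2 ee.
  apply/eqP=> uv; have [_ _ H] := graphP _ _ ge; have [] := H (Some u, None) (in_setT _).
  by rewrite E2 uv eqxx.
- by have [u Eu] := root fin; exists u => v; rewrite g1; apply: (rootC fin).
- have [w Ew] := root fout; exists w => v; apply/forallP/eqP => [H|-> u].
    apply/eqP; rewrite -(rootC fout w Ew) /=; apply/eqP; case E1: (e (Some v, fin)).1 => [u|//].
    have := H u; rewrite g1 => /eqP[]; rewrite -[(Some u, fout)]/(Some u, dual fin) -E1 -eE ee //.
  rewrite g1; apply/eqP => E1; have := rootC fout w Ew w; rewrite eqxx /= => /eqP E2.
  by have := ee (Some u, fout); rewrite eE E1 /= eE E2.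
- by have [u Eu] := root None; exists u => v; rewrite g2; apply: (rootC None).
Qed.

Lemma to_ygraphK : of_ygraph (to_ygraph e) = e.
Proof.
have gT := to_ygraph_vertex; have [gO _] := of_ygraph_graph gT.
have [oo _ _] := graphP _ _ gO.
set o := of_ygraph _ in gO oo *.
have g1 u : o (Some u, fout) = e (Some u, fout) by rewrite !ffunE /= -eE.
have g2 u : o (Some u, None) = e (Some u, None) by rewrite !ffunE /= -eE.
have part t : (forall u, o (Some u, t) = e (Some u, t)) -> forall x, o (x, dual t) = e (x, dual t).
  move=> H x; case E1: (e (x, dual t)).1 => [u|].
    have E2 : e (x, dual t) = (Some u, t) by rewrite eE E1 dualK.
    have E3 : o (Some u, t) = (x, dual t) by rewrite H -E2 ee.
    by rewrite E2 -E3 oo.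
  have [v Ev] : exists v, o (x, dual t) = (v, t).
    by exists (o (x, dual t)).1; rewrite {1}(half_partner (dual t) gO (in_setT x)) dualK.
  case: v Ev => [v|] Ev.
    have E3 : e (Some v, t) = (x, dual t) by rewrite -H -Ev oo.
    by rewrite Ev -E3 ee.
  by rewrite Ev eE E1 dualK.
apply/ffunP=> -[x [[]|]].
- case: x => [u|]; first exact: g1.
  apply: (part fin) => u; exact: (part fout).
- exact: (part fout).
- exact: (part None).
Qed.

(** For [Z] avoiding the root: the internal edges between [Z] and the other proper vertices.
    [root_cut] counts the legs attached to [Z]. *)
Definition inner_cut Z := \sum_h [&& h.1 \in Z, (e h).1 \notin Z & (e h).1 != None] : nat.
Definition root_cut Z := \sum_(t : ty) ((e (None, t)).1 \in Z : nat).

Lemma cut_inner Z : None \notin Z -> cut e Z = inner_cut Z + root_cut Z.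
Proof.
move=> nZ; rewrite /cut /inner_cut.
have -> : root_cut Z = \sum_(h : O * ty) ((h.1 \in Z) && ((e h).1 == None) : nat).
  rewrite (reindex_inj (can_inj ee)) /= /root_cut.
  rewrite [RHS](eq_bigr (fun h : O * ty => ((h.1 == None) && ((e h).1 \in Z) : nat))); last first.
    by move=> h _; rewrite ee andbC.
  transitivity (\sum_(x : O) \sum_(t : ty) ((x == None) && ((e (x, t)).1 \in Z) : nat)).
    by rewrite [RHS](bigD1 None) //= [X in _ + X]big1 ?addn0 // => x /negbTE-> ; rewrite big1.
  by rewrite pair_bigA; apply: eq_bigr => -[].
rewrite -big_split; apply: eq_bigr => h _ /=.
case: (h.1 \in Z) => //=; case: eqP => [->|_]; first by rewrite nZ.
by case: (_ \in Z).
Qed.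

Definition co Z := [set x | (x \notin Z) && (x != None)].

Lemma inner_cutC Z : None \notin Z -> inner_cut (co Z) = inner_cut Z.
Proof.
move=> nZ; rewrite /inner_cut (reindex_inj (can_inj ee)); apply: eq_bigr => h _ /=.
rewrite ee !inE; case: h => [[x|] t] /=; rewrite ?eqxx ?andbF //=.
  by rewrite !andbT negbK; case: (Some x \in Z); rewrite ?andbF ?andbT //= andbC; case: (_ != None).
by rewrite (negbTE nZ).
Qed.

Lemma root_cutC Z : None \notin Z -> root_cut (co Z) + root_cut Z = 3.
Proof.
move=> nZ; rewrite /root_cut -big_split /=; transitivity (\sum_(t : ty) 1); last by rewrite sum_ty.
by apply: eq_bigr => t _; rewrite inE open_root_all andbT; case: ((e (None, t)).1 \in Z).
Qed.

Definition inner_connected := forall Z, None \notin Z -> Z != set0 -> co Z != set0 -> 1 < inner_cut Z.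

(** The three legs split so that [Z] or [co Z] carries at most one. With no leg, bridgelessness
    gives two internal edges; with one, [uncut] gives three edges, two of them internal. Conversely
    legs only add to the cut, and if [co Z] is empty all three are in it. *)
Lemma rooted_inner : 0 < V -> rooted [set: ty] setT None e <-> inner_connected.
Proof.
move=> V0; have coN Z : None \notin co Z by rewrite inE eqxx andbF.
split=> [/rootedP[_ /bridgelessP br un]|ic].
  have small Z : None \notin Z -> Z != set0 -> root_cut Z < 2 -> 1 < inner_cut Z.
    move=> nZ Z0 r1; have ZT : Z != setT by apply: contraNneq nZ => ->; rewrite inE.
    have := br Z (subsetT _) Z0 ZT; rewrite cut_inner //.
    case: (posnP (root_cut Z)) => [->|]; first by rewrite addn0.
    move=> rp _; have [t tZ] : exists t, (e (None, t)).1 \in Z.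
      move: rp; rewrite lt0n sum_nat_eq0 negb_forall => /existsP[t].
      by rewrite negb_imply eqb0 negbK => tZ; exists t.
    have := uncutP _ _ _ _ (un t (in_setT _)) Z (subsetT _) nZ tZ.
    by rewrite cut_inner //; move: r1; clear; lia.
  move=> Z nZ Z0 cZ0; have := root_cutC nZ.
  have [r1|r1] := ltnP (root_cut Z) 2; first by move=> _; apply: small.
  move=> rr; rewrite -inner_cutC //; apply: small => //.
  by move: rr r1; clear; lia.
have key Z : None \notin Z -> Z != set0 -> 1 + (0 < root_cut Z) < cut e Z.
  move=> nZ Z0; rewrite cut_inner //; have [co0|co0] := eqVneq (co Z) set0.
    have := root_cutC nZ; rewrite co0 [root_cut set0]big1 => [|t _]; last by rewrite inE.
    by rewrite add0n => ->; exact: leq_addl.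
  have := ic Z nZ Z0 co0; case: (root_cut Z) => [|k]; clear; rewrite /=; lia.
apply/rootedP; split=> //.
  apply/bridgelessP => Z _ Z0 ZT; have [nZ|nZ] := boolP (None \in Z); last first.
    by apply: leq_trans (key Z nZ Z0); rewrite addSn ltnS leq_addr.
  rewrite -(cutC ge (subsetT Z)); apply: leq_trans (key _ _ _).
  - by rewrite addSn ltnS leq_addr.
  - by rewrite !inE nZ.
  - by rewrite setD_eq0 subTset.
move=> t _; apply/uncutP=> Z _ nZ tZ.
have rp : 0 < root_cut Z by rewrite /root_cut (bigD1 t) //= tZ.
have := key Z nZ; rewrite rp; apply; apply/set0Pn; by exists (e (None, t)).1.
Qed.

(* Half-edges of the edges surviving the deletion [d]. *)
Definition live (d : option (bool * 'I_V)) (h : O * ty) := match d with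
  | None => true
  | Some (b, s) => let k := (Some s, if b then fout else None) in (h != k) && (e h != k)
  end.

Lemma yadj_live d x y : yadj (to_ygraph e) d x y =
  [exists t, ((e (Some x, t)).1 == Some y) && live d (Some x, t)].
Proof.
have ex_ty (P : pred ty) : [exists t, P t] = [|| P fout, P fin | P None].
  apply/existsP/or3P => [[[[]|] Pt]|[]]; by [constructor 1|constructor 2|constructor 3|eexists; eauto].
rewrite ex_ty /yadj /= !ffunE.
have F : ((e (Some x, fin)).1 == Some y) = ((e (Some y, fout)).1 == Some x).
  apply/eqP/eqP => E1.
    by have := ee (Some x, fin); rewrite eE E1 /= => ->.
  by have := ee (Some y, fout); rewrite eE E1 /= => ->.
have B : ((e (Some x, None)).1 == Some y) -> e (Some x, None) = (Some y, None).
  by move/eqP => E1; rewrite eE E1.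
have F' : ((e (Some x, fout)).1 == Some y) -> e (Some x, fout) = (Some y, fin).
  by move/eqP => E1; rewrite eE E1.
have G' : ((e (Some x, fin)).1 == Some y) -> e (Some x, fin) = (Some y, fout).
  by move/eqP => E1; rewrite eE E1.
rewrite -F.
have dS b s b' s' : (Some (b, s) != Some (b', s') :> option (bool * 'I_V)) = ~~ ((b == b') && (s == s')).
  by [].
have hS (a s : 'I_V) (t t' : ty) : ((Some a, t) != (Some s, t') :> O * ty) = ~~ ((a == s) && (t == t')).
  by [].
congr [|| _, _ | _].
- case: d => [[b s]|] /=; last by rewrite andbT.
  case: (boolP (_ == Some y)) => //= /F' ->.
  by rewrite dS !hS eq_sym; case: b; rewrite /= ?andbF ?andbT // eq_sym.
- case: d => [[b s]|] /=; last by rewrite andbT.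
  case: (boolP (_ == Some y)) => //= /G' ->.
  by rewrite dS !hS eq_sym; case: b; rewrite /= ?andbF ?andbT // eq_sym.
- case: d => [[b s]|] /=; last by rewrite andbT.
  case: (boolP (_ == Some y)) => //= /B ->.
  by rewrite !dS !hS; case: b; rewrite /= ?andbF ?andbT // ![s == _]eq_sym.
Qed.

End Closed.

End Correspondence.

Section OnePI.
Variable V : nat.
Local Notation O := (option 'I_V).
Variable e : {ffun O * ty -> O * ty}.
Hypotheses (ge : graph setT e) (oe : open_root e).
Implicit Types Z : {set O}.

Let ee : involutive e. Proof. by case/graphP: ge. Qed.

Definition crosses Z h := [&& h.1 \in Z, (e h).1 \notin Z & (e h).1 != None].

Lemma live_sym d h : live e d (e h) = live e d h.
Proof. by case: d => [[b s]|] //=; rewrite ee andbC. Qed.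

Let eE x t : e (x, t) = ((e (x, t)).1, dual t).
Proof. exact: half_partner ge (in_setT _). Qed.

Lemma yadj_sym d : symmetric (yadj (to_ygraph e) d).
Proof.
have imp x y : yadj (to_ygraph e) d x y -> yadj (to_ygraph e) d y x.
  rewrite !yadj_live // => /existsP[t /andP[/eqP E lv]]; apply/existsP; exists (dual t).
  have E2 : e (Some y, dual t) = (Some x, t) by rewrite -E -eE ee.
  by rewrite E2 eqxx -live_sym E2 lv.
by move=> x y; apply/idP/idP; apply: imp.
Qed.

Lemma yconnected_cross d : yconnected (to_ygraph e) d <->
  forall Z, None \notin Z -> Z != set0 -> co Z != set0 -> exists2 h, crosses Z h & live e d h.
Proof.
split=> [/connect_cutP-/(_ (yadj_sym d)) H Z nZ /set0Pn[[u|] uZ]|H].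
- case/set0Pn=> -[w|]; rewrite inE ?andbF // => /andP[wZ _].
  have [||x [y [xY yY]]] := H [set u | Some u \in Z].
  + by apply/set0Pn; exists u; rewrite inE.
  + by apply: contraNneq wZ => E; have := in_setT w; rewrite -E inE.
  rewrite !inE in xY yY; rewrite yadj_live // => /existsP[t /andP[/eqP E lv]].
  by exists (Some x, t); rewrite // /crosses /= xY E yY.
- by rewrite uZ in nZ.
apply/connect_cutP; first exact: yadj_sym.
move=> Y Y0 YT; pose Z := [set Some u | u in Y].
have memZ u : (Some u \in Z) = (u \in Y) by rewrite mem_imset //; apply: Some_inj.
have nZ : None \notin Z by apply/negP => /imsetP[].
have [||[x t] /and3P[/= xZ eZ e0] lv] := H Z nZ.
- by case/set0Pn: Y0 => u uY; apply/set0Pn; exists (Some u); rewrite memZ.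
- have /subsetPn[u _ uY] : ~~ (setT \subset Y) by rewrite subTset.
  by apply/set0Pn; exists (Some u); rewrite inE memZ uY.
case: x xZ eZ e0 lv => [x|] xZ eZ e0 lv; last by rewrite xZ in nZ.
case E: (e (Some x, t)).1 eZ e0 => [y|//] eZ _; exists x, y; split; rewrite -?memZ //.
by rewrite yadj_live //; apply/existsP; exists t; rewrite E eqxx.
Qed.

Lemma inner_cut_ge2 Z : 1 < inner_cut e Z <->
  exists h h', [/\ crosses Z h, crosses Z h' & h != h'].
Proof.
have -> : inner_cut e Z = #|[set h | crosses Z h]|.
  by rewrite -sum1_card [RHS]big_mkcond; apply: eq_bigr => h _; rewrite inE -/(crosses Z h); case: (crosses Z h).
split=> [/card_gt1P[h [h']]|[h [h' [c c' n]]]].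
  by rewrite !inE => -[c c' n]; exists h, h'.
by apply/card_gt1P; exists h, h'; rewrite !inE.
Qed.

(** Deleting the edge of one crossing half-edge must leave another crossing. Conversely, two
    crossing half-edges based in [Z] lie on different edges, and one deletion spares one of them. *)
Lemma onePI_inner : onePI (to_ygraph e) <-> inner_connected e.
Proof.
split=> [/and3P[/yconnected_cross c0 /forallP cf /forallP cb] Z nZ Z0 cZ|ic].
  apply/inner_cut_ge2; have [h hZ _] := c0 Z nZ Z0 cZ; exists h.
  suff [d [cd ld]] : exists d, yconnected (to_ygraph e) d /\ forall h', live e d h' -> h != h'.
    by have [h' c' l'] := (yconnected_cross d).1 cd Z nZ Z0 cZ; exists h'; split=> //; apply: ld.
  case: h hZ => [[u|] t] /and3P[/= uZ eZ eN]; last by rewrite uZ in nZ.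
  case: t eZ eN => [[]|] eZ eN.
  - exists (Some (true, u)); split; last by move=> h' /andP[]; rewrite eq_sym.
    by have := cf u; rewrite ffunE eN.
  (* A fermion edge is deleted by naming its tail, here [w]. *)
  - case E: (e (Some u, fin)).1 eN => [w|//] _.
    have E2 : e (Some u, fin) = (Some w, fout) by rewrite eE E.
    exists (Some (true, w)); split; last first.
      by move=> h' /andP[_]; apply: contraNneq => <-; rewrite E2.
    by have := cf w; rewrite ffunE -E2 ee.
  - exists (Some (false, u)); split; last by move=> h' /andP[]; rewrite eq_sym.
    by have := cb u; rewrite ffunE eN.
have key d : yconnected (to_ygraph e) d.
  apply/yconnected_cross => Z nZ Z0 cZ; have /inner_cut_ge2[h [h' [c c' n]]] := ic Z nZ Z0 cZ.
  have [l|l] := boolP (live e d h); first by exists h.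
  have [l'|l'] := boolP (live e d h'); first by exists h'.
  have /and3P[hZ ehZ _] := c; have /and3P[hZ' ehZ' _] := c'.
  case: d l l' => [[b s]|//] /nandP[]/negPn/eqP E /nandP[]/negPn/eqP E'.
  - by rewrite E E' eqxx in n.
  - by case/negP: ehZ'; rewrite E' -E.
  - by case/negP: ehZ; rewrite E -E'.
  - by case/eqP: n; apply: (can_inj ee); rewrite E E'.
by apply/and3P; split=> //; apply/forallP=> s; apply/implyP.
Qed.

End OnePI.

Lemma rooted_open V (e : {ffun option 'I_V * ty -> option 'I_V * ty}) F :
  0 < V -> rooted F setT None e -> open_root e.
Proof.
move=> V0 /rootedP[ge /bridgelessP br _]; apply/eqP => E.
have [ee _ et] := graphP _ _ ge.
have E1 : e (None, fout) = (None, fin) by rewrite (half_partner _ ge (in_setT _)) E.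
have E2 : e (None, fin) = (None, fout) by rewrite -E1 ee.
have := br [set None] (subsetT _); rewrite -card_gt0 cards1 => /(_ isT).
have nT : [set None] != [set: option 'I_V].
  by apply/eqP=> E3; have := in_setT (Some (Ordinal V0)); rewrite -E3 inE.
rewrite cut_tcut sum_ty /tcut !big_set1 E1 E2 !inE /= addn0.
by move/(_ nT); case: (_ == _).
Qed.

Definition labelled V := [set g : ygraph V | vertex_type g && onePI g].

Lemma rooted_of_ygraph V (g : ygraph V) : 0 < V -> g \in labelled V ->
  rooted [set: ty] setT None (of_ygraph g).
Proof.
move=> V0; rewrite inE => /andP[vg og]; have [gg oo] := of_ygraph_graph vg.
have og' : onePI (to_ygraph (of_ygraph g)) by rewrite of_ygraphK.
exact: (proj2 (rooted_inner gg oo V0) (proj1 (onePI_inner gg) og')).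
Qed.

Lemma to_ygraph_labelled V (e : {ffun option 'I_V * ty -> option 'I_V * ty}) : 0 < V ->
  rooted [set: ty] setT None e -> to_ygraph e \in labelled V /\ of_ygraph (to_ygraph e) = e.
Proof.
move=> V0 re; have oo := rooted_open V0 re; have /rootedP[gg _ _] := re.
split; last exact: to_ygraphK.
rewrite inE to_ygraph_vertex //=; apply: (proj2 (onePI_inner gg)).
exact: (proj1 (rooted_inner gg oo V0)).
Qed.

Lemma card_labelled V : 0 < V -> #|labelled V| = nrooted [set: ty] V.
Proof.
move=> V0; rewrite -(@card_rooted_n _ [set: option 'I_V] None) ?inE //; last first.
  by rewrite cardsT card_option card_ord.
apply: (@card_can_in _ _ _ _ (@of_ygraph V) (@to_ygraph V)) => [g gL|e|g _|e].
- by rewrite inE; apply: rooted_of_ygraph.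
- by rewrite inE => /(to_ygraph_labelled V0)[].
- exact: of_ygraphK.
- by rewrite inE => /(to_ygraph_labelled V0)[].
Qed.

(** * Isomorphism classes and labelled graphs *)

Section Classes.
Variable V : nat.
Hypothesis V0 : 0 < V.
Implicit Types (g h : ygraph V) (s : {perm 'I_V}).

Definition act s g : ygraph V :=
  ([ffun v => omap s (g.1 (s^-1%g v))], [ffun v => omap s (g.2 (s^-1%g v))]).

Lemma actE1 s g v : (act s g).1 (s v) = omap s (g.1 v).
Proof. by rewrite ffunE permK. Qed.

Lemma actE2 s g v : (act s g).2 (s v) = omap s (g.2 v).
Proof. by rewrite ffunE permK. Qed.

Lemma yisoP g h : reflect (exists s, h = act s g) (yiso g h).
Proof.
apply: (iffP existsP) => -[s].
  move/forallP=> H; exists s; case: h H => h1 h2 /= H.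
  by congr (_, _); apply/ffunP=> v; rewrite !ffunE; have /andP[/eqP a /eqP b] := H (s^-1%g v);
    rewrite -?a -?b permKV.
by move=> ->; exists s; apply/forallP=> v; rewrite actE1 actE2 !eqxx.
Qed.

Lemma act_labelled s g : g \in labelled V -> act s g \in labelled V.
Proof.
move=> gL; have rg := rooted_of_ygraph V0 gL.
pose f := omap s; pose f' := omap (s^-1%g : {perm 'I_V}).
have fK : cancel f f' by case=> //= u; rewrite permK.
have fK' : cancel f' f by case=> //= u; rewrite permKV.
have H := @relabel_rooted _ _ setT setT f f' (fun _ _ => in_setT _) (fun _ _ => in_setT _)
  (in1W fK) (in1W fK') setT None _ (in_setT _) rg.
have [L _] := to_ygraph_labelled V0 H; suff -> : act s g = to_ygraph (relabel setT f f' (of_ygraph g)) by [].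
by congr (_, _); apply/ffunP=> u; rewrite !ffunE /= in_setT.
Qed.

Lemma act1 g : act 1%g g = g.
Proof.
have o1 (x : option 'I_V) : omap (1%g : {perm 'I_V}) x = x by case: x => //= u; rewrite perm1.
by case: g => g1 g2; congr (_, _); apply/ffunP=> v; rewrite ffunE o1 invg1 perm1.
Qed.

Lemma actM s t g : act (s * t)%g g = act t (act s g).
Proof.
have oM (x : option 'I_V) : omap (s * t)%g x = omap t (omap s x) by case: x => //= u; rewrite permM.
by congr (_, _); apply/ffunP=> v; rewrite !ffunE oM invMg permM.
Qed.

(* Rigidity: a relabelling is determined along paths from the end of the fermion line. *)
Lemma act_inj g : g \in labelled V -> injective (act^~ g).
Proof.
move=> gL s s' E; have sL := act_labelled s gL.
have := gL; rewrite inE => /andP[/vertex_typeP[_ _ [u hu] _ _] /and3P[conn _ _]].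
have := sL; rewrite inE => /andP[/vertex_typeP[inj _ [w hw] _ _] _].
pose D := [pred v | s v == s' v].
have E1 v : (act s g).1 (s' v) = omap s' (g.1 v) by rewrite [act s g]E actE1.
have E2 v : (act s g).2 (s' v) = omap s' (g.2 v) by rewrite [act s g]E actE2.
have uD : s u == s' u.
  have /eqP gu : g.1 u == None by rewrite hu.
  have /eqP-> : s u == w by rewrite -hw actE1 gu.
  have /eqP-> : s' u == w by rewrite -hw E1 gu.
  by [].
have step x y : yadj g None x y -> s x == s' x -> s y == s' y.
  move=> xy /eqP Ex; apply/eqP; case/or3P: xy => [/andP[/eqP gx _]|/andP[/eqP gy _]|/and3P[/eqP gx _ _]].
  - by have := E1 x; rewrite -Ex actE1 gx => -[].
  - apply: (inj _ _ (s x)); first by rewrite actE1 gy.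
    by rewrite E1 gy Ex.
  - by have := E2 x; rewrite -Ex actE2 gx => -[].
apply/permP=> v; apply/eqP.
have /connectP[p] := forallP (forallP conn u) v.
elim: p u uD {hu} => [|y p IH] x xD /=; first by move=> _ ->.
by case/andP=> xy pp E3; apply: (IH y) => //; apply: step xy xD.
Qed.

(** The classes are orbits of the symmetric group, and by [act_inj] each has as many elements as the
    group. *)
Lemma card_classes : #|[set [set h | yiso g h] | g in labelled V]| * V`! = #|labelled V|.
Proof.
have clE g : [set h | yiso g h] = [set act s g | s : {perm 'I_V}].
  by apply/setP=> h; rewrite inE; apply/yisoP/imsetP => [[s ->]|[s _ ->]]; exists s.
pose cl g := [set h | yiso g h].
have self g : g \in cl g by rewrite inE; apply/yisoP; exists 1%g; rewrite act1.
have clP g h : h \in cl g -> cl h = cl g.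
  rewrite inE => /yisoP[s ->]; apply/setP=> k; rewrite !inE; apply/yisoP/yisoP => -[t ->].
    by exists (s * t)%g; rewrite actM.
  by exists (s^-1 * t)%g; rewrite -actM mulgA mulgV mul1g.
have clL g h : g \in labelled V -> h \in cl g -> h \in labelled V.
  by move=> gL; rewrite inE => /yisoP[s ->]; apply: act_labelled.
rewrite (@card_classify _ _ (labelled V) (fun c g => cl g == c)); first last.
- by move=> g c c' _ /eqP-> /eqP.
- by move=> g _; exists (cl g).
rewrite -sum_nat_const big_mkcond; apply: eq_bigr => c _; case: ifP => cC; last first.
  apply/esym/eq_card0 => g; rewrite !inE; apply/negP => /andP[gL /eqP E].
  by move/negP: cC; apply; apply/imsetP; exists g; rewrite ?inE.
case/imsetP: cC => g0 g0L ->; rewrite -/(cl g0).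
transitivity #|cl g0|.
  rewrite [cl g0]clE card_imset; last exact: act_inj.
  by rewrite card_Sn.
apply: eq_card => g; rewrite [RHS]inE; apply/idP/andP => [gc|[_ /eqP<-]]; last exact: self.
by rewrite (clP _ _ gc) eqxx (clL g0).
Qed.

End Classes.

(** Internal boson edges pair all vertices except the one with the boson leg. *)
Lemma vertex_type_bosons V (g : ygraph V) n :
  vertex_type g -> (bosons g == n.+1) = (V == n.*2.+1).
Proof.
move=> /vertex_typeP[_ h2 _ _ [b hb]]; rewrite /bosons eqSS.
have c : #|[set u | g.2 u != None]| = V.-1.
  have := cardsC [set u | g.2 u != None]; rewrite card_ord.
  have -> : ~: [set u | g.2 u != None] = [set b] by apply/setP=> u; rewrite !inE negbK hb.
  by rewrite cards1; lia.
have V0 : 0 < V by case: (V) b {hb c h2 g} => [[]|].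
have ev : ~~ odd #|[set u | g.2 u != None]|.
  apply: (@even_card_invol _ _ (fun u => odflt u (g.2 u))) => u; rewrite !inE;
  case E: (g.2 u) => [v|] //= _; have [Ev uv] := h2 _ _ E; by rewrite ?Ev // eq_sym.
rewrite c in ev *; lia.
Qed.

Lemma U11_0 : U11 0 = 0.
Proof.
rewrite /U11 big_ord_recl big_ord0 addn0; apply/eqP; rewrite cards_eq0; apply/eqP/setP => c.
rewrite inE; apply/negP=> /imsetP[g]; rewrite inE => /andP[/vertex_typeP[_ _ [[]]]] //.
Qed.

Lemma U11_nrooted n : U11 n.+1 * (n.*2.+1)`! = nrooted [set: ty] n.*2.+1.
Proof.
have lt : n.*2.+1 < n.+1.*2.+1 by lia.
rewrite -card_labelled // -card_classes // /U11 (bigD1 (Ordinal lt)) //= big1 => [|V nV].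
  rewrite addn0; congr (_ * _); apply: eq_card => c; apply/imsetP/imsetP => -[g].
    by rewrite inE => /and3P[vg og _] ->; exists g; rewrite // inE vg.
  rewrite inE => /andP[vg og] ->; exists g; rewrite // inE vg og.
  by rewrite (vertex_type_bosons _ vg) /= eqxx.
apply/eqP; rewrite cards_eq0; apply/eqP/setP => c; rewrite !inE; apply/negP => /imsetP[g].
rewrite inE => /and3P[vg _]; rewrite vertex_type_bosons // => E _.
by move: nV; rewrite -val_eqE /= E.
Qed.

(** * Recurrences and generating functions *)

Definition conv (u v : nat -> nat) n := \sum_(j < n.+1) u j * v (n - j).

(* Coefficients of [C(x) / x]. *)
Definition cword n := cC n.+1.

Lemma cword_nword n : cword n = nword 1 1 n.*2.+1.
Proof. exact: cCS_nword. Qed.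

Lemma sum_even n (f : nat -> nat) : (forall i, odd i -> f i = 0) ->
  \sum_(i < n.*2) f i = \sum_(j < n) f j.*2.
Proof.
move=> f0; elim: n => [|n IH]; first by rewrite !big_ord0.
rewrite doubleS !big_ord_recr IH /= [f n.*2.+1]f0 ?addn0 //.
by rewrite /= odd_double.
Qed.

Lemma sum_odd n (f : nat -> nat) : (forall i, ~~ odd i -> f i = 0) ->
  \sum_(i < n.*2) f i = \sum_(j < n) f j.*2.+1.
Proof.
move=> f0; elim: n => [|n IH]; first by rewrite !big_ord0.
by rewrite doubleS !big_ord_recr IH /= [f n.*2]f0 ?addn0 // odd_double.
Qed.

(** In [nword_insertion] only even [l = 2j] contribute; the outer diagram then has 2(n-j)+2 points,
    so 2(n-j)+1 inner gaps, and erasing its first point turns it into a word. *)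
Lemma cword_rec n : cword n.+1 = conv cword (fun m => m.*2.+1 * cword m) n.
Proof.
rewrite cword_nword nword_insertion //.
rewrite (sum_even n.+1 (f := fun l => (n.+1.*2 - l).-1 * (nword 1 1 l.+1 * nword 0 1 (n.+1.*2 - l)))).
  apply: eq_bigr => j _; have jn : j <= n by rewrite -ltnS.
  have -> : n.+1.*2 - j.*2 = (n - j).*2.+2 by rewrite -doubleB subSn // doubleS.
  rewrite nword_cut0 // -!cword_nword /=; lia.
by move=> i oi; rewrite nword_parity ?muln0 //= oi.
Qed.

(** Boson edges pair all [k.+1] vertices. *)
Lemma nrooted_even (F : {set ty}) k : ~~ odd k -> nrooted F k = 0.
Proof.
move=> ok; apply: eq_card0 => e; rewrite inE; apply/negP=> /rootedP[g _ _].
have [ee _ et] := graphP _ _ g.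
have eE x : e (x, None) = ((e (x, None)).1, None) := half_partner None g (in_setT x).
have : ~~ odd #|[set: 'I_k.+1]|.
  apply: (@even_card_invol _ _ (fun x => (e (x, None)).1)) => x _; rewrite ?inE //.
    by rewrite -eE ee.
  have [n _] := et (x, None) (in_setT _); apply: contra n => /eqP E.
  by rewrite eE E.
by rewrite cardsT card_ord /= ok.
Qed.

(** The binomial coefficient chooses [A] of size [k.+1] among the vertices other than the root, the
    next factor its marked vertex [w]. *)
Lemma nrooted_strip (F : {set ty}) t p : t \notin F -> nrooted F p = nrooted (t |: F) p +
  \sum_(k < p) 'C(p, k.+1) * (k.+1 * (nrooted set0 k * nrooted (t |: F) (p - k.+1))).
Proof.
move=> tF; rewrite {1}/nrooted (@card_strip _ _ _ _ t) ?inE //; congr (_ + _).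
pose B := [set: 'I_p.+1] :\ ord0.
have cB : #|B| = p by have := cardsD1 (@ord0 p) setT; rewrite inE cardsT card_ord => -[].
pose G k := k * (nrooted set0 k.-1 * nrooted (t |: F) (p - k)).
transitivity (\sum_(A : {set 'I_p.+1} | A \subset B) G #|A|).
  apply: eq_bigr => A AB; have AB' := subset_leq_card AB; rewrite cB in AB'.
  rewrite /G -sum_nat_const; apply: eq_bigr => w wA; congr (_ * _).
    by apply: card_rooted_n => //; rewrite prednK //; apply/card_gt0P; exists w.
  apply: card_rooted_n; first by rewrite !inE andbT; apply: contraTN AB => h; rewrite subsetD1 h andbF.
  by apply/eqP; rewrite setTD -(eqn_add2l #|A|) cardsC card_ord addnS subnKC.
transitivity (\sum_(k < p.+1) 'C(p, k) * G k); last first.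
  rewrite big_ord_recl /G /= mul0n muln0 add0n; apply: eq_bigr => k _.
  by rewrite /bump leq0n add1n.
rewrite (partition_big (fun A : {set 'I_p.+1} => inord #|A| : 'I_p.+1) xpredT) //=.
apply: eq_bigr => k _.
have -> : 'C(p, k) = #|[set A : {set _} | A \subset B & #|A| == k]| by rewrite cards_draws cB.
rewrite -sum_nat_const.
apply: eq_big => [A|A /andP[AB /eqP <-]].
  rewrite inE; case: (boolP (A \subset B)) => //= /subset_leq_card; rewrite cB => cA.
  by rewrite -val_eqE /= inordK.
by rewrite inordK // ltnS -[X in _ <= X]cB subset_leq_card.
Qed.

Lemma cword0 : cword 0 = 1.
Proof.
  rewrite cword_nword /nword (@eq_card1 _ [ffun x => x]) // => m; rewrite !inE.
apply/idP/eqP => [_|->]; first by apply/ffunP=> x; rewrite ffunE !ord1.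
apply/wordP; split.
- by apply/matchingP; split=> x; rewrite !ffunE.
- rewrite (_ : fixpts _ _ = setT) ?cardsT ?card_ord //.
  by apply/setP=> x; rewrite !inE ffunE eqxx.
- by move=> Y _; rewrite card_gt0 cardsT card_ord ltnS leqn0 cards_eq0 => /negbTE->.
Qed.

(** The binomial coefficient, the choice of [w] and the factorials of the two parts multiply to
    (2n+1)!, so dividing by it leaves an ordinary convolution. The term with [cword 0 = 1] is the
    case without a cut. *)
Lemma nrooted_strip_conv (F : {set ty}) t n (u : nat -> nat) : t \notin F ->
  (forall j, j < n -> nrooted set0 j.*2.+1 = (j.*2.+1)`! * cword j.+1) ->
  (forall m, m <= n -> nrooted (t |: F) m.*2.+1 = (m.*2.+1)`! * u m) ->
  nrooted F n.*2.+1 = (n.*2.+1)`! * conv cword u n.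
Proof.
move=> tF H0 Hu; rewrite (nrooted_strip _ tF) Hu // /conv [in RHS]big_ord_recl subn0.
rewrite cword0 mul1n mulnDr; congr (_ + _).
rewrite big_ord_recr /= [X in _ + X](_ : _ = 0) ?addn0; last first.
  by rewrite [nrooted set0 _]nrooted_even ?odd_double // mul0n !muln0.
rewrite (sum_odd n (f := fun k => 'C(n.*2.+1, k.+1) *
  (k.+1 * (nrooted set0 k * nrooted (t |: F) (n.*2.+1 - k.+1))))); last first.
  by move=> i oi; rewrite [nrooted set0 _]nrooted_even // mul0n !muln0.
rewrite big_distrr; apply: eq_bigr => j _ /=; have jn := ltn_ord j.
have E : n.*2.+1 - j.*2.+2 = (n - j.+1).*2.+1 by lia.
rewrite /bump leq0n add1n E H0 // Hu ?leq_subr //.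
have le : j.*2.+2 <= n.*2.+1 by lia.
rewrite -(bin_fact le) E [(j.*2.+2)`!]factS; lia.
Qed.

(** Two vertices are too few for [card_delete]. Each vertex must send all its half-edges to the
    other, since a fermion loop would make the boson edge a bridge. *)
Lemma rooted_bool (e : {ffun bool * ty -> bool * ty}) :
  rooted [set None] setT true e = (e == [ffun h => (~~ h.1, dual h.2)]).
Proof.
have eqY (Y : {set bool}) : Y != set0 -> Y != setT -> Y = [set true] \/ Y = [set false].
  case: (boolP (true \in Y)) (boolP (false \in Y)) => [tY|tY] [fY|fY] Y0 YT.
  - by case/eqP: YT; apply/setP=> -[]; rewrite inE ?tY ?fY.
  - by left; apply/setP=> -[]; rewrite inE ?tY ?(negbTE fY).
  - by right; apply/setP=> -[]; rewrite inE ?(negbTE tY) ?fY.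
  - by case/eqP: Y0; apply/setP=> -[]; rewrite inE ?(negbTE tY) ?(negbTE fY).
have cut1 b : cut [ffun h : bool * ty => (~~ h.1, dual h.2)] [set b] = 3.
  by rewrite cut_tcut sum_ty /tcut !big_set1 !ffunE /= !inE; case: b.
apply/idP/eqP => [/rootedP[g /bridgelessP br _]|->]; last first.
  apply/rootedP; split.
  - by apply/graphP; split=> h; rewrite ?inE // !ffunE /= ?negbK ?dualK; case: h => [[] t].
  - by apply/bridgelessP=> Y _ Y0 /(eqY _ Y0)[]->; rewrite cut1.
  - move=> t _; apply/uncutP=> Y _ tY fY.
    have [||->|->] := eqY Y; rewrite ?cut1 //.
      by apply/set0Pn; exists (([ffun h : bool * ty => (~~ h.1, dual h.2)] (true, t)).1).
    by apply: contraNneq tY => ->; rewrite inE.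
have [ee _ et] := graphP _ _ g.
have eE x t := half_partner t g (in_setT x).
have n1 x : [set x] != set0 :> {set bool} by rewrite -card_gt0 cards1.
have n2 (x : bool) : [set x] != setT.
  by apply/eqP => E; have := in_setT (~~ x); rewrite -E inE; case: (x).
have dE x : tcut e [set x] fin = tcut e [set x] fout.
  exact: (tcut_dual fout g (subsetT _)).
have key x t : (e (x, t)).1 != x.
  case: t => [t|]; last first.
    by have [h _] := et (x, None) (in_setT _); apply: contra h => /eqP E; rewrite eE E.
  have : 0 < tcut e [set x] fout.
    have := br [set x] (subsetT _) (n1 x) (n2 x); rewrite cut_tcut sum_ty dE.
    rewrite {1}/tcut big_set1; case: (_ \notin _) => /=; lia.
  have : tcut e [set x] (Some t) = tcut e [set x] fout by case: t => //; apply: dE.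
  by move=> <-; rewrite /tcut big_set1 inE; case: (_ == _).
by apply/ffunP=> -[x t]; rewrite ffunE eE /=; have := key x t; case: (e (x, t)).1; case: x.
Qed.

(** Two of the three factors of [card_delete] complete the factorial; the third remains as the odd
    weight, the effect of 1 + 2x d/dx on coefficients. *)
Lemma nrooted_boson n : (forall j, j < n -> nrooted set0 j.*2.+1 = (j.*2.+1)`! * cword j.+1) ->
  nrooted [set None] n.*2.+1 = (n.*2.+1)`! * (n.*2.+1 * cword n).
Proof.
case: n => [_|n H].
  rewrite cword0 -(@card_rooted_n _ [set: bool] true) ?inE ?cardsT ?card_bool //.
  apply: etrans (cards1 ([ffun h => (~~ h.1, dual h.2)] : {ffun bool * ty -> bool * ty})).
  by apply: eq_card => e; rewrite !inE rooted_bool.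
rewrite {1}/nrooted card_delete ?inE // cardsT card_ord /=; last lia.
have -> : n.+1.*2.+2 - 3 = n.*2.+1 by lia.
rewrite H // doubleS (factS n.*2.+2) (factS n.*2.+1); move: (n.*2.+1)`! (cword _) => f c /=.
by rewrite -!mulnA; congr (_ * _); congr (_ * _); rewrite mulnCA.
Qed.

Lemma nrooted0 n : nrooted set0 n.*2.+1 = (n.*2.+1)`! * cword n.+1.
Proof.
elim/ltn_ind: n => n IH; rewrite cword_rec; apply: (nrooted_strip_conv (t := None)) => //.
  by rewrite inE.
move=> m mn; rewrite setU0; apply: nrooted_boson => j jm; apply: IH; exact: leq_trans mn.
Qed.

(** The two fermion half-edges are stripped starting from [nrooted_boson], each contributing one
    factor [cword]. The boson half-edge provides the third factor, through [cword_rec]. *)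
Lemma U11_cword n : conv cword (conv cword (fun m => U11 m.+1)) n = n.*2.+1 * cword n.
Proof.
apply/eqP; rewrite -(eqn_pmul2l (fact_gt0 n.*2.+1)) -nrooted_boson => [|j _]; last exact: nrooted0.
apply/eqP/esym; apply: (nrooted_strip_conv (t := fin)) => [|j _|m _]; rewrite ?inE //.
  exact: nrooted0.
apply: (nrooted_strip_conv (t := fout)) => [|j _|k _]; rewrite ?inE //.
  exact: nrooted0.
rewrite mulnC U11_nrooted; congr nrooted.
by apply/setP=> -[[]|]; rewrite !inE.
Qed.

Lemma U11_cword3 n : conv cword (conv cword (conv cword (fun m => U11 m.+1))) n = cword n.+1.
Proof.
by rewrite cword_rec; apply: eq_bigr => j _; rewrite U11_cword.
Qed.

Lemma ndressing_small N k n : n <= N -> n < k -> @ndressing N k n = 0.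
Proof.
move=> nN nk; apply: eq_card0 => m; rewrite inE; apply/negP => /andP[_ /eqP f].
have : #|fixpts m (initseg N n)| <= #|initseg N n|.
  by apply: subset_leq_card; apply/subsetP => x; rewrite inE => /andP[].
by rewrite f card_initseg // leqNgt nk.
Qed.

(** * Power series truncated to integer polynomials *)

Import GRing.Theory.
Local Open Scope ring_scope.

Section Series.
Variable M : nat.
Local Notation S := (\poly_(i < M) (cword i)%:Z).
Local Notation U := (\poly_(i < M) (U11 i.+1)%:Z).
Local Notation Q := (\sum_(k < M) (cC2 k.+2)%:Z *: ('X * S ^+ 2) ^+ k : {poly int}).

Lemma posz_sum (I : Type) (r : seq I) (P : pred I) (f : I -> nat) :
  (\sum_(i <- r | P i) f i)%N%:Z = \sum_(i <- r | P i) (f i)%:Z.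
Proof. by elim/big_rec2: _ => // i y1 y2 _ <-; rewrite PoszD. Qed.

Lemma coef_conv (u v : nat -> nat) (p q : {poly int}) :
  (forall i, (i < M)%N -> p`_i = (u i)%:Z) -> (forall i, (i < M)%N -> q`_i = (v i)%:Z) ->
  forall i, (i < M)%N -> (p * q)`_i = (conv u v i)%:Z.
Proof.
move=> pu qv i iM; rewrite coefM /conv posz_sum; apply: eq_bigr => j _.
rewrite PoszM pu ?qv //; first exact: leq_ltn_trans (leq_subr _ _) iM.
by apply: leq_ltn_trans iM; rewrite -ltnS.
Qed.

Lemma coefS i : (i < M)%N -> S`_i = (cword i)%:Z.
Proof. by move=> iM; rewrite coef_poly iM. Qed.

(** A cell counted by [cword j] has 2j+1 letters, so [k] cells of total degree [q] have 2q+k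
    letters. *)
Lemma ndressing_coef N k q : (q < M)%N -> (q.*2 + k <= N)%N ->
  (@ndressing N k (q.*2 + k))%:Z = (S ^+ k)`_q.
Proof.
elim: k q => [|k IH] q qM qN.
  by rewrite ndressing0 // addn0 expr0 coef1 double_eq0; case: (q == 0%N).
rewrite ndressingS // exprS coefM posz_sum.
pose f i := (nword 1 1 i.+1 * @ndressing N k (q.*2 + k - i))%N.
rewrite big_mkcond big_ord_recl /= add0r addnS.
rewrite (eq_bigr (fun i : 'I__ => (f i)%:Z)); last first.
  by move=> i _; rewrite /f /bump leq0n add1n subSS.
have f0 i : odd i -> f i = 0%N by move=> oi; rewrite /f nword_parity //= oi.
(* Beyond index 2q fewer than [k] letters remain for [k] cells, and the added top index 2q+1 is odd;
   so the range can be made even for [sum_even]. *)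
have -> : (\sum_(i < (q.*2 + k).+1) (f i)%:Z = \sum_(i < q.+1.*2) (f i)%:Z).
  rewrite doubleS [RHS]big_ord_recr /= f0 ?addr0 /= ?odd_double //.
  rewrite -!(big_mkord xpredT (fun i => (f i)%:Z)).
  rewrite (@big_cat_nat _ _ _ q.*2.+1) //=; last by rewrite ltnS leq_addr.
  rewrite [X in _ + X]big_nat_cond [X in _ + X]big1 ?addr0 // => i /andP[/andP[i1 i2] _].
  rewrite /f ndressing_small ?muln0 //; lia.
rewrite -posz_sum (sum_even _ f0) posz_sum; apply: eq_bigr => j _.
have jq : (j <= q)%N by rewrite -ltnS.
rewrite coefS; last exact: leq_ltn_trans qM.
rewrite -IH; last 2 first.
- exact: leq_ltn_trans (leq_subr _ _) qM.
- lia.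
rewrite /f -cword_nword PoszM; congr (_ * (@ndressing _ _ _)%:Z); lia.
Qed.

(** A core with [k.+2] chords has 2k+3 letters after erasure, and 2n+3 = 2(n-k) + (2k+3); hence the
    powers x^k and S^(2k+3). *)
Lemma cword_S3Q n : (n < M)%N -> (S ^+ 3 * Q)`_n = (cword n.+1)%:Z.
Proof.
move=> nM; rewrite cword_nword nword_substitution //.
rewrite mulr_sumr coef_sum.
have E (k : 'I_M) : (S ^+ 3 * ((cC2 k.+2)%:Z *: ('X * S ^+ 2) ^+ k))`_n =
    if (k <= n)%N then (cC2 k.+2 * @ndressing n.+1.*2.+1 k.*2.+3 n.+1.*2.+1)%N%:Z else 0.
  rewrite -scalerAr coefZ exprMn -exprM mulrCA coefXnM ltnNge.
  case: leqP => kn; rewrite ?mulr0 //= -exprD PoszM; congr (_ * _).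
  have e1 : (n.+1.*2.+1 = (n - k).*2 + k.*2.+3)%N by lia.
  have e2 : (3 + 2 * k = k.*2.+3)%N by lia.
  rewrite e2 {2}e1 ndressing_coef //; last by rewrite -e1.
  exact: leq_ltn_trans (leq_subr _ _) nM.
rewrite (eq_bigr _ (fun k _ => E k)) -big_mkcond /=.
rewrite -(big_mkord (fun k => (k <= n)%N)
  (fun k => (cC2 k.+2 * @ndressing n.+1.*2.+1 k.*2.+3 n.+1.*2.+1)%N%:Z)).
rewrite (@big_cat_nat _ _ _ n.+1) //= [X in _ + X]big_nat_cond [X in _ + X]big1 ?addr0; last first.
  by move=> k; lia.
rewrite big_mkord [LHS](eq_bigl xpredT); last by move=> k; apply: leq_ord.
pose f i := (nword 1 2 i.+2 * @ndressing n.+1.*2.+1 i.+2 n.+1.*2.+1)%N.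
have -> : (\sum_(2 <= k < n.+1.*2.+2) @ndressing n.+1.*2.+1 k n.+1.*2.+1 * nword 1 2 k =
   \sum_(i < n.+1.*2) f i)%N.
  rewrite -(big_mkord xpredT f) -[2%N]/(0 + 2)%N big_addn; apply: eq_big_nat => i _.
  by rewrite /f mulnC !addn2.
rewrite (sum_odd _ (f := f)); last first.
  by move=> i oi; rewrite /f nword_parity //= negbK; case: (odd i) oi.
rewrite posz_sum; apply: eq_bigr => k _.
by rewrite /f cC2_nword // !doubleS.
Qed.

Lemma coef_cancel (p q r : {poly int}) : q`_0 = 1 ->
  (forall n, (n < M)%N -> (q * p)`_n = (q * r)`_n) -> forall n, (n < M)%N -> p`_n = r`_n.
Proof.
move=> q0 H; elim/ltn_ind=> n IH nM; have := H n nM.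
rewrite !coefM !big_ord_recl /= !subn0 q0 !mul1r.
rewrite (eq_bigr (fun i : 'I_n => q`_(bump 0 i) * r`_(n - bump 0 i))); first by move/addIr.
move=> i _; congr (_ * _); apply: IH; rewrite /bump leq0n add1n.
  by have := ltn_ord i; lia.
exact: leq_ltn_trans (leq_subr _ _) nM.
Qed.

Lemma U11_Q n : (n < M)%N -> (U11 n.+1)%:Z = Q`_n.
Proof.
move=> nM; have M0 := leq_ltn_trans (leq0n n) nM; have -> : (U11 n.+1)%:Z = U`_n by rewrite coef_poly nM.
apply: (@coef_cancel _ (S ^+ 3)) nM => [|{}n {}nM].
  rewrite -horner_coef0 horner_exp horner_coef0 coefS //.
  by rewrite [cword _]cword0 expr1n.
rewrite cword_S3Q // -U11_cword3 !exprS expr0 mulr1 -!mulrA.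
have conv_S u (p : {poly int}) : (forall i, (i < M)%N -> p`_i = (u i)%:Z) ->
    forall i, (i < M)%N -> (S * p)`_i = (conv cword u i)%:Z.
  by apply: coef_conv; apply: coefS.
apply: (conv_S) nM => {}n nM; apply: (conv_S) nM => {}n nM; apply: (conv_S) nM => {}n nM.
by rewrite coef_poly nM.
Qed.

End Series.

Lemma coef_expr_eq (p q : {poly int}) n k : (forall i, (i <= n)%N -> p`_i = q`_i) ->
  forall i, (i <= n)%N -> (p ^+ k)`_i = (q ^+ k)`_i.
Proof.
move=> pq; elim: k => [|k IH] i iln; first by rewrite !expr0.
rewrite !exprS !coefM; apply: eq_bigr => j _; rewrite pq ?IH //.
  exact: leq_trans (leq_subr _ _) iln.
by apply: leq_trans iln; rewrite -ltnS.
Qed.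

(* U11(x) = x * (C_{>=2}(t)/t^2)|_{t = C(x)^2/x} *)
Theorem theorem4p7p10 : forall n : nat,
  fps_of U11 n =
  fps_mulx (fps_comp (fps_divx2 (fps_of cC2))
                     (fps_divx (fps_mul (fps_of cC) (fps_of cC)))) n.
Proof.
case=> [|n]; first by rewrite /fps_of U11_0.
(* The bound [n.+1] makes the truncated sum in [U11_Q] run over the same indices as [fps_comp] at
   degree [n]. *)
rewrite /fps_of /fps_mulx (@U11_Q n.+1) // /fps_comp !coef_sum.
apply: eq_bigr => k _; rewrite !coefZ; congr (_ * _).
apply: (@coef_expr_eq _ _ n) => // i iln.
rewrite coef_poly ltnS iln coefXM /fps_divx /fps_mul /fps_of.
case: i iln => [|i] iln /=.
  by rewrite !big_ord_recl big_ord0 /= cC0 mul0r mulr0.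
(* [cC 0 = 0] kills both end terms of the square of C(x); the rest is the convolution for S^2, so
   C(x)^2/x agrees with x S^2. *)
rewrite big_ord_recl /= cC0 mul0r add0r big_ord_recr /= subnn cC0 mulr0 addr0.
rewrite expr2 coefM; apply: eq_bigr => j _.
have ji : (j <= i)%N by rewrite -ltnS.
rewrite /bump leq0n add1n !coefS; try lia.
rewrite /cword; congr (_ * (cC _)%:Z); lia.
Qed.
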